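(* Let $N\ge 1$, $R>0$, and let $f\colon [0,R]\times\mathbb{R}\times[0,+\infty[\to\,]-\infty,+\infty]$ be a normal integrand such that for almost every $(r,t)\in[0,R]\times\mathbb{R}$ the map $s\mapsto f(r,t,s)$ is monotone non-decreasing. Define $$F(u):=\int_{B_R} f(|x|,u(x),|\nabla u(x)|)\,dx\quad (u\in W^{1,1}_0(B_R)),\qquad F_{\mathrm{rad}}(u):=\int_0^R r^{N-1} f(r,u(r),|u'(r)|)\,dr\quad (u\in\mathcal{W}^1_{\mathrm{rad}}).$$ Then the minimization problem $\min\{F(u):\ u\in W^{1,1}_0(B_R)\}$ admits a solution if and only if the one-dimensional minimization problem $\min\{F_{\mathrm{rad}}(u):\ u\in\mathcal{W}^1_{\mathrm{rad}}\}$ admits a solution.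
   Context: $B_R\subset\mathbb{R}^N$ is the open ball centered at the origin with radius $R$, and $|\cdot|$ is the Euclidean norm. The space $\mathcal{W}^1_{\mathrm{rad}}$ is $$\mathcal{W}^1_{\mathrm{rad}}:=\{u\in AC_{\mathrm{loc}}(]0,R]):\ u(R)=0,\ r^{N-1}|u'(r)|\in L^1(]0,R[)\}.$$ A function $f\colon[0,R]\times\mathbb{R}\times[0,+\infty[\to\,]-\infty,+\infty]$ is a normal integrand if $f(r,\cdot,\cdot)$ is lower semicontinuous for a.e. $r\in[0,R]$ and there exists a Borel function $\widehat f\colon[0,R]\times\mathbb{R}\times[0,+\infty[\to\,]-\infty,+\infty]$ such that $\widehat f(r,\cdot,\cdot)=f(r,\cdot,\cdot)$ for a.e. $r\in[0,R]$. Extended real-valued functions, including the functionals $F$ and $F_{\mathrm{rad}}$, are assumed to be proper: they take values in $]-\infty,+\infty]$ and are not identically $+\infty$. *)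

(* Defs.v *)
From HB Require Import structures.
From mathcomp Require Import all_boot all_order all_algebra.
From mathcomp Require Import all_classical all_reals all_analysis.
From mathcomp Require Import measurable_realfun.

Set Implicit Arguments.
Unset Strict Implicit.
Unset Printing Implicit Defensive.

Import Order.TTheory GRing.Theory Num.Theory.
Import numFieldNormedType.Exports.

Local Open Scope classical_set_scope.
Local Open Scope ring_scope.

(* R^n is 'rV[R]_n.  It carries the sigma-algebra generated by the coordinates,
   that is, its Borel sigma-algebra; the construction mirrors the one of the
   library for n.-tuple T. *)
Definition row_display : measure_display.
Proof. exact: default_measure_display. Qed.

Section row_measurable.
Context {R : realType} (n : nat).

Let coord : 'I_n -> 'rV[R]_n -> measurableTypeR R := fun i x => x ord0 i.

Let row_set0 : g_sigma_preimage coord set0.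
Proof. exact: sigma_algebra0. Qed.

Let row_setC A : g_sigma_preimage coord A -> g_sigma_preimage coord (~` A).
Proof. exact: sigma_algebraC. Qed.

Let row_bigcup (F : _^nat) : (forall i, g_sigma_preimage coord (F i)) ->
  g_sigma_preimage coord (\bigcup_i (F i)).
Proof. exact: sigma_algebra_bigcup. Qed.

HB.instance Definition _ :=
  @isMeasurable.Build row_display
    'rV[R]_n (g_sigma_preimage coord) row_set0 row_setC row_bigcup.

End row_measurable.

Section row_cons.
Context {R : realType} (n : nat).

Definition row_cons (p : measurableTypeR R * 'rV[R]_n) : 'rV[R]_n.+1 :=
  \row_i oapp (p.2 ord0) p.1 (unlift ord0 i).

Definition row_uncons (x : 'rV[R]_n.+1) : measurableTypeR R * 'rV[R]_n :=
  (x ord0 ord0, \row_i x ord0 (lift ord0 i)).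

Lemma row_consK : cancel row_cons row_uncons.
Proof.
case=> t v; rewrite /row_uncons /row_cons !mxE unlift_none/=; congr pair.
by apply/rowP => i; rewrite !mxE liftK.
Qed.

End row_cons.

Section row_measurability.
Context {R : realType}.

Lemma measurable_coord n (i : 'I_n) :
  measurable_fun [set: 'rV[R]_n] (fun x => x ord0 i : measurableTypeR R).
Proof.
move=> _ Y mY; rewrite setTI; apply: sub_sigma_algebra => /=.
rewrite -bigcup_seq/=; exists i => /=; first by rewrite mem_index_enum.
by exists Y => //; rewrite setTI.
Qed.

Lemma measurable_fun_row d (T : measurableType d) n (f : T -> 'rV[R]_n) :
  (forall i, measurable_fun [set: T] (fun x => f x ord0 i : measurableTypeR R)) ->
  measurable_fun [set: T] f.
Proof.
move=> mf.
suff prefS : g_sigma_preimage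
    (fun i => (fun x : 'rV[R]_n => x ord0 i : measurableTypeR R) \o f)
    `<=` measurable.
  by move=> _ A mA; apply: prefS; rewrite g_sigma_preimage_comp; exists A.
apply: smallest_sub; first exact: sigma_algebra_measurable.
case: n => [|n] in f mf *; first by rewrite big_ord0.
rewrite -bigcup_mkord_ord; apply: bigcup_sub => i Ii.
by move=> A [B mB <-]; exact: mf.
Qed.

Lemma measurable_row_cons n : measurable_fun setT (@row_cons R n).
Proof.
apply: measurable_fun_row => i; case: (unliftP ord0 i) => [j|] ->.
  rewrite (_ : (fun _ => _) = (fun x : 'rV[R]_n => x ord0 j) \o snd).
    by apply: measurableT_comp; [exact: measurable_coord|exact: measurable_snd].
  by apply/funext => p; rewrite /= mxE liftK.
rewrite (_ : (fun _ => _) = fst); first exact: measurable_fst.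
by apply/funext => p; rewrite /= mxE unlift_none.
Qed.

Lemma measurable_row_uncons n : measurable_fun setT (@row_uncons R n).
Proof.
apply: measurable_fun_pair; first exact: measurable_coord.
apply: measurable_fun_row => i.
rewrite (_ : (fun _ => _) = (fun x : 'rV[R]_n.+1 => x ord0 (lift ord0 i))).
  exact: measurable_coord.
by apply/funext => x; rewrite mxE.
Qed.

End row_measurability.

Section lebesgue_row_succ.
Context {R : realType} (n : nat).
Variable mu : {sigma_finite_measure set 'rV[R]_n -> \bar R}.

Definition lebesgue_row_succ : set 'rV[R]_n.+1 -> \bar R :=
  pushforward (@lebesgue_measure R \x mu)%E (@row_cons R n).

Let nu : {measure set (measurableTypeR R * 'rV[R]_n)%type -> \bar R} :=
  (@lebesgue_measure R \x mu)%E.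

Let measurable_preimage_row_cons A :
  measurable A -> measurable (@row_cons R n @^-1` A).
Proof. by move=> mA; rewrite -[X in measurable X]setTI; exact: measurable_row_cons. Qed.

Let lebesgue_row_succ0 : lebesgue_row_succ set0 = 0%E.
Proof. by rewrite /lebesgue_row_succ /pushforward preimage_set0 measure0. Qed.

Let lebesgue_row_succ_ge0 A : (0 <= lebesgue_row_succ A)%E.
Proof. exact: (@measure_ge0 _ _ _ nu). Qed.

Let lebesgue_row_succ_sigma_additive : semi_sigma_additive lebesgue_row_succ.
Proof.
move=> F mF tF mUF; rewrite /lebesgue_row_succ /pushforward preimage_bigcup.
apply: (@measure_semi_sigma_additive _ _ _ nu).
- by move=> k; exact: measurable_preimage_row_cons.
- apply/trivIsetP => /= i j _ _ ij; rewrite -preimage_setI.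
  by move/trivIsetP : tF => /(_ _ _ _ _ ij) ->//; rewrite preimage_set0.
- by rewrite -preimage_bigcup; exact: measurable_preimage_row_cons.
Qed.

HB.instance Definition _ := isMeasure.Build _ _ _ lebesgue_row_succ
  lebesgue_row_succ0 lebesgue_row_succ_ge0 lebesgue_row_succ_sigma_additive.

Let lebesgue_row_succ_sigma_finite : sigma_finite setT lebesgue_row_succ.
Proof.
have /sigma_finiteP[A [TA ndA Aoo]] := sigma_finiteT (@lebesgue_measure R).
have /sigma_finiteP[B [TB ndB Boo]] := sigma_finiteT mu.
exists (fun k => @row_uncons R n @^-1` (A k `*` B k)).
  apply/esym; rewrite -subTset => x _.
  have [k _ Ak] : (\bigcup_k A k) (row_uncons x).1 by rewrite -TA.
  have [l _ Bl] : (\bigcup_k B k) (row_uncons x).2 by rewrite -TB.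
  exists (maxn k l) => //; split.
  - by move: Ak; exact/subsetPset/ndA/leq_maxl.
  - by move: Bl; exact/subsetPset/ndB/leq_maxr.
move=> k; have [mA ?] := Aoo k; have [mB ?] := Boo k; split.
  rewrite -[X in measurable X]setTI; apply: measurable_row_uncons => //.
  exact: measurableX.
rewrite /lebesgue_row_succ /pushforward (_ : _ @^-1` _ = A k `*` B k).
  by rewrite product_measure1E// lte_mul_pinfty// ge0_fin_numE.
have consK : @row_uncons R n \o @row_cons R n = id.
  by apply/funext => p; exact: row_consK.
by rewrite -[RHS]preimage_id -consK.
Qed.

HB.instance Definition _ := Measure_isSigmaFinite.Build _ _ _ lebesgue_row_succ
  lebesgue_row_succ_sigma_finite.

End lebesgue_row_succ.

(* Lebesgue measure on R^n: a Dirac mass for n = 0, then n-fold product with the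
   one-dimensional Lebesgue measure. *)
Fixpoint lebesgue_row {R : realType} (n : nat) :
    {sigma_finite_measure set 'rV[R]_n -> \bar R} :=
  match n with
  | 0 => \d_(0 : 'rV[R]_0)
  | n'.+1 => lebesgue_row_succ (@lebesgue_row R n')
  end.

Lemma lebesgue_row_box {R : realType} n (A : 'I_n -> set (measurableTypeR R)) :
  (forall i, measurable (A i)) ->
  lebesgue_row n [set x : 'rV[R]_n | forall i, A i (x ord0 i)] =
  (\prod_(i < n) lebesgue_measure (A i))%E.
Proof.
elim: n A => [|n IHn] A mA /=.
  rewrite big_ord0 diracE (_ : _ \in _ = true)//; apply/mem_set.
  by case.
rewrite big_ord_recl -IHn => [|i]; last exact: mA.
rewrite /lebesgue_row_succ /pushforward.
rewrite (_ : _ @^-1` _ = A ord0 `*`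
    [set x : 'rV[R]_n | forall i, A (lift ord0 i) (x ord0 i)]); last first.
  apply/seteqP; split => [[t v] /= h|[t v] /= [ht hv] i].
    split; first by have := h ord0; rewrite mxE unlift_none.
    by move=> i; have := h (lift ord0 i); rewrite mxE liftK.
  by rewrite mxE; case: unliftP => [j|] ->.
rewrite product_measure1E//.
rewrite (_ : [set _ | _] = \bigcap_(i in [set: 'I_n])
    ((fun x : 'rV[R]_n => x ord0 i : measurableTypeR R) @^-1` A (lift ord0 i))).
  apply: fin_bigcap_measurable => [|i _]; first exact: finite_finset.
  by rewrite -[X in measurable X]setTI; exact: measurable_coord.
by apply/seteqP; split => x /= h i => [_|]; exact: h.
Qed.

Section minimization.
Context {T : Type} {R : realType}.
Implicit Types (A : set T) (G : T -> \bar R).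

Definition proper_on A G :=
  (forall x, A x -> -oo < G x)%E /\ (exists2 x, A x & (G x < +oo)%E).

Definition has_minimizer A G :=
  exists2 x, A x & forall y, A y -> (G x <= G y)%E.

End minimization.

Section sobolev.
Context {R : realType} (n : nat).
Implicit Types (Om : set 'rV[R]_n) (u phi : 'rV[R]_n -> R).

(* The norm `|x| of the library on 'rV[R]_n is the sup norm. *)
Definition eucl_norm (x : 'rV[R]_n) : R := Num.sqrt (\sum_i x ord0 i ^+ 2).

Definition eucl_ball (rho : R) : set 'rV[R]_n := [set x | eucl_norm x < rho].

Definition partial (i : 'I_n) phi : 'rV[R]_n -> R :=
  fun x => 'D_(delta_mx ord0 i) phi x.

Definition partials (s : seq 'I_n) phi := foldr partial phi s.

Definition smooth phi := forall s : seq 'I_n, continuous (partials s phi) /\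
  forall i x, derivable (partials s phi) x (delta_mx ord0 i).

Definition test_function Om phi := [/\ smooth phi,
  compact (closure [set x | phi x != 0]) &
  closure [set x | phi x != 0] `<=` Om].

Definition weak_gradient Om u (g : 'rV[R]_n -> 'rV[R]_n) := forall i : 'I_n,
  (lebesgue_row n).-integrable Om (fun x => (g x ord0 i)%:E) /\
  forall phi, test_function Om phi ->
    (\int[lebesgue_row n]_(x in Om) (u x * partial i phi x)%:E =
     - \int[lebesgue_row n]_(x in Om) (g x ord0 i * phi x)%:E)%E.

Definition W11 Om : set ('rV[R]_n -> R) := [set u |
  (lebesgue_row n).-integrable Om (EFin \o u) /\ exists g, weak_gradient Om u g].

(* Well defined up to a negligible set for u in W11 Om. *)
Definition grad Om u : 'rV[R]_n -> 'rV[R]_n := get (weak_gradient Om u).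

Definition W11_norm Om u : \bar R :=
  (\int[lebesgue_row n]_(x in Om) `|u x|%:E +
   \int[lebesgue_row n]_(x in Om) (eucl_norm (grad Om u x))%:E)%E.

Definition W110 Om : set ('rV[R]_n -> R) := [set u | W11 Om u /\
  exists phi_ : nat -> 'rV[R]_n -> R,
    (forall k, test_function Om (phi_ k)) /\
    W11_norm Om (u \- phi_ k) @[k --> \oo] --> 0%E].

End sobolev.

Section radial.
Context {R : realType}.
Implicit Types (u : R -> R) (a b rho : R).

Definition absolutely_continuous a b u := forall e : R, 0 < e ->
  exists2 d : R, 0 < d & forall m (s t : 'I_m -> R),
    (forall k, [/\ a <= s k, s k <= t k & t k <= b]) ->
    trivIset setT (fun k => [set` `]s k, t k[]) ->
    \sum_k (t k - s k) < d -> \sum_k `|u (t k) - u (s k)| < e.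

Definition AC_loc rho u :=
  forall a b, 0 < a -> a <= b -> b <= rho -> absolutely_continuous a b u.

(* An element of W_rad is represented by a function on R of which only the
   restriction to ]0, rho] matters; derive1 u is the classical derivative, which
   exists a.e. and takes a junk value elsewhere. *)
Definition Wrad (N : nat) rho : set (R -> R) := [set u |
  [/\ AC_loc rho u, u rho = 0 &
      lebesgue_measure.-integrable `]0, rho[
        (fun r => (r ^+ N.-1 * `|derive1 u r|)%:E)]].

End radial.

Section integrands.
Context {R : realType}.
Implicit Types (rho : R) (f : R -> R -> R -> \bar R).

(* An integrand is a total curried function of which only the values on
   [0, rho] x R x [0, +oo[ matter. *)
Definition integrand_domain rho : set (R * R * R) :=
  (`[0, rho] `*` setT) `*` `[0, +oo[.

Definition uncurry3 f : R * R * R -> \bar R := fun p => f p.1.1 p.1.2 p.2.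

Definition normal_integrand rho f :=
  {ae lebesgue_measure, forall r : R, r \in `[0, rho] ->
    lower_semicontinuous
      (fun p : subspace ([set: R] `*` `[0 : R, +oo[) => f r p.1 p.2)} /\
  exists fhat : R -> R -> R -> \bar R,
    [/\ forall p, integrand_domain rho p -> (-oo < uncurry3 fhat p)%E,
        measurable_fun (integrand_domain rho) (uncurry3 fhat) &
        {ae lebesgue_measure, forall r : R, r \in `[0, rho] ->
          forall t s, 0 <= s -> fhat r t s = f r t s}].

Definition ae_nondecreasing rho f :=
  {ae (lebesgue_measure \x lebesgue_measure)%E,
    forall p : R * R, p.1 \in `[0, rho] ->
    forall s s' : R, 0 <= s -> s <= s' -> (f p.1 p.2 s <= f p.1 p.2 s')%E}.

(* The integral of the library is the integral of the positive part minus that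
   of the negative part, with +oo - +oo = -oo: it differs from -oo exactly when
   the negative part has a finite integral. *)
Definition Fball (N : nat) rho f (u : 'rV[R]_N -> R) : \bar R :=
  (\int[lebesgue_row N]_(x in eucl_ball rho)
    f (eucl_norm x) (u x) (eucl_norm (grad (eucl_ball rho) u x)))%E.

Definition Frad (N : nat) rho f (u : R -> R) : \bar R :=
  (\int[lebesgue_measure]_(r in `]0%R, rho[)
    ((r ^+ N.-1)%:E * f r (u r) `|derive1 u r|%R))%E.

End integrands.

(* Main.v *)
Require Import Defs.
From HB Require Import structures.
From mathcomp Require Import all_boot all_order all_algebra.
From mathcomp Require Import all_classical all_reals all_analysis.
From mathcomp Require Import measurable_realfun.
From mathcomp Require Import lra.

Set Implicit Arguments.
Unset Strict Implicit.
Unset Printing Implicit Defensive.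

Import Order.TTheory GRing.Theory Num.Theory.
Import numFieldNormedType.Exports.

Local Open Scope classical_set_scope.
Local Open Scope ring_scope.

(* Write A for the annulus 1 < |y| < 2, whose rays replace the unit sphere: there is
   0 < K < oo with K \int g dx = \int_A \int_0^oo s^(N-1) g(s y/|y|) ds dy, by scaling
   and Tonelli. Two comparisons give both directions. (1) If v is in W_rad, then
   v(|x|) is in W^{1,1}_0 with gradient of norm |v'(|x|)|, so that
   K F(v(|.|)) = |A| F_rad(v). (2) If F(w) is finite, some v in W_rad has
   |A| F_rad(v) <= K F(w). Indeed, for a.e. y the restriction of w to the ray through y
   belongs to W_rad, with derivative the radial component of grad w; the monotonicity
   of f bounds the integrand of F_rad on that restriction by that of F on the ray, and
   a ray with at most the average energy exists.
   Monotonicity may fail on a null set M of pairs (r, t), and (|x|, w(x)) may well lie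
   in M on a set of positive measure. But there grad w is radial: the rotations
   X = x_i d_j - x_j d_i annihilate |x|, so by the chain rule
   \int a(|x|^2) b(w) Xw psi = - \int a(|x|^2) B(w) X psi with B' = b, which expresses
   the image under (|x|^2, w) of the signed measure Xw psi dx as an integral over pairs
   (x, t) with t < w(x). The latter does not charge M, hence Xw = 0 a.e. where
   (|x|, w) is in M, and there |grad w| equals the modulus of its radial component. *)

(** With N = n + 1, a function v in W_rad may be unbounded at 0, but r^n |v(r)| <= \int_0^rho t^n
    |v'(t)| dt, so the weighted L^1 norm of v' controls both v(|.|) and its gradient in L^1 of the
    ball. Test functions are taken of the form V(|x|^2), because |x| is not smooth at the origin;
    with V' = q/2, this reduces membership of v(|.|) in W^{1,1}_0 to the density in L^1(]0, rho[) of
    the functions t^(n+1) q(t^2). Three points of rigour shape the rest. The integrand f coincides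
    with a Borel function for a.e. r only, so integrals are compared a.e. without measurability, and
    f is replaced by that function before Tonelli is used. Comparison (2) needs F(w) > -oo, which
    properness gives: then both parts of the integrand are integrable, and the averaging over rays
    is done on their difference. Finally [grad] is an arbitrary choice among weak gradients, so
    comparing it with an explicit gradient goes through uniqueness a.e. *)

(** * Integrals of non-measurable functions *)

Section ae_integral.
Local Open Scope ereal_scope.
Context d (T : measurableType d) (R : realType).
Variable mu : {measure set T -> \bar R}.
Implicit Types (f g : T -> \bar R) (D : set T).

Import HBNNSimple.

(** A simple function below [f], once set to 0 on a measurable null set containing the exceptional
    points, is a simple function below [g] with the same integral; hence the suprema compare. *)
Let ge0_ae_le_integral f g : (forall x, 0 <= f x) -> (forall x, 0 <= g x) ->
  {ae mu, forall x, f x <= g x} -> \int[mu]_x f x <= \int[mu]_x g x.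
Proof.
move=> f0 g0 [N [mN N0 fgN]]; rewrite !ge0_integralTE//; apply: ge_ereal_sup => _ [h /= hf <-].
have mCN : measurable (~` N) by exact: measurableC.
have [h' h'E] : exists h' : {nnsfun T >-> R},
    forall x, h' x = (h x * \1_(~` N) x)%R.
  by exists (proj_nnsfun h mCN) => x /=; rewrite mindicE indicE.
have -> : sintegral mu h = sintegral mu h'.
  rewrite -!integralT_nnsfun.
  apply: ge0_ae_eq_integral => //; [exact/measurable_EFinP|exact/measurable_EFinP| | |].
  - by move=> x _; rewrite lee_fin fun_ge0.
  - by move=> x _; rewrite lee_fin fun_ge0.
  exists N; split => // x /= hx; apply: contrapT => Nx; apply: hx => _.
  by rewrite h'E indicE mem_set// mulr1.
apply: ereal_sup_ubound; exists h' => //= x; rewrite h'E indicE.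
have [Nx|Nx] := pselect (N x); last first.
  rewrite mem_set// mulr1; apply: (le_trans (hf x)).
  by apply: contrapT => fgx; apply: Nx; exact: fgN.
by rewrite memNset ?mulr0//; exact/contrapT.
Qed.

(* No measurability is assumed: the integral is a supremum over simple functions. *)
Lemma ae_le_integral f g D : {ae mu, forall x, D x -> f x <= g x} ->
  \int[mu]_(x in D) f x <= \int[mu]_(x in D) g x.
Proof.
move=> fg; rewrite integralE [leRHS]integralE; apply: leeB.
- rewrite integral_mkcond [leRHS]integral_mkcond; apply: ge0_ae_le_integral.
  + by move=> x; rewrite patchE; case: ifP.
  + by move=> x; rewrite patchE; case: ifP.
  apply: filterS fg => x fgx; rewrite /patch /=.
  case: ifPn => // /set_mem Dx; have {}fgx := fgx Dx; rewrite unlock.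
  by rewrite ge_max !le_max fgx lexx orbT.
- rewrite integral_mkcond [leRHS]integral_mkcond; apply: ge0_ae_le_integral.
  + by move=> x; rewrite patchE; case: ifP.
  + by move=> x; rewrite patchE; case: ifP.
  apply: filterS fg => x fgx; rewrite /patch /=.
  case: ifPn => // /set_mem Dx; have {}fgx := fgx Dx; rewrite unlock.
  by rewrite ge_max !le_max leeN2 fgx lexx orbT.
Qed.

Lemma ae_eq_integralT f g D : {ae mu, forall x, D x -> f x = g x} ->
  \int[mu]_(x in D) f x = \int[mu]_(x in D) g x.
Proof.
move=> fg; apply/eqP; rewrite eq_le; apply/andP; split; apply: ae_le_integral.
  by apply: filterS fg => x + Dx => ->.
by apply: filterS fg => x + Dx => ->.
Qed.

Lemma le_integralT f g D : (forall x, D x -> f x <= g x) ->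
  \int[mu]_(x in D) f x <= \int[mu]_(x in D) g x.
Proof. by move=> fg; apply: ae_le_integral; exact/nearW. Qed.

Lemma le_integral_sub f D E : D `<=` E -> (forall x, E x -> 0 <= f x) ->
  \int[mu]_(x in D) f x <= \int[mu]_(x in E) f x.
Proof.
move=> DE f0; rewrite integral_mkcond [leRHS]integral_mkcond; apply: le_integralT => x _.
rewrite !patchE; case: ifPn => [/set_mem/DE/mem_set->//|_].
by case: ifPn => // /set_mem/f0.
Qed.

End ae_integral.

(** * Lebesgue measure on row vectors *)

Section lebesgue_row_theory.
Context {R : realType}.
Notation leb := (@lebesgue_measure R).

Definition row_box n (A : 'I_n -> set (measurableTypeR R)) : set 'rV[R]_n :=
  [set x | forall i, A i (x ord0 i)].

Definition row_boxes n : set (set 'rV[R]_n) :=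
  [set row_box A | A in [set A | forall i, measurable (A i)]].

Lemma measurable_row_box n (A : 'I_n -> set (measurableTypeR R)) :
  (forall i, measurable (A i)) -> measurable (row_box A).
Proof.
move=> mA; rewrite (_ : row_box A = \bigcap_(i in [set: 'I_n])
    ((fun x : 'rV[R]_n => x ord0 i : measurableTypeR R) @^-1` A i)).
  apply: fin_bigcap_measurable => [|i _]; first exact: finite_finset.
  by rewrite -[X in measurable X]setTI; exact: measurable_coord.
by apply/seteqP; split => x /= h i => [_|]; exact: h.
Qed.

Lemma measurable_row_boxesE n : measurable = <<s @row_boxes n >>.
Proof.
apply/seteqP; split; last first.
  apply: smallest_sub; first exact: sigma_algebra_measurable.
  by move=> _ [A mA <-]; exact: measurable_row_box.
apply: smallest_sub; first exact: smallest_sigma_algebra.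
rewrite -bigcup_seq => X [i _ [Y mY <-]]; apply: sub_sigma_algebra.
exists (fun j => if j == i then Y else setT); first by move=> j; case: ifP.
rewrite setTI; apply/seteqP; split => x /=; first by move=> /(_ i); rewrite eqxx.
by move=> Yx j; case: eqP => // ->.
Qed.

Lemma row_boxes_setI n : setI_closed (@row_boxes n).
Proof.
move=> _ _ [A mA <-] [B mB <-]; exists (fun i => A i `&` B i).
  by move=> i; exact: measurableI.
by apply/seteqP; split=> [x h|x [hA hB] i]; [split => i; case: (h i)|split].
Qed.

Lemma lebesgue_row_boxE n (A : 'I_n -> set (measurableTypeR R)) :
  (forall i, measurable (A i)) ->
  lebesgue_row n (row_box A) = (\prod_(i < n) leb (A i))%E.
Proof. exact: lebesgue_row_box. Qed.

(** Boxes form a pi-system generating the sigma-algebra, and the cubes [-k, k]^n exhaust the space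
    with finite measure. This identifies the images of the measure under insertion of a coordinate
    and under dilation. *)
Lemma lebesgue_row_unique n (m : {measure set 'rV[R]_n -> \bar R}) :
  (forall A, (forall i, measurable (A i)) ->
    m (row_box A) = (\prod_(i < n) leb (A i))%E) ->
  forall X, measurable X -> lebesgue_row n X = m X.
Proof.
move=> mE X mX.
pose g (k : nat) := row_box (fun _ : 'I_n => `[- k%:R, k%:R]%classic : set (measurableTypeR R)).
apply: (measure_unique (@row_boxes n) g) => //.
- exact: measurable_row_boxesE.
- exact: row_boxes_setI.
- by move=> k; exists (fun _ => `[- k%:R, k%:R]%classic) => // i; exact: measurable_itv.
- apply/seteqP; split => // x _.
  have [k xk] : exists k : nat, forall i : 'I_n, `|x ord0 i| <= k%:R.
    exists (Num.truncn `|x|).+1 => i; apply: (@le_trans _ _ `|x|).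
      rewrite [leRHS]mx_normrE.
      by apply: (le_bigmax _ (fun ij => `|x ij.1 ij.2|) (ord0, i)).
    exact/ltW/truncnS_gt.
  by exists k => // i; rewrite /= in_itv /= -ler_norml.
- by move=> _ [A mA <-]; rewrite mE//; exact: lebesgue_row_boxE.
- move=> k; suff : (\prod_(i < n) leb `[(- k%:R)%R, k%:R] < +oo)%E.
    by rewrite -(lebesgue_row_boxE (fun i : 'I_n => measurable_itv `[- k%:R, k%:R])).
  rewrite (eq_bigr (fun _ => ((k%:R - - k%:R) : R)%:E)); last first.
    move=> i _; rewrite lebesgue_measure_itv/= lte_fin.
    have [|] := boolP (- k%:R < k%:R :> R) => // /negbTE; case: k => [|k].
      by rewrite oppr0 subrr.
    by rewrite gtrN// ltr0n.
  by rewrite prodEFin ltry.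
Qed.

(** [row_cons] with the new coordinate at position [i] instead of 0, so that the integral along any
    coordinate direction can be taken first. *)
Definition row_insert n (i : 'I_n.+1) (p : measurableTypeR R * 'rV[R]_n) :
  'rV[R]_n.+1 := \row_j oapp (p.2 ord0) p.1 (unlift i j).

Lemma measurable_row_insert n (i : 'I_n.+1) : measurable_fun setT (row_insert i).
Proof.
apply: measurable_fun_row => j; case: (unliftP i j) => [k|] ->.
  rewrite (_ : (fun _ => _) = (fun x : 'rV[R]_n => x ord0 k) \o snd).
    by apply: measurableT_comp; [exact: measurable_coord|exact: measurable_snd].
  by apply/funext => p; rewrite /= mxE liftK.
rewrite (_ : (fun _ => _) = fst); first exact: measurable_fst.
by apply/funext => p; rewrite /= mxE unlift_none.
Qed.

Lemma lebesgue_row_insert n (i : 'I_n.+1) X : measurable X ->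
  lebesgue_row n.+1 X =
  pushforward (leb \x lebesgue_row n)%E (@row_insert n i) X.
Proof.
move: X; pose nu : {measure set (measurableTypeR R * 'rV[R]_n)%type -> \bar R} :=
  (leb \x lebesgue_row n)%E.
pose m := measure_function_pushforward__canonical__measure_function_Measure
  nu (measurable_row_insert i).
apply: (lebesgue_row_unique (m := m)) => A mA /=.
rewrite /pushforward (_ : _ @^-1` _ = A i `*` row_box (fun j => A (lift i j))).
  rewrite /nu product_measure1E//; last exact: measurable_row_box.
  by rewrite lebesgue_row_boxE// (bigD1_ord i).
apply/seteqP; split => [[t v] /= h|[t v] /= [ht hv] j].
  split; first by have := h i; rewrite mxE unlift_none.
  by move=> j; have := h (lift i j); rewrite mxE liftK.
by rewrite mxE; case: unliftP => [k|] ->.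
Qed.

Definition prod_row n : {measure set (measurableTypeR R * 'rV[R]_n)%type -> \bar R} :=
  (leb \x lebesgue_row n)%E.

Lemma ge0_integral_prod_row n (F : measurableTypeR R * 'rV[R]_n -> \bar R) :
  measurable_fun setT F -> (forall x, 0 <= F x)%E ->
  (\int[prod_row n]_p F p = \int[lebesgue_row n]_v \int[leb]_t F (t, v))%E.
Proof.
move=> mF F0; rewrite -(fubini_tonelli (m1 := leb) (m2 := lebesgue_row n))//.
exact: (fubini_tonelli1 (m1 := leb) (m2 := lebesgue_row n)).
Qed.

Lemma lebesgue_row_insert_eq n (i : 'I_n.+1) (F : 'rV[R]_n.+1 -> \bar R) :
  (\int[lebesgue_row n.+1]_x F x =
   \int[measure_function_pushforward__canonical__measure_function_Measure
     (prod_row n) (measurable_row_insert i)]_x F x)%E.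
Proof. by apply: eq_measure_integral => A mA _; exact: lebesgue_row_insert. Qed.

Lemma ge0_integral_row_insert n (i : 'I_n.+1) (F : 'rV[R]_n.+1 -> \bar R) :
  measurable_fun setT F -> (forall x, 0 <= F x)%E ->
  (\int[lebesgue_row n.+1]_x F x =
   \int[lebesgue_row n]_v \int[leb]_t F (row_insert i (t, v)))%E.
Proof.
move=> mF F0; rewrite (lebesgue_row_insert_eq i).
have mFi : measurable_fun setT (F \o row_insert i).
  by apply: measurableT_comp => //; exact: measurable_row_insert.
have <- := ge0_integral_prod_row mFi (fun p => F0 _).
exact: (ge0_integral_pushforward (measurable_row_insert i) (prod_row n) measurableT mF (fun x _ => F0 x)).
Qed.

Lemma integral_row_insert n (i : 'I_n.+1) (F : 'rV[R]_n.+1 -> \bar R) :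
  (lebesgue_row n.+1).-integrable setT F ->
  (\int[lebesgue_row n.+1]_x F x =
   \int[lebesgue_row n]_v \int[leb]_t F (row_insert i (t, v)))%E.
Proof.
move=> iF; have mF : measurable_fun setT F by case/integrableP: iF.
have mFi : measurable_fun setT (F \o row_insert i).
  by apply: measurableT_comp => //; exact: measurable_row_insert.
have iFi : (prod_row n).-integrable setT (F \o row_insert i).
  apply/integrableP; split => //.
  case/integrableP: iF => _; apply: le_lt_trans.
  rewrite (ge0_integral_row_insert i)//; last exact: measurableT_comp.
  by rewrite ge0_integral_prod_row//; exact: measurableT_comp.
rewrite (lebesgue_row_insert_eq i).
transitivity (\int[prod_row n]_p (F \o row_insert i) p)%E.
  exact: (integral_pushforward (measurable_row_insert i) (mu := prod_row n) (D := setT)).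
rewrite -(Fubini (m1 := leb) (m2 := lebesgue_row n) (f := F \o row_insert i))//.
exact/esym/(integral12_prod_meas1 iFi).
Qed.

Lemma lebesgue_measure_scale (r : R) (A : set R) : 0 < r -> measurable A ->
  leb A = (r%:E * leb ( *%R r @^-1` A))%E.
Proof.
move=> r0; pose c := NngNum (ltW r0).
have mr : measurable_fun setT ( *%R r : measurableTypeR R -> measurableTypeR R).
  exact: mulrl_measurable.
pose pf := pushforward leb ( *%R r : measurableTypeR R -> measurableTypeR R).
pose m1 := measure_function_pushforward__canonical__measure_function_Measure leb mr.
pose m := mscale c m1.
move=> mA; rewrite -[RHS]/(m A).
apply: lebesgue_measure_unique => // _ [[a b]] _ <-.
rewrite -[RHS]/(r%:E * leb ( *%R r @^-1` `]a, b]))%E.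
rewrite (_ : _ @^-1` _ = `]r^-1 * a, r^-1 * b]%classic).
  rewrite !lebesgue_measure_itv/= !lte_fin ltr_pM2l ?invr_gt0//.
  case: ifPn => _; last by rewrite mule0.
  by rewrite -!EFinB -EFinM -mulrBr mulrA divff ?gt_eqF// mul1r.
apply/seteqP; split => x /=; rewrite !in_itv/= => /andP[h1 h2].
  by rewrite ltr_pdivrMl// h1 ler_pdivlMl.
by rewrite -ltr_pdivrMl// h1 -ler_pdivlMl.
Qed.

Lemma ge0_integral_scale (r : R) (q : R -> \bar R) : 0 < r ->
  measurable_fun setT q -> (forall s, 0 <= q s)%E ->
  (\int[leb]_s q s = r%:E * \int[leb]_s q (r * s)%R)%E.
Proof.
move=> r0 mq q0; pose c := NngNum (ltW r0).
have mr : measurable_fun setT ( *%R r : measurableTypeR R -> measurableTypeR R).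
  exact: mulrl_measurable.
pose m1 := measure_function_pushforward__canonical__measure_function_Measure leb mr.
transitivity (\int[mscale c m1]_s q s)%E.
  apply: eq_measure_integral => A mA _; exact: lebesgue_measure_scale.
rewrite ge0_integral_mscale//; congr (_ * _)%E.
by rewrite ge0_integral_pushforward.
Qed.

Lemma measurable_row_scale n (r : R) :
  measurable_fun setT (fun x : 'rV[R]_n => r *: x).
Proof.
apply: measurable_fun_row => i.
rewrite (_ : (fun x : 'rV[R]_n => (r *: x) ord0 i) =
    (fun t => r * t : measurableTypeR R) \o (fun x => x ord0 i)); last first.
  by apply/funext => x; rewrite /= mxE.
by apply: measurableT_comp; [exact: mulrl_measurable|exact: measurable_coord].
Qed.

Lemma ge0_integral_row_scale n (r : R) (q : 'rV[R]_n -> \bar R) : 0 < r ->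
  measurable_fun setT q -> (forall x, 0 <= q x)%E ->
  (\int[lebesgue_row n]_x q x = (r ^+ n)%:E * \int[lebesgue_row n]_x q (r *: x)%R)%E.
Proof.
move=> r0 mq q0; pose c := NngNum (ltW (exprn_gt0 n r0)).
have mr : measurable_fun setT ( *%R r : measurableTypeR R -> measurableTypeR R).
  exact: mulrl_measurable.
pose m1 := measure_function_pushforward__canonical__measure_function_Measure (lebesgue_row n) (@measurable_row_scale n r).
pose m := mscale c m1.
transitivity (\int[m]_x q x)%E.
  apply: eq_measure_integral => X mX _; apply: (lebesgue_row_unique (m := m)) => //.
  move=> A mA; rewrite -[LHS]/((r ^+ n)%:E * lebesgue_row n ((fun x => r *: x) @^-1` row_box A))%E.
  rewrite (_ : _ @^-1` _ = row_box (fun i => *%R r @^-1` A i)); last first.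
    by apply/seteqP; split => x h i; have := h i; rewrite /= mxE.
  have mrA i : measurable ( *%R r @^-1` A i : set (measurableTypeR R)).
    by rewrite -[X in measurable X]setTI; exact: mr.
  rewrite lebesgue_row_boxE//.
  rewrite [RHS](eq_bigr (fun i => r%:E * leb ( *%R r @^-1` A i)))%E; last first.
    by move=> i _; exact: (lebesgue_measure_scale r0 (mA i)).
  by rewrite big_split/= prodEFin prodr_const card_ord.
rewrite ge0_integral_mscale//; congr (_ * _)%E.
exact: (ge0_integral_pushforward (measurable_row_scale r) (lebesgue_row n) measurableT mq (fun x _ => q0 x)).
Qed.

(** The sigma-algebra is generated by the coordinates, not by the open sets: an open set is the
    countable union of the cubes with rational centre and radius 1/(k+1) that it contains. *)
Lemma open_row_measurable n (U : set 'rV[R]_n) : open U -> measurable U.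
Proof.
move=> oU.
pose B (q : 'rV[rat]_n * nat) : set 'rV[R]_n :=
  row_box (fun i => (ball (ratr (q.1 ord0 i) : R) q.2.+1%:R^-1 : set (measurableTypeR R))).
rewrite (_ : U = \bigcup_(q in [set q | B q `<=` U]) B q); last first.
  apply/seteqP; split; last by move=> x [q qU /qU].
  move=> x Ux; have /nbhs_ballP[e /= e0 eU] := open_nbhs_nbhs (conj oU Ux).
  (* Radius below e/2: a cube whose rational centre is that close to x then lies within e of x. *)
  have [k _ /(_ k (leqnn _)) ke] := near_infty_natSinv_lt (PosNum (divr_gt0 e0 (ltr0Sn R 1))).
  have /= ke2 : k.+1%:R^-1 < e / 2 := ke.
  have qP i : exists q : rat, ball (x ord0 i) (k.+1%:R^-1 : R) (ratr q).
    have k0 : 0 < k.+1%:R^-1 :> R by rewrite invr_gt0.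
    have bx : ball (x ord0 i) (k.+1%:R^-1 : R) !=set0 by exists (x ord0 i); exact: ballxx.
    by have [y [hy [q _ qE]]] := dense_rat bx (ball_open _ _); exists q; rewrite qE.
  pose q i := xget 0%R [set q : rat | ball (x ord0 i) (k.+1%:R^-1 : R) (ratr q)].
  have qB i : ball (x ord0 i) (k.+1%:R^-1 : R) (ratr (q i)) by exact: (xgetPex _ (qP i)).
  exists (\row_i q i, k); last by move=> i /=; rewrite mxE; exact/ball_sym/qB.
  move=> y By /=; apply: eU; split => // i j; rewrite ord1.
  apply: (@le_ball _ _ _ (k.+1%:R^-1 + k.+1%:R^-1)).
    by rewrite [leRHS]splitr lerD// ltW.
  by apply: (ball_triangle (qB j)); have := By j; rewrite /= mxE.
rewrite bigcup_mkcond; apply: countable_bigcupT_measurable => [|q].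
  exact: countableP.
case: ifPn => // _; apply: measurable_row_box => i; exact: measurable_ball.
Qed.

Lemma continuous_row_measurable n (g : 'rV[R]_n -> R) : continuous g ->
  measurable_fun setT (g : 'rV[R]_n -> measurableTypeR R).
Proof.
move=> cg; apply: (measurability _ (RGenOpens.measurableE R)) => _ [_ [a [b ->] <-]].
rewrite setTI; apply: open_row_measurable; apply: open_comp => [x _|]; first exact: cg.
exact: interval_open.
Qed.

End lebesgue_row_theory.

(** * Polar coordinates *)

Section eucl_norm_theory.
Context {R : realType} (n : nat).
Implicit Types (x y : 'rV[R]_n).

Lemma eucl_norm_ge0 x : 0 <= eucl_norm x.
Proof. exact: sqrtr_ge0. Qed.

Lemma sumsq_ge0 x : 0 <= \sum_i x ord0 i ^+ 2.
Proof. by apply: sumr_ge0 => i _; exact: sqr_ge0. Qed.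

Lemma sqr_eucl_norm x : eucl_norm x ^+ 2 = \sum_i x ord0 i ^+ 2.
Proof. by rewrite sqr_sqrtr// sumsq_ge0. Qed.

Lemma eucl_normZ (r : R) x : eucl_norm (r *: x) = `|r| * eucl_norm x.
Proof.
rewrite /eucl_norm (eq_bigr (fun i => r ^+ 2 * x ord0 i ^+ 2)); last first.
  by move=> i _; rewrite mxE exprMn.
by rewrite -mulr_sumr sqrtrM ?sqr_ge0// sqrtr_sqr.
Qed.

Lemma ler_coord_eucl_norm x i : `|x ord0 i| <= eucl_norm x.
Proof.
rewrite -sqrtr_sqr ler_sqrt ?sumsq_ge0// (bigD1 i)//= lerDl.
by apply: sumr_ge0 => j _; exact: sqr_ge0.
Qed.

Lemma ler_norm_eucl_norm x : `|x| <= eucl_norm x.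
Proof.
rewrite [leLHS]mx_normrE; apply: bigmax_le; first exact: eucl_norm_ge0.
by move=> [i j] _ /=; rewrite ord1; exact: ler_coord_eucl_norm.
Qed.

Lemma eucl_norm_eq0 x : eucl_norm x = 0 -> x = 0.
Proof.
move=> x0; apply/rowP => i; rewrite mxE; apply/eqP.
by rewrite -normr_le0 -x0 ler_coord_eucl_norm.
Qed.

Lemma eucl_norm0 : eucl_norm (0 : 'rV[R]_n) = 0.
Proof. by rewrite -(scale0r 0) eucl_normZ normr0 mul0r. Qed.

Lemma continuous_row_sum (I : Type) (r : seq I) (F : I -> 'rV[R]_n -> R) :
  (forall i, continuous (F i)) -> continuous (fun x => \sum_(i <- r) F i x).
Proof.
move=> cF; elim: r => [|i r IHr] x.
  rewrite (_ : (fun _ => _) = fun=> 0); first exact: cst_continuous.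
  by apply/funext => y; rewrite big_nil.
rewrite (_ : (fun _ => _) = (F i \+ fun y => \sum_(i <- r) F i y)).
  by apply: continuousD; [exact: cF|exact: IHr].
by apply/funext => y; rewrite big_cons.
Qed.

Lemma continuous_sumsq : continuous (fun x => \sum_i x ord0 i ^+ 2).
Proof.
apply: continuous_row_sum => i x.
apply: (@continuous_comp _ _ _ (fun y : 'rV[R]_n => y ord0 i) (fun t => t ^+ 2)).
  exact: coord_continuous.
exact: exprn_continuous.
Qed.


Lemma continuous_eucl_norm : continuous (@eucl_norm R n).
Proof.
move=> x; apply: (@continuous_comp _ _ _ (fun x => \sum_i x ord0 i ^+ 2) Num.sqrt).
  exact: continuous_sumsq.
exact: sqrt_continuous.
Qed.

Lemma measurable_eucl_norm :
  measurable_fun setT (@eucl_norm R n : _ -> measurableTypeR R).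
Proof. by apply: continuous_row_measurable; exact: continuous_eucl_norm. Qed.

Lemma open_eucl_ball (r : R) : open (eucl_ball r : set 'rV[R]_n).
Proof.
rewrite (_ : eucl_ball r = @eucl_norm R n @^-1` `]-oo, r[%classic); last first.
  by apply/seteqP; split => x /=; rewrite in_itv.
by apply: open_comp => [x _|]; [exact: continuous_eucl_norm|exact: interval_open].
Qed.

Lemma measurable_eucl_ball (r : R) : measurable (eucl_ball r : set 'rV[R]_n).
Proof. by apply: open_row_measurable; exact: open_eucl_ball. Qed.

Lemma lebesgue_row_box_lty (a : R) :
  (lebesgue_row n (row_box (fun=> `[(- a)%R, a]%classic)) < +oo)%E.
Proof.
have -> : lebesgue_row n (row_box (fun=> `[(- a)%R, a]%classic)) =
    (\prod_(i < n) lebesgue_measure `[(- a)%R, a]%classic)%E.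
  by rewrite lebesgue_row_boxE// => i; exact: measurable_itv.
rewrite (eq_bigr (fun=> (fine (lebesgue_measure `[(- a)%R, a]%classic : \bar R))%:E)).
  by rewrite prodEFin ltry.
move=> i _; rewrite fineK// ge0_fin_numE// lebesgue_measure_itv/=.
by case: ifP; rewrite ltry.
Qed.

Lemma lebesgue_row_ball_lty (r : R) : (lebesgue_row n (eucl_ball r) < +oo)%E.
Proof.
apply: le_lt_trans (lebesgue_row_box_lty r); apply: le_measure; rewrite ?inE.
- exact: measurable_eucl_ball.
- by apply: measurable_row_box => i; exact: measurable_itv.
move=> x /= xr i /=; rewrite in_itv/= -ler_norml.
exact: le_trans (ler_coord_eucl_norm _ _) (ltW xr).
Qed.

End eucl_norm_theory.

Lemma ge0_integral_eq0_ae d (T : measurableType d) (R : realType)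
    (mu : {measure set T -> \bar R}) (D : set T) (g : T -> \bar R) :
  measurable D -> measurable_fun D g -> (forall x, D x -> 0 <= g x)%E ->
  (\int[mu]_(x in D) g x = 0)%E -> {ae mu, forall x, D x -> g x = 0%E}.
Proof.
move=> mD mg g0 ig; apply/(ae_eq_integral_abs mu mD mg); rewrite -[RHS]ig.
by apply: eq_integral => x /set_mem Dx; rewrite gee0_abs// g0.
Qed.

(** x^-1 = x |x|^-1 |x|^-1, with the inverses of |x| read as real powers, which are measurable; at 0
    both sides are 0. *)
Lemma measurable_invr (R : realType) : measurable_fun [set: R] (fun x : R => x^-1).
Proof.
rewrite (_ : (fun x : R => x^-1) = (fun x => x * (`|x| `^ (- 1) * `|x| `^ (- 1)))).
  by apply: measurable_funM => //; apply: measurable_funM;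
    apply: (measurableT_comp (measurable_powR (- 1))).
apply/funext => x; rewrite powR_inv1// -invfM -expr2 -normrX ger0_norm ?sqr_ge0//.
have [->|x0] := eqVneq x 0; first by rewrite mul0r invr0.
by rewrite expr2 invfM mulrA mulfV// mul1r.
Qed.

Section polar.
Context {R : realType} (n : nat).
Notation leb := (@lebesgue_measure R).
Notation lrow := (lebesgue_row n.+1).

Definition annulus : set 'rV[R]_n.+1 := [set y | 1 < eucl_norm y < 2].

Definition dir (y : 'rV[R]_n.+1) : 'rV[R]_n.+1 := (eucl_norm y)^-1 *: y.

Lemma in_annulus y : (y \in annulus) = (1 < eucl_norm y < 2).
Proof. by apply/idP/idP; rewrite inE. Qed.

Lemma measurable_annulus : measurable annulus.
Proof.
rewrite (_ : annulus = (@eucl_norm R n.+1 : _ -> measurableTypeR R) @^-1` `]1, 2[%classic).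
  by rewrite -[X in measurable X]setTI; exact: measurable_eucl_norm.
by apply/seteqP; split => x /=; rewrite in_itv.
Qed.

Lemma annulus_gt0 y : annulus y -> 0 < eucl_norm y.
Proof. by move=> /andP[+ _]; exact: lt_trans. Qed.

Lemma eucl_norm_dir y : annulus y -> eucl_norm (dir y) = 1.
Proof.
move=> /annulus_gt0 y0; rewrite eucl_normZ ger0_norm ?invr_ge0 ?eucl_norm_ge0//.
by rewrite mulVf// gt_eqF.
Qed.

Lemma eucl_norm_ray y s : annulus y -> 0 < s -> eucl_norm (s *: dir y) = s.
Proof. by move=> Ay s0; rewrite eucl_normZ eucl_norm_dir// mulr1 gtr0_norm. Qed.

Lemma measurable_row_smul :
  measurable_fun setT (fun p : 'rV[R]_n.+1 * measurableTypeR R => p.2 *: p.1 : 'rV[R]_n.+1).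
Proof.
apply: measurable_fun_row => i.
rewrite (_ : (fun _ => _) = (fun p : 'rV[R]_n.+1 * measurableTypeR R =>
   (p.2 : R) * (p.1 ord0 i : R))); last by apply/funext => p; rewrite mxE.
apply: measurable_funM; first exact: measurable_snd.
by apply: (measurableT_comp (measurable_coord i)); exact: measurable_fst.
Qed.

Lemma measurable_dir : measurable_fun setT dir.
Proof.
apply: (measurableT_comp measurable_row_smul (g := fun y => (y, (eucl_norm y)^-1))).
apply: measurable_fun_pair => //.
by apply: (measurableT_comp (@measurable_invr R)); exact: measurable_eucl_norm.
Qed.

Lemma measurable_ray : measurable_fun setT
  (fun p : 'rV[R]_n.+1 * measurableTypeR R => p.2 *: dir p.1 : 'rV[R]_n.+1).
Proof.
apply: (measurableT_comp measurable_row_smul (g := fun p => (dir p.1, p.2))).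
apply: measurable_fun_pair; last exact: measurable_snd.
by apply: (measurableT_comp measurable_dir); exact: measurable_fst.
Qed.

Lemma lebesgue_row_set0 : lrow [set 0 : 'rV[R]_n.+1] = 0%E.
Proof.
rewrite (_ : [set 0] = row_box (fun=> [set 0%R : R])); last first.
  by apply/seteqP; split => [x -> i|x h]; [rewrite /= mxE|apply/rowP => i; rewrite mxE; exact: h].
have -> : lrow (row_box (fun=> [set 0%R : R])) = (\prod_(i < n.+1) leb [set 0%R : R])%E.
  by rewrite lebesgue_row_boxE// => i.
by rewrite big_ord_recl lebesgue_measure_set1 mul0e.
Qed.

(** The weight left in [polar] by the last change of variables s = |x| t. It is supported in ]1/2,
    1[, where it lies between 1 and 2 * 2^(n+1), so its integral is positive and finite. *)
Let k (t : R) : R := \1_(`]0, +oo[) t * \1_(`]1, 2[) t^-1 * t^-1 * t^-1 ^+ n.+1.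

Let k_ge0 t : 0 <= k t.
Proof.
rewrite /k indicE; case: (boolP (t \in _)) => /= [|_]; last by rewrite !mul0r.
by rewrite inE/= in_itv/= andbT => t0; rewrite !mulr_ge0// ?exprn_ge0// invr_ge0 ltW.
Qed.

Let measurable_k : measurable_fun setT k.
Proof.
have mI := @measurable_invr R.
apply: measurable_funM; last exact: measurable_funX.
apply: measurable_funM => //; apply: measurable_funM.
  exact: measurable_indic.
by apply: (measurableT_comp (f := \1_(`]1%R, 2%R[%classic) : R -> R) _ mI); exact: measurable_indic.
Qed.

Definition polar_cst : \bar R := (\int[leb]_t (k t)%:E)%E.

Lemma polar_cst_gt0 : (0 < polar_cst)%E.
Proof.
apply: (@lt_le_trans _ _ (\int[leb]_(t in `](2^-1)%R, 1%R[) 1%:E)%E).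
  rewrite integral_cst//= mul1e lebesgue_measure_itv/= lte_fin.
  by rewrite invf_lt1// ltr1n -EFinB lte_fin subr_gt0 invf_lt1// ltr1n.
rewrite integral_mkcond; apply: le_integralT => t _.
rewrite patchE; case: ifPn => [|_]; last by rewrite lee_fin.
rewrite inE/= in_itv/= => /andP[t2 t1]; rewrite lee_fin /k.
have t0 : 0 < t by exact: lt_trans t2.
have tV1 : 1 < t^-1 by rewrite invf_gt1.
rewrite !indicE !mem_set/= ?in_itv/= ?andbT// ?mul1r; last first.
  by rewrite tV1/= -[ltRHS]invrK ltf_pV2// posrE.
by rewrite mulr_ege1// ?exprn_ege1// ltW.
Qed.

Lemma polar_cst_lty : (polar_cst < +oo)%E.
Proof.
apply: (@le_lt_trans _ _ (\int[leb]_(t in `[0%R, 1%R]) (2 * 2 ^+ n.+1)%:E)%E).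
  rewrite [leRHS]integral_mkcond; apply: le_integralT => t _.
  rewrite patchE /k !indicE !mem_setE !in_itv/= andbT.
  have [t0|_] /= := boolP (0 < t); last by rewrite !mul0r; case: ifP; rewrite lee_fin.
  have [/andP[t1 t2]|_] /= := boolP (1 < t^-1 < 2); last first.
    by rewrite !(mul0r, mulr0); case: ifP; rewrite lee_fin.
  rewrite (ltW t0)/= (_ : t <= 1); last by move: t1; rewrite invf_gt1// => /ltW.
  rewrite lee_fin !mul1r ler_pM ?exprn_ge0 ?invr_ge0 ?(ltW t0)//; first exact: ltW.
  by rewrite lerXn2r ?nnegrE ?invr_ge0 ?(ltW t0)// ltW.
by rewrite integral_cst//= lebesgue_measure_itv/= lte_fin ltr01 -EFinB -EFinM ltry.
Qed.

Lemma polar_cst_fin : polar_cst \is a fin_num.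
Proof. by rewrite ge0_fin_numE ?polar_cst_lty// ltW// polar_cst_gt0. Qed.

(** Three dilations, separated by exchanges of the integrals: s becomes |y| s, then x = s y, then s
    = |x| t. By homogeneity the weight of g(x) that remains does not depend on x. *)
Lemma polar (g : 'rV[R]_n.+1 -> \bar R) : measurable_fun setT g ->
  (forall x, 0 <= g x)%E ->
  (polar_cst * \int[lrow]_x g x =
   \int[lrow]_(y in annulus) \int[leb]_(s in `]0%R, +oo[)
     ((s ^+ n)%:E * g (s *: dir y)%R))%E.
Proof.
move=> mg g0.
have mA := measurable_annulus.
have mI := @measurable_invr R.
have mN : measurable_fun setT (@eucl_norm R n.+1 : _ -> measurableTypeR R) by exact: measurable_eucl_norm.
(* The weight of g(s y) once s has been replaced by |y| s. *)
pose Psi (p : 'rV[R]_n.+1 * measurableTypeR R) : R :=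
  \1_annulus p.1 * \1_(`]0, +oo[) (p.2 : R) * eucl_norm p.1 ^+ n.+1 * (p.2 : R) ^+ n.
have m1 (h : 'rV[R]_n.+1 -> R) : measurable_fun setT h ->
    measurable_fun setT (fun p : 'rV[R]_n.+1 * measurableTypeR R => h p.1).
  by move=> mh; apply: (measurableT_comp mh); exact: measurable_fst.
have m2 (h : R -> R) : measurable_fun setT h ->
    measurable_fun setT (fun p : 'rV[R]_n.+1 * measurableTypeR R => h p.2).
  by move=> mh; apply: (measurableT_comp mh); exact: measurable_snd.
have mPsi : measurable_fun setT Psi.
  apply: measurable_funM; last exact: (m2 (fun s => s ^+ n)).
  apply: measurable_funM; last by apply: (m1 (fun y => eucl_norm y ^+ n.+1)); exact: measurable_funX.
  apply: measurable_funM; first by apply: (m1 (\1_annulus)); exact: measurable_indic.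
  by apply: (m2 (\1_(`]0, +oo[))); exact: measurable_indic.
have Psi0 p : 0 <= Psi p.
  rewrite /Psi !indicE; have [|_] /= := boolP (p.2 \in _); last by rewrite mulr0 !mul0r.
  rewrite inE/= in_itv/= andbT => p0.
  by rewrite !mulr_ge0// ?exprn_ge0// ?eucl_norm_ge0// ltW.
(* The weight of g(x) after x = s y: the Jacobian s^-(n+1) turns s^n into s^-1, and |y| becomes
   |x|/s. *)
pose Phi (p : 'rV[R]_n.+1 * measurableTypeR R) : R :=
  \1_(`]0, +oo[) (p.2 : R) * \1_annulus ((p.2 : R)^-1 *: p.1) * (p.2 : R)^-1 *
    ((p.2 : R)^-1 * eucl_norm p.1) ^+ n.+1.
have mPhi : measurable_fun setT Phi.
  apply: measurable_funM; last first.
    apply: measurable_funX; apply: measurable_funM; first exact: (m2 (fun s => s^-1)).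
    exact: (m1 (@eucl_norm R n.+1)).
  apply: measurable_funM; last exact: (m2 (fun s => s^-1)).
  apply: measurable_funM; first by apply: (m2 (\1_(`]0, +oo[))); exact: measurable_indic.
  apply: (measurableT_comp (f := \1_annulus : _ -> R)); first exact: measurable_indic.
  apply: (measurableT_comp measurable_row_smul (g := fun p => (p.1, (p.2 : R)^-1))).
  by apply: measurable_fun_pair; [exact: measurable_fst|exact: (m2 (fun s => s^-1))].
have Phi0 p : 0 <= Phi p.
  rewrite /Phi !indicE; have [|_] /= := boolP (p.2 \in _); last by rewrite !mul0r.
  rewrite inE/= in_itv/= andbT => p0.
  by rewrite !mulr_ge0// ?exprn_ge0// ?mulr_ge0 ?invr_ge0 ?eucl_norm_ge0// ltW.
transitivity (\int[lrow]_y \int[leb]_s ((Psi (y, s))%:E * g (s *: y)))%E; last first.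
  rewrite [RHS]integral_mkcond; apply: eq_integral => y _; rewrite patchE.
  have [|Ay] := boolP (y \in annulus); last first.
    rewrite integral0_eq// => s _.
    by rewrite /Psi /= indicE (negbTE Ay) !mul0r mul0e.
  rewrite inE => Ay; have a0 := annulus_gt0 Ay; set a := eucl_norm y in a0.
  rewrite [RHS]integral_mkcond [RHS](@ge0_integral_scale _ a)//; last 2 first.
  - apply/(measurable_restrictT _ _).1 => //; apply: measurable_funTS.
    apply: emeasurable_funM; first by apply/measurable_EFinP; exact: exprn_measurable.
    apply: (measurableT_comp mg).
    exact: (measurableT_comp measurable_ray (@measurable_pair1 _ _ _ _ y)).
  - move=> s; rewrite patchE; case: ifPn => // /set_mem/=; rewrite in_itv/= andbT => s0.
    by rewrite mule_ge0// lee_fin exprn_ge0// ltW.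
  rewrite -ge0_integralZl_EFin//; last 3 first.
  - move=> s _; rewrite patchE; case: ifPn => // /set_mem/=; rewrite in_itv/= andbT => s0.
    by rewrite mule_ge0// lee_fin exprn_ge0// ltW.
  - rewrite (_ : (fun _ => _) = ((fun s => (s ^+ n)%:E * g (s *: dir y))%E \_ `]0, +oo[%classic) \o ( *%R a : measurableTypeR R -> measurableTypeR R))//.
    apply: measurableT_comp; last exact: mulrl_measurable.
    apply/(measurable_restrictT _ _).1 => //; apply: measurable_funTS.
    apply: emeasurable_funM; first by apply/measurable_EFinP; exact: exprn_measurable.
    apply: (measurableT_comp mg).
    exact: (measurableT_comp measurable_ray (@measurable_pair1 _ _ _ _ y)).
  - exact: ltW.
  apply: eq_integral => s _; rewrite patchE /Psi/= !indicE (mem_set Ay)/= mul1r !mem_setE !in_itv/= !andbT.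
  rewrite pmulr_rgt0//; have [s0|_] := boolP (0 < s); last by rewrite !mul0r mul0e mule0.
  rewrite mul1r /dir -/a scalerA mulrAC mulfV ?gt_eqF// mul1r muleA -EFinM.
  by rewrite exprMn mulrA -exprS.
rewrite (fubini_tonelli (m1 := lrow) (m2 := leb) (fun p => (Psi p)%:E * g ((p.2 : R) *: p.1)))%E; last 2 first.
- apply: emeasurable_funM; first exact/measurable_EFinP.
  exact: (measurableT_comp mg measurable_row_smul).
- by move=> p; rewrite mule_ge0// lee_fin.
transitivity (\int[leb]_s \int[lrow]_x ((Phi (x, s))%:E * g x))%E; last first.
  apply: eq_integral => s _ /=.
  have [s0|s0] := ltP 0 s; last first.
    have si : \1_(`]0, +oo[%classic) s = 0 :> R.
      by rewrite indicE mem_setE in_itv/= andbT ltNge s0.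
    by rewrite !integral0_eq// => x _; rewrite /Psi /Phi /= si ?(mul0r,mulr0) mul0e.
  rewrite (@ge0_integral_row_scale _ _ s)//; last 2 first.
  - apply: emeasurable_funM => //; apply/measurable_EFinP.
    exact: (measurableT_comp mPhi (@measurable_pair2 _ _ _ _ s)).
  - by move=> x; rewrite mule_ge0// lee_fin.
  rewrite -ge0_integralZl_EFin//; last 3 first.
  - by move=> x _; rewrite mule_ge0// lee_fin.
  - apply: (measurableT_comp (f := fun x => (Phi (x, s))%:E * g x)%E); last exact: measurable_row_scale.
    apply: emeasurable_funM => //; apply/measurable_EFinP.
    exact: (measurableT_comp mPhi (@measurable_pair2 _ _ _ _ s)).
  - by rewrite exprn_ge0// ltW.
  apply: eq_integral => x _; rewrite muleA -EFinM; congr (_%:E * _)%E.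
  rewrite /Phi /Psi /= eucl_normZ (gtr0_norm s0) scalerA (mulVf (lt0r_neq0 s0)) scale1r (mulKf (lt0r_neq0 s0)).
  rewrite exprS; set c := \1__ s; set b := \1__ x; set a := _ ^+ n.+1; set d := s ^+ n.
  rewrite (_ : s * d * (c * b * s^-1 * a) = (s * s^-1) * (b * c * a * d)).
    by rewrite mulfV ?gt_eqF// mul1r.
  by lra.
rewrite -(fubini_tonelli (m1 := lrow) (m2 := leb) (fun p => (Phi p)%:E * g p.1))%E; last 2 first.
- apply: emeasurable_funM; first exact/measurable_EFinP.
  by apply: (measurableT_comp mg); exact: measurable_fst.
- by move=> p; rewrite mule_ge0// lee_fin.
rewrite -[polar_cst]fineK ?polar_cst_fin// -ge0_integralZl_EFin//; last first.
  by rewrite fine_ge0// ltW// polar_cst_gt0.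
(* The origin is set aside, as s = |x| t requires |x| > 0. *)
apply: ae_eq_integralT; exists [set 0]; split.
- by rewrite -[X in measurable X]setIid; apply: (measurableI) => //; 
   rewrite (_ : [set 0] = row_box (fun=> [set 0%R : R])); try (by apply: measurable_row_box => i);
   by apply/seteqP; split => [x -> i|x h]; [rewrite /= mxE|apply/rowP => i; rewrite mxE; exact: h].
- exact: lebesgue_row_set0.
move=> x /= hx; apply: contrapT => x0; apply: hx => _.
have a0 : 0 < eucl_norm x.
  by rewrite lt_neqAle eucl_norm_ge0 andbT eq_sym; apply/eqP => /eucl_norm_eq0.
set a := eucl_norm x in a0.
have mPx : measurable_fun setT (fun s : measurableTypeR R => Phi (x, s)).
  exact: (measurableT_comp mPhi (@measurable_pair1 _ _ _ _ x)).
rewrite [RHS](_ : _ = \int[leb]_s (g x * (Phi (x, s))%:E))%E; last first.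
  by apply: eq_integral => s _; rewrite muleC.
rewrite ge0_integralZl//=; last 2 first.
- exact/measurable_EFinP.
- by move=> s _; rewrite lee_fin.
rewrite muleC fineK ?polar_cst_fin//; congr (_ * _)%E.
rewrite (@ge0_integral_scale _ a)//; last 2 first.
- exact/measurable_EFinP.
- by move=> s; rewrite lee_fin.
rewrite -ge0_integralZl_EFin//; last 3 first.
- by move=> s _; rewrite lee_fin.
- apply/measurable_EFinP.
  apply: (measurableT_comp (f := fun s : measurableTypeR R => Phi (x, s)) (g := *%R a : measurableTypeR R -> measurableTypeR R)) => //.
- exact: ltW.
apply: eq_integral => t _; rewrite -EFinM /k /Phi.
have [t0|t0] := ltP 0 t; last first.
  rewrite !indicE !mem_setE !in_itv/= !andbT pmulr_rgt0// ltNge t0/=.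
  by rewrite !mul0r mulr0.
have iA : \1_annulus ((a * t)^-1 *: x) = (1 < t^-1 < 2)%R%:R :> R.
  rewrite indicE in_annulus eucl_normZ -/a ger0_norm ?invr_ge0 ?mulr_ge0 ?ltW//.
  by rewrite invfM -mulrA mulrCA mulVf ?gt_eqF// mulr1.
rewrite [(_, _).1]/= [(_, _).2]/= iA -/a !indicE !mem_setE !in_itv/= !andbT pmulr_rgt0// t0 !mul1r.
rewrite invfM (mulrC a^-1) -(mulrA t^-1 a^-1 a) mulVf ?gt_eqF// mulr1; congr (_%:E).
rewrite (_ : a * (_ * (t^-1 * a^-1) * _) = (a * a^-1) * ((1 < t^-1 < 2)%R%:R * t^-1 * t^-1 ^+ n.+1)).
  by rewrite mulfV ?gt_eqF// mul1r.
by lra.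
Qed.

End polar.

(** * Smooth functions *)

Section smooth1.
Context {R : realType}.
Implicit Types (f g q V : R -> R).

(** The family x^-k exp(-1/x), extended by 0, rather than exp(-1/x) alone: up to linear combinations
    it is stable under differentiation, also at 0. *)
Definition flat (k : nat) (x : R) : R :=
  if 0 < x then x^-1 ^+ k * expR (- x^-1) else 0.

Lemma flat_ge0 k x : 0 <= flat k x.
Proof.
rewrite /flat; case: ifPn => // x0.
by rewrite mulr_ge0 ?expR_ge0// exprn_ge0// invr_ge0 ltW.
Qed.

Lemma flat_le0 k x : x <= 0 -> flat k x = 0.
Proof. by rewrite /flat ltNge => ->. Qed.

(* [expR y = expR (y / m) ^ m >= (y / m) ^ m] with [y = 1 / x] *)
Lemma flat_linear k x : 0 <= x -> flat k x <= k.+1%:R ^+ k.+1 * x.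
Proof.
rewrite le_eqVlt => /predU1P[<-|x0]; first by rewrite flat_le0// mulr0.
rewrite /flat x0; set m := k.+1%:R : R.
have m0 : 0 < m by rewrite ltr0n.
have y0 : 0 < x^-1 by rewrite invr_gt0.
have h : (x^-1 / m) ^+ k.+1 <= expR x^-1.
  rewrite [leRHS](_ : _ = expR (x^-1 / m) ^+ k.+1); last first.
    by rewrite -expRM_natl -/m mulrC mulfVK// gt_eqF.
  rewrite lerXn2r ?nnegrE ?expR_ge0// ?divr_ge0 ?ltW//.
  by apply: lt_le_trans (expR_ge1Dx _); rewrite ltrDr.
rewrite expRN ler_pdivrMr ?expR_gt0//.
apply: (@le_trans _ _ (m ^+ k.+1 * x * (x^-1 / m) ^+ k.+1)); last first.
  by rewrite ler_wpM2l// mulr_ge0 ?exprn_ge0// ltW.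
rewrite -mulrA mulrCA -exprMn (mulrC m) mulfVK ?gt_eqF//.
by rewrite exprS mulVKf// gt_eqF.
Qed.

Lemma is_derive_exprn k (x : R) : is_derive x 1 (fun y : R => y ^+ k) (k%:R * x ^+ k.-1).
Proof.
rewrite (_ : (fun y : R => y ^+ k) = (@id R) ^+ k); last first.
  by apply/funext => y; rewrite exprfctE.
by apply: is_derive_eq; rewrite -[_ *: _]/(_ * _) mulr1.
Qed.

Lemma is_derive_flat k (x : R) : is_derive x 1 (flat k) (flat k.+2 x - k%:R * flat k.+1 x).
Proof.
have [x0|x0|->] := ltgtP x 0.
- rewrite !flat_le0 ?(ltW x0)// mulr0 subr0.
  apply: (near_eq_is_derive (f := fun=> 0 : R)).
    by near=> y; rewrite flat_le0// ltW//; near: y; exact: lt_nbhsl.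
- apply: (near_eq_is_derive (f := fun y : R => y^-1 ^+ k * expR (- y^-1))).
    by near=> y; rewrite /flat ifT//; near: y; exact: lt_nbhsr.
  have x1 : x != 0 by rewrite gt_eqF.
  have dV : is_derive x 1 (fun y : R => y^-1) (- x ^- 2).
    by apply: is_derive_eq; [exact: (is_deriveV (f := id) x1 (is_derive_id x 1))|rewrite -[_ *: _]/(_ * _) mulr1].
  have dX : is_derive x 1 (fun y : R => y^-1 ^+ k) (k%:R * x^-1 ^+ k.-1 * - x ^- 2).
    by apply: (is_derive1_comp (f := fun t => t ^+ k)); exact: is_derive_exprn.
  have dE : is_derive x 1 (fun y : R => expR (- y^-1)) (expR (- x^-1) * x ^- 2).
    have dN : is_derive x 1 (fun y : R => - y^-1) (x ^- 2).
      by rewrite -[X in is_derive _ _ _ X]opprK; exact: is_deriveN dV.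
    exact: (is_derive1_comp (is_derive_expR _) dN).
  apply: (is_derive_eq (is_deriveM dX dE)).
  rewrite /flat x0 -![_ *: _]/(_ * _) !exprVn.
  case: k {dX} => [|k]; first by rewrite !mul0r mulr0 addr0 subr0 expr0 invr1 mul1r mulrC.
  rewrite (_ : x ^- k.+3 = x ^- k.+1 * x ^- 2); last by rewrite -invfM -exprD addn2.
  rewrite (_ : x ^- k.+2 = x ^- k * x ^- 2); last by rewrite -invfM -exprD addn2.
  by rewrite /=; set a := expR _; set b := x ^- k; set c := x ^- k.+1; set d := x ^- 2; lra.
- rewrite !flat_le0// mulr0 subr0.
  (* The difference quotient of [flat k] at 0 is [flat k.+1], which tends to 0 by the linear
     bound. *)
  apply/is_derive1_caratheodory; exists (flat k.+1); split.
  + move=> z; rewrite (flat_le0 k (lexx 0)) !subr0 /flat; case: ifPn => z0; last by rewrite mul0r.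
    by rewrite exprSr -!mulrA (mulrC (expR _)) mulKf// gt_eqF.
  + have h : (fun z : R => k.+2%:R ^+ k.+2 * `|z|) @ (0 : R) --> (0 : R).
      rewrite -[X in _ --> X](mulr0 (k.+2%:R ^+ k.+2)); apply: cvgMr.
      by rewrite -[X in _ --> X](@normr0 R R); exact: norm_continuous.
    have h0 : (fun=> 0 : R) @ (0 : R) --> (0 : R) by exact: cvg_cst.
    rewrite /prop_for /continuous_at flat_le0//; apply: squeeze_cvgr h0 h.
    apply: nearW => z; rewrite flat_ge0/=; have [z0|z0] := leP 0 z.
      by rewrite ger0_norm//; exact: flat_linear.
    by rewrite flat_le0 ?(ltW z0)// mulr_ge0 ?exprn_ge0.
  + by rewrite flat_le0.
Unshelve. all: by end_near. Qed.

(* The class is stable under differentiation, whence the smoothness of its members. *)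
Inductive gen_smooth1 : (R -> R) -> Prop :=
| gen_smooth1_cst c : gen_smooth1 (fun=> c)
| gen_smooth1_id : gen_smooth1 id
| gen_smooth1_add f g : gen_smooth1 f -> gen_smooth1 g -> gen_smooth1 (fun x => f x + g x)
| gen_smooth1_mul f g : gen_smooth1 f -> gen_smooth1 g -> gen_smooth1 (fun x => f x * g x)
| gen_smooth1_flat k : gen_smooth1 (flat k)
| gen_smooth1_comp f g : gen_smooth1 f -> gen_smooth1 g -> gen_smooth1 (fun x => f (g x)).

Lemma gen_smooth1_is_derive f : gen_smooth1 f -> exists2 f', gen_smooth1 f' & forall x : R, is_derive x 1 f (f' x).
Proof.
elim=> {f} [c||f g sf [f' sf' df] sg [g' sg' dg]|f g sf [f' sf' df] sg [g' sg' dg]|k|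
  f g sf [f' sf' df] sg [g' sg' dg]].
- by exists (fun=> 0); [exact: gen_smooth1_cst|move=> x; exact: is_derive_cst].
- by exists (fun=> 1); [exact: gen_smooth1_cst|move=> x; exact: is_derive_id].
- exists (fun x => f' x + g' x); [exact: gen_smooth1_add|move=> x; exact: is_deriveD].
- exists (fun x => f x * g' x + g x * f' x); last by move=> x; exact: is_deriveM.
  by apply: gen_smooth1_add; apply: gen_smooth1_mul.
- exists (fun x => flat k.+2 x + - k%:R * flat k.+1 x).
    by apply: gen_smooth1_add; [exact: gen_smooth1_flat|apply: gen_smooth1_mul; [exact: gen_smooth1_cst|exact: gen_smooth1_flat]].
  by move=> x; rewrite mulNr; exact: is_derive_flat.
- exists (fun x => f' (g x) * g' x); first by apply: gen_smooth1_mul => //; exact: gen_smooth1_comp.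
  by move=> x; exact: is_derive1_comp.
Qed.

Definition smooth1 f := forall n (x : R), derivable (derive1n n f) x 1.

Lemma smooth1_derive1 f : smooth1 f -> smooth1 (derive1 f).
Proof. by move=> sf n x; rewrite -derive1Sn; exact: sf. Qed.

Lemma smooth1_is_derive f (x : R) : smooth1 f -> is_derive x 1 f ((derive1 f) x).
Proof. by move=> /(_ 0%N x) df; rewrite derive1E; exact: derivableP. Qed.

Lemma smooth1_continuous f : smooth1 f -> continuous f.
Proof.
by move=> sf x; apply: differentiable_continuous; apply/derivable1_diffP; exact: (sf 0%N).
Qed.

Lemma is_derive1E f f' : (forall x : R, is_derive x 1 f (f' x)) -> (derive1 f) = f'.
Proof. by move=> df; apply/funext => x; rewrite derive1E; exact: derive_val. Qed.

Lemma gen_smooth1P f : gen_smooth1 f -> smooth1 f.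
Proof.
move=> sf n; elim: n f sf => [|n IHn] f sf x.
  by have [f' _ df] := gen_smooth1_is_derive sf; have [] := df x.
have [f' sf' df] := gen_smooth1_is_derive sf.
by rewrite derive1Sn (is_derive1E df); exact: IHn.
Qed.

Lemma smooth1_antiderivative V q : (forall x : R, is_derive x 1 V (q x)) ->
  smooth1 q -> smooth1 V.
Proof.
move=> dV sq [|n] x; first by have [] := dV x.
by rewrite derive1Sn (is_derive1E dV); exact: sq.
Qed.

(** Smooth and zero outside ]a, b[. Since [flat 0] tends to 1 at infinity, letting k grow gives the
    indicator function of ]a, b[ pointwise, with values in [0, 1]. *)
Definition bump (a b : R) (k : nat) (x : R) : R :=
  flat 0 (k%:R * (x - a)) * flat 0 (k%:R * (b - x)).

Lemma gen_smooth1_bump a b k : gen_smooth1 (bump a b k).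
Proof.
apply: gen_smooth1_mul; apply: (gen_smooth1_comp (gen_smooth1_flat 0)); apply: gen_smooth1_mul; (try exact: gen_smooth1_cst).
  by apply: gen_smooth1_add; [exact: gen_smooth1_id|exact: gen_smooth1_cst].
rewrite (_ : (fun x => b - x) = (fun x => b + -1 * x)).
  by apply: gen_smooth1_add; [exact: gen_smooth1_cst|apply: gen_smooth1_mul; [exact: gen_smooth1_cst|exact: gen_smooth1_id]].
by apply/funext => x; rewrite mulN1r.
Qed.

Lemma flat0_le1 x : flat 0 x <= 1.
Proof.
rewrite /flat; case: ifPn => // x0; rewrite expr0 mul1r -expR0 ler_expR.
by rewrite oppr_le0 invr_ge0 ltW.
Qed.

Lemma bump_ge0 a b k x : 0 <= bump a b k x.
Proof. by rewrite mulr_ge0// flat_ge0. Qed.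

Lemma bump_le1 a b k x : bump a b k x <= 1.
Proof. by rewrite mulr_ile1// ?flat_ge0// flat0_le1. Qed.

Lemma bump_out a b k x : ~ (a < x < b) -> bump a b k x = 0.
Proof.
move=> /negP; rewrite negb_and -!leNgt => /orP[xa|bx]; rewrite /bump.
  by rewrite flat_le0 ?mul0r// mulr_ge0_le0// subr_le0.
by rewrite (@flat_le0 0 (_ * (b - x))) ?mulr0// mulr_ge0_le0// subr_le0.
Qed.

Lemma cvg_flat0 (c : R) : flat 0 (k%:R * c) @[k --> \oo] --> ((0 < c)%R%:R : R).
Proof.
have [c0|c0] := ltP 0 c; last first.
  rewrite (_ : (fun _ => _) = fun=> 0); first exact: cvg_cst.
  by apply/funext => k; rewrite flat_le0// mulr_ge0_le0.
rewrite (_ : (true%:R : R) = expR (- (0 * c^-1))); last by rewrite mul0r oppr0 expR0.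
have h : (fun k : nat => expR (- (k.+1%:R^-1 * c^-1))) @ \oo --> expR (- (0 * c^-1)).
  have h0 : (fun k : nat => - (k.+1%:R^-1 * c^-1)) @ \oo --> - (0 * c^-1).
    by apply: cvgN; apply: cvgMl; exact: cvg_harmonic.
  have := @continuous_expR R (- (0 * c^-1)).
  exact: (cvg_comp (fun k : nat => - (k.+1%:R^-1 * c^-1)) expR h0).
rewrite -(cvg_shiftS (fun k : nat => flat 0 (k%:R * c))); apply: cvg_trans h.
apply: near_eq_cvg; apply: nearW => k.
by rewrite /= /flat pmulr_lgt0// ltr0n expr0 mul1r invfM.
Qed.

Lemma cvg_bump a b x : bump a b k x @[k --> \oo] --> ((a < x < b)%R%:R : R).
Proof.
rewrite (_ : (a < x < b)%R%:R = (0 < x - a)%R%:R * (0 < b - x)%R%:R :> R).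
  by apply: cvgM; exact: cvg_flat0.
by rewrite !subr_gt0 -natrM mulnb.
Qed.

End smooth1.

(** * Smooth functions of several variables *)

Section smooth_row.
Context {R : realType} (n : nat).
Implicit Types (x v : 'rV[R]_n) (phi F : 'rV[R]_n -> R).
Notation e i := (delta_mx ord0 i : 'rV[R]_n).

Lemma is_derive_line phi x v (t : R) df : is_derive (x + t *: v) v phi df <->
  is_derive t 1 (fun s : R => phi (x + s *: v)) df.
Proof.
have E : (fun h : R => h^-1 *: ((phi \o shift (x + t *: v)) (h *: v) - phi (x + t *: v))) =
    (fun h : R => h^-1 *: (((fun s : R => phi (x + s *: v)) \o shift t) (h *: (1 : R)) -
      (fun s : R => phi (x + s *: v)) t)).
  by apply/funext => h /=; rewrite scalerDl -[h *: 1]/(h * 1) mulr1 addrCA.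
split => -[d1 d2]; split.
- by move: d1; rewrite /derivable E.
- by move: d2; rewrite /derive E.
- by move: d1; rewrite /derivable -E.
- by move: d2; rewrite /derive -E.
Qed.

Lemma is_derive_line0 phi x v df : is_derive x v phi df <->
  is_derive (0 : R) 1 (fun s : R => phi (x + s *: v)) df.
Proof. by rewrite -is_derive_line scale0r addr0. Qed.

Lemma is_derive_comp1 (q : R -> R) F x v dq dF : is_derive (F x) 1 q dq ->
  is_derive x v F dF -> is_derive x v (fun y => q (F y)) (dq * dF).
Proof.
move=> hq /is_derive_line0 hF; apply/is_derive_line0.
by apply: (is_derive1_comp (f := q)); rewrite ?scale0r ?addr0.
Qed.

Lemma is_derive_coord i j x : is_derive x (e j) (fun y => y ord0 i) (i == j)%:R.
Proof.
apply/is_derive_line0.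
rewrite (_ : (fun _ => _) = (fun s : R => x ord0 i + s * (i == j)%:R)).
  have h : is_derive (0 : R) 1 (fun s : R => s * (i == j)%:R) (i == j)%:R.
    apply: (is_derive_eq (is_deriveM (is_derive_id _ _) (is_derive_cst _ _ _))).
    by rewrite scaler0 add0r -[_ *: _]/(_ * _) mulr1.
  by apply: (is_derive_eq (is_deriveD (is_derive_cst (x ord0 i) _ _) h)); rewrite add0r.
by apply/funext => s; rewrite !mxE eqxx.
Qed.

(** A certificate stable under partial derivatives: [smooth], which speaks of all iterated partial
    derivatives, then follows by induction on the list of directions. *)
Inductive gen_smooth : ('rV[R]_n -> R) -> Prop :=
| gen_smooth_smooth phi : smooth phi -> gen_smooth phi
| gen_smooth_coord i : gen_smooth (fun x => x ord0 i)
| gen_smooth_cst c : gen_smooth (fun=> c)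
| gen_smooth_add F G : gen_smooth F -> gen_smooth G -> gen_smooth (fun x => F x + G x)
| gen_smooth_mul F G : gen_smooth F -> gen_smooth G -> gen_smooth (fun x => F x * G x)
| gen_smooth_comp q F : smooth1 q -> gen_smooth F -> gen_smooth (fun x => q (F x)).

Lemma smooth_partial phi i : smooth phi -> smooth (partial i phi).
Proof. by move=> sp s; have := sp (rcons s i); rewrite /partials foldr_rcons. Qed.

Lemma smooth_is_derive phi i x : smooth phi -> is_derive x (e i) phi (partial i phi x).
Proof. by move=> /(_ [::])[_ /(_ i x)]; exact: derivableP. Qed.

Lemma smooth_continuous phi : smooth phi -> continuous phi.
Proof. by move=> /(_ [::])[]. Qed.

Lemma gen_smooth_continuous F : gen_smooth F -> continuous F.
Proof.
elim=> {F} [phi|i|c|F G _ cF _ cG|F G _ cF _ cG|q F sq _ cF] x.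
- by move=> sphi; exact: smooth_continuous.
- exact: coord_continuous.
- exact: cst_continuous.
- by apply: continuousD; [exact: cF|exact: cG].
- by apply: continuousM; [exact: cF|exact: cG].
- by apply: continuous_comp; [exact: cF|exact: smooth1_continuous].
Qed.

Lemma gen_smooth_is_derive F i : gen_smooth F ->
  exists2 F', gen_smooth F' & forall x, is_derive x (e i) F (F' x).
Proof.
elim=> {F} [phi sphi|j|c|F G rF [F' rF' dF] rG [G' rG' dG]|
  F G rF [F' rF' dF] rG [G' rG' dG]|q F sq rF [F' rF' dF]].
- exists (partial i phi); last by move=> x; exact: smooth_is_derive.
  exact/gen_smooth_smooth/smooth_partial.
- by exists (fun=> (j == i)%:R); [exact: gen_smooth_cst|move=> x; exact: is_derive_coord].
- by exists (fun=> 0); [exact: gen_smooth_cst|move=> x; exact: is_derive_cst].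
- by exists (fun x => F' x + G' x); [exact: gen_smooth_add|move=> x; exact: is_deriveD].
- exists (fun x => F x * G' x + G x * F' x); last by move=> x; exact: is_deriveM.
  by apply: gen_smooth_add; apply: gen_smooth_mul.
- exists (fun x => derive1 q (F x) * F' x).
    by apply: gen_smooth_mul => //; apply: gen_smooth_comp => //; exact: smooth1_derive1.
  by move=> x; apply: is_derive_comp1 => //; exact: smooth1_is_derive.
Qed.

Lemma partialE i F F' : (forall x, is_derive x (e i) F (F' x)) -> partial i F = F'.
Proof. by move=> dF; apply/funext => x; exact: derive_val. Qed.

Lemma gen_smoothP F : gen_smooth F -> smooth F.
Proof.
move=> rF s; suff rs : gen_smooth (partials s F).
  split; first exact: gen_smooth_continuous.
  by move=> i x; have [F' _ /(_ x)[]] := gen_smooth_is_derive i rs.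
elim: s => [//|i s IHs] /=.
by have [F' rF' /partialE ->] := gen_smooth_is_derive i IHs.
Qed.

Lemma gen_smooth_sum (I : Type) (r : seq I) (F : I -> 'rV[R]_n -> R) :
  (forall i, gen_smooth (F i)) -> gen_smooth (fun x => \sum_(i <- r) F i x).
Proof.
move=> rF; elim: r => [|i r IHr].
  rewrite (_ : (fun _ => _) = fun=> 0); first exact: gen_smooth_cst.
  by apply/funext => y; rewrite big_nil.
rewrite (_ : (fun _ => _) = (fun x => F i x + \sum_(i <- r) F i x)).
  exact: gen_smooth_add.
by apply/funext => y; rewrite big_cons.
Qed.

Lemma gen_smooth_prod (I : Type) (r : seq I) (F : I -> 'rV[R]_n -> R) :
  (forall i, gen_smooth (F i)) -> gen_smooth (fun x => \prod_(i <- r) F i x).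
Proof.
move=> rF; elim: r => [|i r IHr].
  rewrite (_ : (fun _ => _) = fun=> 1); first exact: gen_smooth_cst.
  by apply/funext => y; rewrite big_nil.
rewrite (_ : (fun _ => _) = (fun x => F i x * \prod_(i <- r) F i x)).
  exact: gen_smooth_mul.
by apply/funext => y; rewrite big_cons.
Qed.

Lemma gen_smooth_sumsq : gen_smooth (fun x => \sum_i x ord0 i ^+ 2).
Proof.
apply: gen_smooth_sum => i.
rewrite (_ : (fun _ => _) = (fun x : 'rV[R]_n => x ord0 i * x ord0 i)).
  by apply: gen_smooth_mul; exact: gen_smooth_coord.
by apply/funext => x; rewrite expr2.
Qed.

(** The mean value theorem for t |-> g(t) - c t, with s of either sign. *)
Lemma mean_value_bound (g g' : R -> R) (c eps s : R) :
  (forall t : R, is_derive t 1 g (g' t)) ->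
  (forall t, `|t| <= `|s| -> `|g' t - c| <= eps) ->
  `|g s - g 0 - c * s| <= eps * `|s|.
Proof.
move=> dg g'c.
pose k t := g t - c * t.
have dk (t : R) : is_derive t 1 k (g' t - c).
  have h : is_derive t 1 (fun s => c * s) c.
    apply: (is_derive_eq (is_deriveM (is_derive_cst _ _ _) (is_derive_id _ _))).
    by rewrite scaler0 addr0 -[_ *: _]/(_ * _) mulr1.
  exact: (is_deriveB (dg t) h).
have ck : continuous k.
  by move=> t; apply: differentiable_continuous; apply/derivable1_diffP; have [] := dk t.
have -> : g s - g 0 - c * s = k s - k 0 by rewrite /k mulr0 subr0 addrAC.
have [s0|s0|<-] := ltgtP 0 s; last by rewrite subrr normr0 mulr0.
- have [t /[!in_itv]/= /andP[t0 ts] ->] := MVT s0 (fun t _ => dk t) (continuous_subspaceT ck).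
  rewrite subr0 normrM ler_wpM2r// g'c// !ger0_norm ?ltW//; exact: lt_trans ts.
- have [t /[!in_itv]/= /andP[ts t0] kE] := MVT s0 (fun t _ => dk t) (continuous_subspaceT ck).
  rewrite distrC kE normrM sub0r normrN ler_wpM2r// g'c//.
  by rewrite !ltr0_norm ?lerN2 ?ltW.
Qed.

(** [smooth] speaks of the axis directions only. The segment from x to x + h v is replaced by a path
    parallel to the axes; on each piece the mean value theorem and the continuity at x of one
    partial derivative give an error o(h). *)
Lemma smooth_is_derive_dir phi x v : smooth phi ->
  is_derive x v phi (\sum_i v ord0 i * partial i phi x).
Proof.
move=> sphi; have [n0|n0] := posnP n.
  have v0 : v = 0 by apply/rowP => i; have := ltn_ord i; rewrite [X in (_ < X)%N]n0.
  rewrite v0 big1; first exact: is_derive0.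
  by move=> i _; rewrite mxE mul0r.
(* v with only its first j coordinates kept: the points x + h w_j are the vertices of the path. *)
pose w (j : nat) : 'rV[R]_n := \row_i (if (i < j)%N then v ord0 i else 0).
(* All points of the path are within |h| M of x; the summand 1 keeps M positive when v = 0. *)
pose M := `|v| + `|v| + 1.
have M0 : 0 < M by rewrite ltr_wpDl// addr_ge0.
have key (eps : R) : 0 < eps -> \forall h \near (0 : R),
    `|phi (x + h *: v) - phi x - h * \sum_i v ord0 i * partial i phi x| <= eps * `|h|.
  (* There are n pieces, each with error at most eps1 |h| |v_j| <= (eps/n) |h|. *)
  move=> eps0; pose eps1 := eps / (n%:R * M).
  have eps10 : 0 < eps1 by rewrite divr_gt0// mulr_gt0// ltr0n.
  have : \forall y \near x, forall i, `|partial i phi y - partial i phi x| <= eps1.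
    suff h i : \forall y \near x, `|partial i phi y - partial i phi x| <= eps1.
      exact: filter_forall h.
    have := @smooth_continuous _ (smooth_partial i sphi) x.
    by move/cvgrPdist_le => /(_ _ eps10); apply: filterS => y; rewrite distrC.
  move=> /nbhs_ballP[d /= d0 hd].
  near=> h.
  have hM : `|h| * M < d.
    rewrite -ltr_pdivlMr//; near: h; apply/nbhs_ballP; exists (d / M) => [|h].
      by rewrite /= divr_gt0.
    by rewrite -ball_normE/= sub0r normrN.
  have vle j : `|v ord0 j| <= `|v|.
    by rewrite [leRHS]mx_normrE; apply: (le_bigmax _ (fun ij => `|v ij.1 ij.2|) (ord0, j)).
  have wle j : `|w j| <= `|v|.
    rewrite [leLHS]mx_normrE; apply: bigmax_le => // -[a b] _ /=; rewrite mxE.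
    by case: ifP => _; rewrite ?normr0// ord1 vle.
  have step (j : 'I_n) : `|phi (x + h *: w j.+1) - phi (x + h *: w j) -
      h * (v ord0 j * partial j phi x)| <= eps / n%:R * `|h|.
    have wS : w j.+1 = w j + v ord0 j *: e j.
      apply/rowP => i; rewrite !mxE eqxx/= ltnS leq_eqVlt.
      have [ij|ij|ij] := ltngtP i j; rewrite ?ltnn.
      - by rewrite orbT (_ : (i == j) = false) ?mulr0 ?addr0//; apply/negbTE; rewrite -val_eqE/= ltn_eqF.
      - by rewrite (_ : (i == j) = false) ?mulr0 ?addr0//; apply/negbTE; rewrite -val_eqE/= gtn_eqF.
      - by rewrite orTb (val_inj ij) eqxx mulr1 add0r.
    pose g t := phi (x + h *: w j + t *: e j).
    have := @mean_value_bound g (fun t => partial j phi (x + h *: w j + t *: e j))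
      (partial j phi x) eps1 (h * v ord0 j).
    rewrite /g scale0r addr0 wS scalerDr scalerA addrA.
    rewrite (mulrA h) (mulrC (partial j phi x)) => mv; apply: (le_trans (mv _ _)).
    - by move=> t; apply/is_derive_line; exact: smooth_is_derive.
    - move=> t th; apply: hd; rewrite -ball_normE /ball_/=.
      rewrite -addrA opprD addrA subrr sub0r normrN.
      apply: le_lt_trans hM; apply: (@le_trans _ _ (`|h| * (`|v| + `|v|))); last first.
        by rewrite ler_wpM2l// lerDl.
      rewrite mulrDr; apply: (le_trans (ler_normD _ _)); apply: lerD.
        by rewrite normrZ ler_wpM2l.
      rewrite normrZ; apply: (@le_trans _ _ (`|h| * `|v ord0 j| * 1)).
        rewrite ler_pM//; first by rewrite -normrM.
        rewrite [leLHS]mx_normrE; apply: bigmax_le => // -[a b] _ /=.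
        by rewrite mxE; case: (_ && _); rewrite ?normr0// normr1.
      by rewrite mulr1 ler_wpM2l.
    - rewrite normrM mulrA /eps1 invfM -!mulrA; apply: ler_wpM2l; first exact: ltW.
      apply: ler_wpM2l; first by rewrite invr_ge0.
      rewrite mulrCA -[leRHS]mulr1; apply: ler_wpM2l => //.
      by rewrite mulrC ler_pdivrMr// mul1r (le_trans (vle j))// /M -addrA lerDl addr_ge0.
  have tele : phi (x + h *: v) - phi x - h * (\sum_i v ord0 i * partial i phi x) =
     \sum_(j < n) (phi (x + h *: w j.+1) - phi (x + h *: w j) - h * (v ord0 j * partial j phi x)).
    rewrite sumrB -mulr_sumr; congr (_ - _).
    rewrite -(big_mkord xpredT (fun j => phi (x + h *: w j.+1) - phi (x + h *: w j))).
    rewrite telescope_sumr//; congr (phi (_ + _ *: _) - phi _).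
      by apply/rowP => i; rewrite mxE ltn_ord.
    rewrite (_ : w 0%N = 0) ?scaler0 ?addr0//.
    by apply/rowP => i; rewrite !mxE ltn0.
  rewrite tele; apply: le_trans (ler_norm_sum _ _ _) _.
  apply: le_trans (ler_sum _ (fun j _ => step j)) _.
  rewrite sumr_const card_ord -[leLHS]mulr_natr mulrAC mulfVK//.
  by rewrite pnatr_eq0 -lt0n.
set L := \sum_i _ in key *.
have dL : (fun h : R => h^-1 *: (phi (h *: v + x) - phi x)) @ 0^' --> L.
  apply/cvgrPdist_le => eps eps0; have := key _ eps0.
  move=> /nbhs_ballP[d /= d0 hd]; apply/nbhs_ballP; exists d => //= h /hd hh h0.
  rewrite -[_ *: (_ - _)]/(_ * _) (_ : L - _ = - (h^-1 * (phi (h *: v + x) - phi x - h * L))).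
    rewrite normrN normrM normfV ler_pdivrMl ?normr_gt0// [leRHS]mulrC.
    by rewrite [h *: v + x]addrC.
  by rewrite (mulrBr h^-1 _ (h * L)) mulKf// opprB.
by split; [apply/cvg_ex; exists L; exact: dL|apply/cvg_lim => //; exact: dL].
Unshelve. all: by end_near. Qed.

End smooth_row.

(** * Test functions *)

Section bounded_support.
Context {R : realType} (n : nat).
Implicit Types (F phi : 'rV[R]_n -> R) (Om : set 'rV[R]_n).
Notation e i := (delta_mx ord0 i : 'rV[R]_n).

Definition bounded_supp F := exists2 M : R, 0 < M & forall x, M <= `|x| -> F x = 0.

Lemma bounded_supp_is_derive i F F' :
  (forall x, is_derive x (e i) F (F' x)) -> bounded_supp F -> bounded_supp F'.
Proof.
(* The margin 1 makes F vanish in a neighbourhood of x, not only at x. *)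
move=> dF [M M0 FM]; exists (M + 1) => [|x xM]; first exact: addr_gt0.
have dF0 : is_derive x (e i) F 0.
  apply: (near_eq_is_derive (f := fun=> 0 : R)).
  have Mx : M < `|x| by apply: lt_le_trans xM; rewrite ltrDl.
  have : \forall y \near x, M < `|y|.
    by have := @norm_continuous _ _ x => /(_ _ (lt_nbhsr Mx)).
  by apply: filterS => y /ltW/FM.
by rewrite -(@derive_val _ _ _ _ _ _ _ (dF x)) (@derive_val _ _ _ _ _ _ _ dF0).
Qed.

Lemma bounded_supp_bounded F : continuous F -> bounded_supp F ->
  exists2 C : R, 0 <= C & forall x, `|F x| <= C.
Proof.
move=> cF [M M0 FM].
have cK : compact [set x : 'rV[R]_n | forall i, `[- M, M]%classic (x ord0 i)].
  exact: (rV_compact (fun=> @segment_compact R (- M) M)).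
have := compact_bounded (continuous_compact (continuous_subspaceT cF) cK).
move=> [A [_ /(_ (`|A| + 1))]]; rewrite (le_lt_trans (ler_norm _))// ?ltrDl// => /(_ isT) hA.
exists (`|A| + 1) => [|x]; first exact: addr_ge0.
have [xM|Mx] := ltP `|x| M; last by rewrite FM// normr0 addr_ge0.
apply: hA; exists x => // i /=; rewrite in_itv/= -ler_norml.
apply: le_trans (ltW xM); rewrite [leRHS]mx_normrE.
by apply: (le_bigmax _ (fun ij => `|x ij.1 ij.2|) (ord0, i)).
Qed.

Lemma bounded_supp_integrable F : continuous F -> bounded_supp F ->
  (lebesgue_row n).-integrable setT (EFin \o F).
Proof.
move=> cF bF; have [C C0 FC] := bounded_supp_bounded cF bF; case: bF => M M0 FM.
have mF : measurable_fun setT (F : _ -> measurableTypeR R) by exact: continuous_row_measurable.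
apply/integrableP; split; first exact/measurable_EFinP.
have mB : measurable (row_box (fun=> `[(- M)%R, M]%classic) : set 'rV[R]_n).
  by apply: measurable_row_box => i; exact: measurable_itv.
apply: (@le_lt_trans _ _ (\int[lebesgue_row n]_(x in row_box (fun=> `[(- M)%R, M]%classic)) C%:E)%E).
  rewrite [leRHS]integral_mkcond; apply: le_integralT => x _.
  rewrite patchE; case: ifPn => [_|xB]; first by rewrite /= lee_fin.
  rewrite /= FM ?normr0// leNgt; apply/negP => xM; move/negP: xB; apply; rewrite inE => i /=.
  rewrite in_itv/= -ler_norml; apply: le_trans (ltW xM); rewrite [leRHS]mx_normrE.
  by apply: (le_bigmax _ (fun ij => `|x ij.1 ij.2|) (ord0, i)).
by rewrite integral_cst// lte_mul_pinfty// lebesgue_row_box_lty.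
Qed.

Lemma test_bounded_supp Om phi : test_function Om phi -> bounded_supp phi.
Proof.
move=> [_ /compact_bounded [A [_ +]] _] => /(_ (`|A| + 1)).
rewrite (le_lt_trans (ler_norm _))// ?ltrDl// => /(_ isT) hA.
exists (`|A| + 1 + 1) => [|x xA]; first by rewrite addr_gt0// ltr_wpDl.
apply/eqP; apply: contraT => px.
have cx : closure [set x | phi x != 0] x by exact: subset_closure.
by have := le_trans xA (hA _ cx); rewrite gerDl ler10.
Qed.

Lemma test_out Om phi x : test_function Om phi -> ~ Om x -> phi x = 0.
Proof.
move=> [_ _ sO] Ox; apply/eqP; apply: contraT => px; exfalso; apply/Ox/sO.
exact: subset_closure.
Qed.

Lemma test_partial_out Om phi i x : test_function Om phi -> ~ Om x -> partial i phi x = 0.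
Proof.
move=> [_ _ sO] Ox.
have Cx : ~ closure [set x | phi x != 0] x by move=> /sO.
have dF0 : is_derive x (e i) phi 0.
  apply: (near_eq_is_derive (f := fun=> 0 : R)).
  have : \forall y \near x, ~ closure [set x | phi x != 0] y.
    by apply: open_nbhs_nbhs; split => //; apply: closed_openC; exact: closed_closure.
  apply: filterS => y hy; apply/esym/eqP; apply: contraT => py; exfalso; apply: hy.
  exact: subset_closure.
exact: (@derive_val _ _ _ _ _ _ _ dF0).
Qed.

Lemma test_functionI Om phi (C : set 'rV[R]_n) (M : R) : smooth phi -> closed C ->
  (forall x, C x -> `|x| <= M) -> C `<=` Om -> (forall x, ~ C x -> phi x = 0) ->
  test_function Om phi.
Proof.
move=> sphi cC CM CO phiC.
have sC : closure [set x | phi x != 0] `<=` C.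
  rewrite [X in _ `<=` X](closure_id C).1//; apply: closureS.
  by move=> x /= px; apply: contrapT => /phiC p0; move: px; rewrite p0 eqxx.
split => //; last exact: subset_trans CO.
apply: bounded_closed_compact; last exact: closed_closure.
exists M; split; first by rewrite num_real.
by move=> y My x /sC/CM xM; apply: le_trans xM (ltW My).
Qed.

Definition gradient phi x : 'rV[R]_n := \row_i partial i phi x.

Lemma test_gradient_out Om phi x : test_function Om phi -> ~ Om x -> gradient phi x = 0.
Proof.
by move=> tp Ox; apply/rowP => i; rewrite !mxE (test_partial_out i tp).
Qed.

End bounded_support.

Section integral_partial.
Context {R : realType} (n : nat).
Notation e i := (delta_mx ord0 i : 'rV[R]_n.+1).

Lemma row_insertD (i : 'I_n.+1) (t : R) (v : 'rV[R]_n) :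
  row_insert i (t, v) = row_insert i (0, v) + t *: e i.
Proof.
apply/rowP => j; rewrite !mxE eqxx/=; case: unliftP => [k|] ->/=.
  by rewrite eq_sym (negbTE (neq_lift _ _)) mulr0 addr0.
by rewrite eqxx mulr1 add0r.
Qed.

(** Fubini with the coordinate [i] first: on each line the integral is the difference of the values
    of F at two points beyond its support. *)
Lemma integral_partial0 (i : 'I_n.+1) (F F' : 'rV[R]_n.+1 -> R) :
  (forall x, is_derive x (e i) F (F' x)) -> continuous F' -> bounded_supp F ->
  (\int[lebesgue_row n.+1]_x (F' x)%:E = 0)%E.
Proof.
move=> dF cF' bF; have bF' := bounded_supp_is_derive dF bF.
rewrite (integral_row_insert i); last exact: bounded_supp_integrable.
apply: integral0_eq => v _.
have [M M0 FM] := bF; have [M' M'0 FM'] := bF'.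
pose B := Num.max M M'.
have B0 : 0 < B by rewrite lt_max M0.
have insB t : B <= `|t| -> B <= `|row_insert i (t, v)|.
  move=> Bt; apply: (le_trans Bt); rewrite [leRHS]mx_normrE.
  have -> : `|t| = `|row_insert i (t, v) ord0 i| by rewrite mxE unlift_none.
  by apply: (le_bigmax _ (fun ij => `|row_insert i (t, v) ij.1 ij.2|) (ord0, i)).
pose h t := F (row_insert i (t, v)); pose h' t := F' (row_insert i (t, v)).
have dh (t : R) : is_derive t 1 h (h' t).
  rewrite /h' row_insertD (_ : h = fun s => F (row_insert i (0, v) + s *: e i)).
    by apply/is_derive_line.
  by apply/funext => s; rewrite /h row_insertD.
have ch' : continuous h'.
  move=> t; rewrite /h'; apply: (@continuous_comp _ _ _ (fun s => row_insert i (s, v)) F').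
    rewrite (_ : (fun s => _) = (fun s : R => row_insert i (0, v) + s *: e i)).
      by apply: cvgD; [exact: cvg_cst|apply: cvgZl; exact: cvg_id].
    by apply/funext => s; rewrite row_insertD.
  exact: cF'.
have ch : continuous h.
  by move=> t; apply: differentiable_continuous; apply/derivable1_diffP; have [] := dh t.
have BB : - B < B by rewrite gtrN.
transitivity (\int[lebesgue_measure]_(t in `[(- B)%R, B]) (h' t)%:E)%E.
  rewrite [RHS]integral_mkcond; apply: eq_integral => t _; rewrite patchE.
  case: ifPn => // /negP; rewrite inE/= in_itv/= -ler_norml => /negP; rewrite -ltNge => Bt.
  by rewrite FM'//; apply: le_trans (insB _ (ltW Bt)); rewrite le_max lexx orbT.
have -> := @continuous_FTC2 R h' h (- B) B BB.
- rewrite /h !FM ?subee//; apply: le_trans (insB _ _); rewrite ?le_max ?lexx//.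
    by rewrite ?normrN ger0_norm// ltW.
  by rewrite ?normrN ger0_norm// ltW.
- exact: continuous_subspaceT.
- split.
  + by move=> t _; have [] := dh t.
  + by apply: cvg_at_right_filter; exact: ch.
  + by apply: cvg_at_left_filter; exact: ch.
- by move=> t _; rewrite derive1E; exact: derive_val.
Qed.

Lemma integral_by_parts_row (i : 'I_n.+1) (F F' G G' : 'rV[R]_n.+1 -> R) :
  (forall x, is_derive x (e i) F (F' x)) -> continuous F -> continuous F' ->
  (forall x, is_derive x (e i) G (G' x)) -> continuous G -> continuous G' ->
  bounded_supp G ->
  (\int[lebesgue_row n.+1]_x (F x * G' x)%:E = - \int[lebesgue_row n.+1]_x (F' x * G x)%:E)%E.
Proof.
move=> dF cF cF' dG cG cG' bG.
have bG' := bounded_supp_is_derive dG bG.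
have bM H K : bounded_supp K -> bounded_supp (fun x : 'rV[R]_n.+1 => H x * K x).
  by move=> [M M0 KM]; exists M => // x /KM ->; rewrite mulr0.
have cM (H K : 'rV[R]_n.+1 -> R) : continuous H -> continuous K -> continuous (fun x => H x * K x).
  by move=> cH cK x; apply: continuousM; [exact: cH|exact: cK].
have i1 : (lebesgue_row n.+1).-integrable setT (EFin \o (fun x => F x * G' x)).
  by apply: bounded_supp_integrable; [exact: cM|exact: bM].
have i2 : (lebesgue_row n.+1).-integrable setT (EFin \o (fun x => F' x * G x)).
  by apply: bounded_supp_integrable; [exact: cM|exact: bM].
have h1 x : is_derive x (e i) (fun x => F x * G x) (F x * G' x + F' x * G x).
  by apply: (is_derive_eq (is_deriveM (dF x) (dG x))); rewrite [F' x * _]mulrC.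
have h2 : continuous (fun x => F x * G' x + F' x * G x).
  move=> x; apply: (@continuousD _ _ _ (fun x => F x * G' x) (fun x => F' x * G x)); exact: cM.
have := integral_partial0 h1 h2 (bM _ _ bG).
under eq_integral do rewrite EFinD.
rewrite integralD// => E; rewrite -[LHS](addeK (x := \int[lebesgue_row n.+1]_x (F' x * G x)%:E)%E).
  by rewrite E add0e.
exact: integrable_fin_num.
Qed.

End integral_partial.

(** * The fundamental lemma of the calculus of variations *)

Section dynkin_integral.
Local Open Scope ereal_scope.
Context (R : realType) (dS : measure_display) (S : measurableType dS).

Lemma integral_preimageC d (T : measurableType d) (mu : {measure set T -> \bar R})
    (D : set T) (g : T -> \bar R) (h : T -> S) (A : set S) :
  measurable D -> mu.-integrable D g -> measurable_fun setT h -> measurable A ->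
  \int[mu]_(x in D `&` h @^-1` (~` A)) g x =
  \int[mu]_(x in D) g x - \int[mu]_(x in D `&` h @^-1` A) g x.
Proof.
move=> mD ig mh mA.
have mhA (B : set S) : measurable B -> measurable (D `&` h @^-1` B).
  by move=> mB; apply: measurableI => //; rewrite -[X in measurable X]setTI; exact: mh.
have DE : D = (D `&` h @^-1` A) `|` (D `&` h @^-1` (~` A)).
  by rewrite -setIUr -preimage_setU setUv preimage_setT setIT.
rewrite [X in _ = X - _](_ : _ = \int[mu]_(x in (D `&` h @^-1` A) `|` (D `&` h @^-1` (~` A))) g x); last first.
  by rewrite -DE.
rewrite integral_setU//; [|exact: mhA|exact/mhA/measurableC| |].
- rewrite addeC addeK//; apply: integrable_fin_num; first exact: mhA.
  by apply: integrableS ig => //; exact: mhA.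
- by rewrite -DE; case/integrableP: ig.
- apply/disj_setPLR => x [_ hx] [_]; exact.
Qed.

(* Uniqueness of signed measures on a generating pi-system, for images of densities *)
Lemma dynkin_integral_eq d1 (T1 : measurableType d1) (mu1 : {measure set T1 -> \bar R})
    (D1 : set T1) (g1 : T1 -> \bar R) (h1 : T1 -> S)
    d2 (T2 : measurableType d2) (mu2 : {measure set T2 -> \bar R})
    (D2 : set T2) (g2 : T2 -> \bar R) (h2 : T2 -> S) (G : set (set S)) :
  @measurable _ S = <<s G >> -> setI_closed G ->
  measurable D1 -> mu1.-integrable D1 g1 -> measurable_fun setT h1 ->
  measurable D2 -> mu2.-integrable D2 g2 -> measurable_fun setT h2 ->
  \int[mu1]_(x in D1) g1 x = \int[mu2]_(x in D2) g2 x ->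
  (forall A, G A -> \int[mu1]_(x in D1 `&` h1 @^-1` A) g1 x =
                    \int[mu2]_(x in D2 `&` h2 @^-1` A) g2 x) ->
  forall A, measurable A -> \int[mu1]_(x in D1 `&` h1 @^-1` A) g1 x =
                            \int[mu2]_(x in D2 `&` h2 @^-1` A) g2 x.
Proof.
move=> mG GI mD1 ig1 mh1 mD2 ig2 mh2 eqT eqG A; rewrite mG.
apply: (dynkin_induction (P := fun A => \int[mu1]_(x in D1 `&` h1 @^-1` A) g1 x =
                            \int[mu2]_(x in D2 `&` h2 @^-1` A) g2 x)) => //.
- by rewrite !preimage_setT !setIT.
- by move=> B mB PB; rewrite !integral_preimageC// eqT PB.
move=> F mF tF PF; rewrite !preimage_bigcup !setI_bigcupr.
have mhF d (T : measurableType d) (D : set T) (h : T -> S) k :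
    measurable D -> measurable_fun setT h -> measurable (D `&` h @^-1` F k).
  by move=> mD mh; apply: measurableI => //; rewrite -[X in measurable X]setTI; exact: mh.
have tr d (T : measurableType d) (D : set T) (h : T -> S) :
    trivIset setT (fun k => D `&` h @^-1` F k).
  apply/trivIsetP => i j _ _ ij; apply/seteqP; split => // x [[_ xi] [_ xj]].
  have /= FF : F i `&` F j = set0 by move/trivIsetP : tF; apply.
  have : (F i `&` F j) (h x) by split; [exact: xi|exact: xj].
  by rewrite FF.
have sub d (T : measurableType d) (D : set T) (h : T -> S) :
    \bigcup_k (D `&` h @^-1` F k) `<=` D by move=> x [k _ []].
have ibc d (T : measurableType d) (mu : {measure set T -> \bar R}) (D : set T)
    (g : T -> \bar R) (h : T -> S) : measurable D -> mu.-integrable D g ->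
    measurable_fun setT h -> \int[mu]_(x in \bigcup_k (D `&` h @^-1` F k)) g x =
    \sum_(0 <= k <oo) \int[mu]_(x in D `&` h @^-1` F k) g x.
  move=> mD ig mh; apply: integral_bigcup; [exact: tr|by move=> k; exact: mhF|].
  apply: integrableS ig => //.
  by apply: bigcupT_measurable => k; exact: mhF.
by rewrite !ibc//; exact: eq_eseriesr.
Qed.

End dynkin_integral.

Section fundamental_lemma.
Context {R : realType} (n : nat).
Implicit Types (Om : set 'rV[R]_n).
Notation lrow := (lebesgue_row n).

Lemma integrable_mul_bounded d (T : measurableType d) (mu : {measure set T -> \bar R})
    (D : set T) (g h : T -> R) (C : R) :
  measurable D -> mu.-integrable D (EFin \o g) -> measurable_fun D h ->
  (forall x, D x -> `|h x| <= C) -> mu.-integrable D (EFin \o (fun x => g x * h x)).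
Proof.
move=> mD ig mh hC.
have mg : measurable_fun D g by case/integrableP: ig => /measurable_EFinP.
apply: (@le_integrable _ _ _ mu D mD _ (fun x => (C%:E * (g x)%:E)%E)).
- by apply/measurable_EFinP; exact: measurable_funM.
- move=> x Dx /=; rewrite lee_fin normrM mulrC [leRHS]normrM ler_wpM2r//.
  exact: le_trans (hC x Dx) (ler_norm _).
- exact: integrableZl.
Qed.

Lemma cvg_integral_mul_bounded d (T : measurableType d) (mu : {measure set T -> \bar R})
    (D : set T) (g h : T -> R) (h_ : nat -> T -> R) (C : R) :
  measurable D -> mu.-integrable D (EFin \o g) ->
  (forall k, measurable_fun D (h_ k)) -> measurable_fun D h ->
  (forall k x, D x -> `|h_ k x| <= C) ->
  {ae mu, forall x, D x -> h_ k x @[k --> \oo] --> h x} ->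
  (\int[mu]_(x in D) (g x * h_ k x)%:E @[k --> \oo] -->
   \int[mu]_(x in D) (g x * h x)%:E)%E.
Proof.
move=> mD ig mh_ mh hC hh.
have mg : measurable_fun D g by case/integrableP: ig => /measurable_EFinP.
have [] := @dominated_convergence _ _ _ mu D mD (fun k x => (g x * h_ k x)%:E)
  (fun x => (g x * h x)%:E) (fun x => (C%:E * `|(g x)%:E|)%E).
- by move=> k; apply/measurable_EFinP; exact: measurable_funM.
- by apply/measurable_EFinP; exact: measurable_funM.
- apply: filterS hh => x hx Dx; apply: cvg_EFin; first exact: nearW.
  by apply: cvgMr; exact: hx.
- by apply: integrableZl => //; exact: integrable_abse.
- apply: nearW => x k Dx; rewrite -EFinM lee_fin normrM mulrC ler_wpM2r//.
  exact: hC.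
by [].
Qed.

Definition obox (a b : 'rV[R]_n) : set 'rV[R]_n := [set x | forall i, a ord0 i < x ord0 i < b ord0 i].
Definition cbox (a b : 'rV[R]_n) : set 'rV[R]_n := [set x | forall i, a ord0 i <= x ord0 i <= b ord0 i].

Lemma oboxE a b : obox a b = row_box (fun i => `]a ord0 i, b ord0 i[%classic).
Proof. by apply/seteqP; split => x h i; have := h i; rewrite /= in_itv. Qed.

Lemma measurable_obox a b : measurable (obox a b).
Proof. by rewrite oboxE; apply: measurable_row_box => i; exact: measurable_itv. Qed.

Lemma closed_cbox a b : closed (cbox a b).
Proof.
rewrite (_ : cbox a b = \bigcap_(i in [set: 'I_n])
   ((fun x : 'rV[R]_n => x ord0 i) @^-1` `[a ord0 i, b ord0 i]%classic)).
  apply: closed_bigI => i _; apply: closed_comp => [x _|]; first exact: coord_continuous.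
  exact: interval_closed.
by apply/seteqP; split => [x h i _|x h i]; have := h i; rewrite /= in_itv//=; apply.
Qed.

Definition box_bump (a b : 'rV[R]_n) (k : nat) (x : 'rV[R]_n) : R :=
  \prod_i bump (a ord0 i) (b ord0 i) k (x ord0 i).

Lemma box_bump_ge0 a b k x : 0 <= box_bump a b k x.
Proof. by apply: prodr_ge0 => i _; exact: bump_ge0. Qed.

Lemma box_bump_le1 a b k x : box_bump a b k x <= 1.
Proof.
suff /andP[] : 0 <= box_bump a b k x <= 1 by [].
apply: (big_ind (fun y : R => 0 <= y <= 1)) => [|u v /andP[u0 u1] /andP[v0 v1]|i _].
- by rewrite ler01 lexx.
- by rewrite mulr_ge0//= mulr_ile1.
- by rewrite bump_ge0 bump_le1.
Qed.

Lemma test_box_bump Om a b k : cbox a b `<=` Om -> test_function Om (box_bump a b k).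
Proof.
move=> abO; apply: (@test_functionI _ _ _ _ (cbox a b) (`|a| + `|b|)) => //.
- apply: gen_smoothP; apply: gen_smooth_prod => i; apply: gen_smooth_comp; last exact: gen_smooth_coord.
  exact/gen_smooth1P/gen_smooth1_bump.
- exact: closed_cbox.
- move=> x h; rewrite [leLHS]mx_normrE; apply: bigmax_le; first exact: addr_ge0.
  move=> [i j] _ /=; rewrite ord1.
  have aj : `|a ord0 j| <= `|a|.
    by rewrite [leRHS]mx_normrE; apply: (le_bigmax _ (fun ij => `|a ij.1 ij.2|) (ord0, j)).
  have bj : `|b ord0 j| <= `|b|.
    by rewrite [leRHS]mx_normrE; apply: (le_bigmax _ (fun ij => `|b ij.1 ij.2|) (ord0, j)).
  have /andP[h1 h2] := h j; rewrite ler_norml; apply/andP; split.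
    apply: le_trans h1; rewrite lerNl; apply: (le_trans (ler_norm _)); rewrite normrN.
    by apply: (le_trans aj); rewrite lerDl.
  apply: (le_trans h2); apply: (le_trans (ler_norm _)); apply: (le_trans bj).
  by rewrite lerDr.
- move=> x /existsNP[i hi].
  rewrite /box_bump (bigD1 i)//= bump_out ?mul0r// => /andP[h1 h2]; apply: hi.
  by rewrite !ltW.
Qed.

Lemma cvg_box_bump a b x : box_bump a b k x @[k --> \oo] --> (\1_(obox a b) x : R).
Proof.
have -> : (\1_(obox a b) x : R) = \prod_i (a ord0 i < x ord0 i < b ord0 i)%R%:R.
  rewrite indicE; have [/set_mem h|/negP h] := boolP (x \in _).
    by rewrite big1// => i _; rewrite h.
  apply/esym/eqP; apply/prodf_eq0.
  have : exists i, ~ (a ord0 i < x ord0 i < b ord0 i).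
    by apply/existsNP => h'; apply: h; rewrite inE.
  by move=> [i /negP/negbTE hi]; exists i => //; rewrite hi.
rewrite /box_bump; elim: (index_enum _) => [|i r IHr].
  by rewrite big_nil; under eq_cvg do rewrite big_nil; exact: cvg_cst.
rewrite big_cons; under eq_cvg do rewrite big_cons.
by apply: cvgM => //; exact: cvg_bump.
Qed.

Definition oboxes : set (set 'rV[R]_n) := [set obox ab.1 ab.2 | ab in setT].

Lemma obox_setI (a b c d : 'rV[R]_n) : obox (\row_i Num.max (a ord0 i) (c ord0 i))
  (\row_i Num.min (b ord0 i) (d ord0 i)) = obox a b `&` obox c d.
Proof.
apply/seteqP; split => [x h|x [h1 h2] i].
  by split => i; have := h i; rewrite !mxE gt_max lt_min => /andP[/andP[h1 h2] /andP[h3 h4]];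
    rewrite ?h1 ?h2 ?h3 ?h4.
have /andP[h3 h4] := h1 i; have /andP[h5 h6] := h2 i.
by rewrite !mxE gt_max lt_min h3 h4 h5 h6.
Qed.

Lemma oboxes_setI : setI_closed oboxes.
Proof. by move=> _ _ [[a b] _ <-] [[c d] _ <-] /=; rewrite -obox_setI; eexists (_, _). Qed.

Lemma measurable_oboxesE : measurable = <<s oboxes >>.
Proof.
apply/seteqP; split; last first.
  apply: smallest_sub; first exact: sigma_algebra_measurable.
  by move=> _ [ab _ <-]; exact: measurable_obox.
apply: smallest_sub; first exact: smallest_sigma_algebra.
rewrite -bigcup_seq => X [i _ [Y mY <-]]; rewrite setTI.
have sG : sigma_algebra setT <<s oboxes >> by exact: smallest_sigma_algebra.
have /(_ Y mY) : @measurable _ (measurableTypeR R) `<=`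
    [set Y | <<s oboxes >> ((fun x : 'rV[R]_n => x ord0 i) @^-1` Y)].
  rewrite (RGenOpens.measurableE R); apply: smallest_sub.
    case: sG => s0 sC sU; split => /=.
    - by rewrite preimage_set0.
    - by move=> A hA; rewrite setTD preimage_setC -setTD; exact: sC.
    - by move=> F hF; rewrite preimage_bigcup; exact: sU.
  move=> _ [u [v ->]] /=.
  (* The slab u < x_i < v is the union of the boxes that bound the other coordinates by k. *)
  rewrite (_ : _ @^-1` _ = \bigcup_k obox (\row_j if j == i then u else - k%:R)
     (\row_j if j == i then v else k%:R)).
    case: sG => _ _ sU; apply: sU => k; apply: sub_sigma_algebra.
    by eexists (_, _).
  apply/seteqP; split => [x /=|x [k _ /(_ i)]]; last by rewrite !mxE eqxx /= in_itv.
  rewrite in_itv/= => hx; exists (Num.truncn `|x|).+1 => // j.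
  rewrite !mxE; case: eqP => [->//|_]; rewrite -ltr_norml.
  apply: (@le_lt_trans _ _ `|x|); last exact: truncnS_gt.
  by rewrite [leRHS]mx_normrE; apply: (le_bigmax _ (fun ij => `|x ij.1 ij.2|) (ord0, j)).
by [].
Qed.

(** Testing against [box_bump] and passing to the limit, g has integral 0 over every open box whose
    closure lies in [Om]. Inside such a box, open boxes form a generating pi-system, so g = 0 a.e.
    there; countably many such boxes cover [Om]. *)
Lemma fundamental_lemma Om (g : 'rV[R]_n -> R) : open Om ->
  lrow.-integrable Om (EFin \o g) ->
  (forall phi, test_function Om phi -> \int[lrow]_(x in Om) (g x * phi x)%:E = 0)%E ->
  {ae lrow, forall x, Om x -> g x = 0}.
Proof.
move=> oO ig g0.
have mO : measurable Om := open_row_measurable oO.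
have mg : measurable_fun Om g by case/integrableP: ig => /measurable_EFinP.
have intbox a b : cbox a b `<=` Om -> (\int[lrow]_(x in Om `&` obox a b) (g x)%:E = 0)%E.
  move=> abO.
  rewrite integral_mkcondr.
  have mb k : measurable_fun Om (box_bump a b k : _ -> R).
    apply: measurable_funTS; apply: continuous_row_measurable; apply: smooth_continuous.
    by have [] := test_box_bump k abO.
  have := @cvg_integral_mul_bounded _ _ lrow Om g (\1_(obox a b)) (box_bump a b) 1 mO ig.
  move=> /(_ mb _ _ _).
  have mi : measurable_fun Om (\1_(obox a b) : _ -> R) by apply: measurable_indic; exact: measurable_obox.
  have b1 k x : Om x -> `|box_bump a b k x| <= 1.
    by move=> _; rewrite ger0_norm ?box_bump_ge0// box_bump_le1.
  have cb : {ae lrow, forall x, Om x -> box_bump a b k x @[k --> \oo] --> (\1_(obox a b) x : R)}.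
    by apply: nearW => x _; exact: cvg_box_bump.
  move=> /(_ mi b1 cb).
  under eq_cvg do rewrite (g0 _ (test_box_bump _ abO)).
  move=> /(cvg_lim (@ereal_hausdorff R)); rewrite lim_cst// => ->.
  apply: eq_integral => x _; rewrite patchE indicE; case: ifPn => _; by rewrite ?mulr1// mulr0.
have aebox a b : cbox a b `<=` Om -> {ae lrow, forall x, obox a b x -> g x = 0}.
  move=> abO.
  have mD := measurable_obox a b.
  have DO : obox a b `<=` Om.
    by apply: subset_trans abO => x h i; have /andP[h1 h2] := h i; rewrite !ltW.
  have igD : lrow.-integrable (obox a b) (EFin \o g) by exact: integrableS ig.
  have : ae_eq lrow (obox a b) (EFin \o g) (cst 0%E).
    apply: integral_ae_eq => // E ED mE.
    have := @dynkin_integral_eq R _ _ _ _ lrow (obox a b) (EFin \o g) id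
      _ _ lrow (obox a b) (cst 0%E) id oboxes measurable_oboxesE oboxes_setI
      mD igD _ mD (integrable0 _ _) _ _ _ E mE.
    rewrite preimage_id (setIidr ED); apply => //.
    - by rewrite integral0 -(intbox a b abO) setIidr.
    - move=> _ [[c d] _ <-]; rewrite !preimage_id integral0 -obox_setI.
      rewrite -(intbox (\row_i Num.max (a ord0 i) (c ord0 i)) (\row_i Num.min (b ord0 i) (d ord0 i))).
        rewrite setIidr// obox_setI; exact: subset_trans DO.
      apply: subset_trans abO => x h i; have := h i; rewrite !mxE.
      by rewrite ge_max le_min => /andP[/andP[-> _] /andP[-> _]].
  by apply: filterS => x /[apply] /= -[].
(* For s = -1 and s = 1 these are opposite corners of the cube with rational centre q.1 and
   half-side 1/(q.2 + 1); [unpickle] below enumerates these cubes. *)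
pose box (q : 'rV[rat]_n * nat) (s : R) : 'rV[R]_n :=
  \row_i (ratr (q.1 ord0 i) + s * q.2.+1%:R^-1).
have : {ae lrow, forall x m, (if unpickle m is Some q then
    cbox (box q (- 1)) (box q 1) `<=` Om /\ obox (box q (- 1)) (box q 1) x
    else False) -> g x = 0}.
  apply: ae_foralln => m; case: unpickle => [q|]; last exact: nearW.
  have [/aebox|nab] := pselect (cbox (box q (- 1)) (box q 1) `<=` Om).
    by apply: filterS => x gx [_ /gx].
  by apply: nearW => x [/nab].
apply: filterS => x gx Ox.
have /nbhs_ballP[e /= e0 eO] := open_nbhs_nbhs (conj oO Ox).
have [k _ /(_ k (leqnn _)) ke] := near_infty_natSinv_lt (PosNum (divr_gt0 e0 (ltr0Sn R 1))).
have /= ke2 : k.+1%:R^-1 < e / 2 := ke.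
have k0 : 0 < k.+1%:R^-1 :> R by rewrite invr_gt0.
have qP i : exists q : rat, ball (x ord0 i) (k.+1%:R^-1 : R) (ratr q).
  have bx : ball (x ord0 i) (k.+1%:R^-1 : R) !=set0 by exists (x ord0 i); exact: ballxx.
  by have [y [hy [q _ qE]]] := dense_rat bx (ball_open _ _); exists q; rewrite qE.
pose q i := xget 0%R [set q : rat | ball (x ord0 i) (k.+1%:R^-1 : R) (ratr q)].
have qB i : ball (x ord0 i) (k.+1%:R^-1 : R) (ratr (q i)) by exact: (xgetPex _ (qP i)).
pose Q : 'rV[rat]_n * nat := (\row_i q i, k).
have QE i s : box Q s ord0 i = ratr (q i) + s * k.+1%:R^-1 by rewrite !mxE.
apply: (gx (pickle Q)); rewrite pickleK; split; last first.
  move=> i; rewrite !QE mulN1r mul1r; have := qB i; rewrite /ball/= ltr_distlC => /andP[h1 h2].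
  by rewrite ltrBlDr h2 -ltrBlDr h1.
move=> y hy; apply: eO; split => // i j; rewrite ord1.
have := hy j; rewrite !QE mulN1r mul1r => /andP[h1 h2].
have := qB j; rewrite /ball/= !ltr_distlC => /andP[h3 h4].
move: (k.+1%:R^-1) ke2 h1 h2 h3 h4 => c ke2 h1 h2 h3 h4.
by apply/andP; split; lra.
Qed.

End fundamental_lemma.

(** * Weak gradients *)

Section Rintegral_bounds.
Context d (T : measurableType d) (R : realType) (mu : {measure set T -> \bar R}).
Variables (D : set T) (mD : measurable D).
Implicit Types (f g h : T -> R).

Lemma integrable_subr f g : mu.-integrable D (EFin \o f) -> mu.-integrable D (EFin \o g) ->
  mu.-integrable D (EFin \o (fun x => f x - g x)).
Proof.
move=> i1 i2; rewrite (_ : EFin \o _ = (EFin \o f) \- (EFin \o g))%E//.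
exact: integrableB.
Qed.

Lemma normr_Rintegral_le f (b : R) : mu.-integrable D (EFin \o f) ->
  (\int[mu]_(x in D) `|f x|%:E <= b%:E)%E -> `|(\int[mu]_(x in D) f x)%R| <= b.
Proof.
move=> i1 fb; apply: (le_trans (le_normr_Rintegral mD i1)).
rewrite -lee_fin fineK//; rewrite ge0_fin_numE ?integral_ge0//.
exact: le_lt_trans fb (ltry _).
Qed.

Lemma normr_Rintegral_mul_le f h (C b : R) : mu.-integrable D (EFin \o f) ->
  measurable_fun D h -> 0 <= C -> (forall x, D x -> `|h x| <= C) ->
  (\int[mu]_(x in D) `|f x|%:E <= b%:E)%E ->
  `|(\int[mu]_(x in D) (f x * h x))%R| <= C * b.
Proof.
move=> i1 mh C0 hC fb; apply: normr_Rintegral_le.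
  exact: (integrable_mul_bounded (C := C)).
have mf : measurable_fun D f by case/integrableP: i1 => /measurable_EFinP.
apply: (@le_trans _ _ (\int[mu]_(x in D) (C%:E * `|f x|%:E))%E).
  apply: le_integralT => x Dx; rewrite -EFinM lee_fin normrM mulrC.
  by rewrite ler_wpM2r// hC.
rewrite ge0_integralZl_EFin//; last by apply/measurable_EFinP; exact: measurableT_comp.
by rewrite EFinM lee_wpmul2l.
Qed.

End Rintegral_bounds.

Section weak_gradients.
Context {R : realType} (n : nat).
Implicit Types (Om : set 'rV[R]_n.+1) (u phi : 'rV[R]_n.+1 -> R) (g h : 'rV[R]_n.+1 -> 'rV[R]_n.+1).
Notation lrow := (lebesgue_row n.+1).
Notation e i := (delta_mx ord0 i : 'rV[R]_n.+1).

Lemma test_bounded Om phi : test_function Om phi -> exists2 C : R, 0 <= C & forall x, `|phi x| <= C.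
Proof.
move=> tp; apply: bounded_supp_bounded; last exact: test_bounded_supp tp.
by apply: smooth_continuous; case: tp.
Qed.

Lemma test_partial_bounded Om phi i : test_function Om phi ->
  exists2 C : R, 0 <= C & forall x, `|partial i phi x| <= C.
Proof.
move=> tp; have sp : smooth phi by case: tp.
apply: bounded_supp_bounded; first exact/smooth_continuous/smooth_partial.
by apply: bounded_supp_is_derive (test_bounded_supp tp) => x; exact: smooth_is_derive.
Qed.

Lemma test_measurable Om phi D : test_function Om phi -> measurable_fun D (phi : _ -> R).
Proof.
move=> [sp _ _]; apply: measurable_funTS; apply: continuous_row_measurable.
exact: smooth_continuous.
Qed.

Lemma test_partial_measurable Om phi i D : test_function Om phi ->
  measurable_fun D (partial i phi : _ -> R).
Proof.
move=> [sp _ _]; apply: measurable_funTS; apply: continuous_row_measurable.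
exact/smooth_continuous/smooth_partial.
Qed.

Lemma test_integrable Om phi D : measurable D -> test_function Om phi ->
  lrow.-integrable D (EFin \o phi).
Proof.
move=> mD tp; apply: (@integrableS _ _ _ lrow setT) => //.
apply: bounded_supp_integrable; last exact: test_bounded_supp tp.
by apply: smooth_continuous; case: tp.
Qed.

Lemma test_partial_integrable Om phi i D : measurable D -> test_function Om phi ->
  lrow.-integrable D (EFin \o partial i phi).
Proof.
move=> mD tp; apply: (@integrableS _ _ _ lrow setT) => //.
have sp : smooth phi by case: tp.
apply: bounded_supp_integrable; first exact/smooth_continuous/smooth_partial.
by apply: bounded_supp_is_derive (test_bounded_supp tp) => x; exact: smooth_is_derive.
Qed.

Lemma weak_gradient_unique Om u g h : open Om ->
  weak_gradient Om u g -> weak_gradient Om u h -> {ae lrow, forall x, Om x -> g x = h x}.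
Proof.
move=> oO ug uh; have mO := open_row_measurable oO.
have gh i : {ae lrow, forall x, Om x -> g x ord0 i - h x ord0 i = 0}.
  have [ig gE] := ug i; have [ih hE] := uh i.
  apply: fundamental_lemma => //.
    rewrite (_ : EFin \o _ = (EFin \o (fun x => g x ord0 i)) \- (EFin \o (fun x => h x ord0 i)))%E//.
    exact: integrableB.
  move=> phi tp; have [C C0 pC] := test_bounded tp.
  have mp := @test_measurable _ _ Om tp.
  have i1 : lrow.-integrable Om (EFin \o (fun x => g x ord0 i * phi x)).
    by apply: (integrable_mul_bounded (C := C)).
  have i2 : lrow.-integrable Om (EFin \o (fun x => h x ord0 i * phi x)).
    by apply: (integrable_mul_bounded (C := C)).
  have := gE _ tp; rewrite hE// => /oppe_inj E.
  under eq_integral do rewrite mulrBl EFinB.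
  by rewrite integralB// -E subee//; exact: integrable_fin_num i2.
have : {ae lrow, forall x, forall i, Om x -> g x ord0 i - h x ord0 i = 0}.
  exact: filter_forall gh.
apply: filterS => x xgh Ox.
by apply/rowP => i; apply/eqP; rewrite -subr_eq0 xgh.
Qed.

Lemma weak_gradient_test Om phi : measurable Om -> test_function Om phi ->
  weak_gradient Om phi (gradient phi).
Proof.
move=> mO tp i; have sp : smooth phi by case: tp.
split.
  rewrite (_ : (fun x => _) = EFin \o partial i phi); last by apply/funext => x; rewrite mxE.
  exact: test_partial_integrable tp.
move=> psi ts; have ss : smooth psi by case: ts.
have E := integral_by_parts_row (fun x => smooth_is_derive i x sp) (smooth_continuous sp)
  (smooth_continuous (smooth_partial i sp)) (fun x => smooth_is_derive i x ss)
  (smooth_continuous ss) (smooth_continuous (smooth_partial i ss)) (test_bounded_supp ts).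
transitivity (\int[lrow]_x (phi x * partial i psi x)%:E)%E.
  rewrite integral_mkcond; apply: eq_integral => x _; rewrite patchE.
  case: ifPn => // /negP; rewrite inE => Ox.
  by rewrite (test_partial_out i ts Ox) mulr0.
rewrite E; congr (- _)%E; rewrite [RHS]integral_mkcond; apply: eq_integral => x _.
rewrite patchE mxE; case: ifPn => // /negP; rewrite inE => Ox.
by rewrite (test_out ts Ox) mulr0.
Qed.

Lemma weak_gradientB Om u v g h : measurable Om ->
  lrow.-integrable Om (EFin \o u) -> lrow.-integrable Om (EFin \o v) ->
  weak_gradient Om u g -> weak_gradient Om v h ->
  weak_gradient Om (u \- v) (fun x => g x - h x).
Proof.
move=> mO iu iv ug vh i; have [ig gE] := ug i; have [ih hE] := vh i; split.
  rewrite (_ : (fun x => _) = (EFin \o (fun x => g x ord0 i)) \- (EFin \o (fun x => h x ord0 i)))%E.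
    exact: integrableB.
  by apply/funext => x; rewrite !mxE.
move=> psi ts; have [C C0 pC] := test_bounded ts; have [C' C'0 pC'] := test_partial_bounded i ts.
have mp := @test_measurable _ _ Om ts; have mpp := @test_partial_measurable _ _ i Om ts.
have i1 : lrow.-integrable Om (EFin \o (fun x => u x * partial i psi x)).
  by apply: (integrable_mul_bounded (C := C')).
have i2 : lrow.-integrable Om (EFin \o (fun x => v x * partial i psi x)).
  by apply: (integrable_mul_bounded (C := C')).
have i3 : lrow.-integrable Om (EFin \o (fun x => g x ord0 i * psi x)).
  by apply: (integrable_mul_bounded (C := C)).
have i4 : lrow.-integrable Om (EFin \o (fun x => h x ord0 i * psi x)).
  by apply: (integrable_mul_bounded (C := C)).
under eq_integral do rewrite mulrBl EFinB.
under [in RHS]eq_integral do rewrite !mxE mulrBl EFinB.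
rewrite !integralB// gE// hE// oppeK fin_num_oppeB//.
exact: integrable_fin_num i4.
Qed.

(** A subsequence with errors 2^-j is extracted because summable errors give a.e. convergence later.
    The chosen gradient of u - phi_j is replaced by the difference of the gradients through
    [weak_gradient_unique]. *)
Lemma W110_elim Om u : open Om -> W110 Om u ->
  exists phi_ : nat -> 'rV[R]_n.+1 -> R, (forall j, test_function Om (phi_ j)) /\
  forall j, (\int[lrow]_(x in Om) `|u x - phi_ j x|%:E +
    \int[lrow]_(x in Om) (eucl_norm (grad Om u x - gradient (phi_ j) x))%:E <= (2 ^- j)%:E)%E.
Proof.
move=> oO [[iu gu] [phi_ [tp cp]]]; have mO := open_row_measurable oO.
have wgu : weak_gradient Om u (grad Om u) by exact: getPex gu.
pose E k := (\int[lrow]_(x in Om) `|u x - phi_ k x|%:E +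
    \int[lrow]_(x in Om) (eucl_norm (grad Om u x - gradient (phi_ k) x))%:E)%E.
have EE k : W11_norm Om (u \- phi_ k) = E k.
  rewrite /W11_norm /E; congr (_ + _)%E.
  have wB : weak_gradient Om (u \- phi_ k) (fun x => grad Om u x - gradient (phi_ k) x).
    by apply: weak_gradientB => //; [exact: test_integrable (tp k)|exact: weak_gradient_test].
  have wg : weak_gradient Om (u \- phi_ k) (grad Om (u \- phi_ k)).
    by apply: getPex; eexists; exact: wB.
  apply: ae_eq_integralT; have := weak_gradient_unique oO wg wB.
  by apply: filterS => x xE Ox; rewrite xE.
have kP j : exists k, (E k <= (2 ^- j)%:E)%E.
  have p2 : (0 < (2 ^- j : R)%:E)%E by rewrite lte_fin invr_gt0 exprn_gt0.
  have /fine_cvgP[fE /cvgrPdist_lt /(_ (2 ^- j)) cE] : E @ \oo --> 0%E.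
    by apply: cvg_trans cp; apply: near_eq_cvg; apply: nearW => k; rewrite EE.
  have /cE hE : 0 < 2 ^- j :> R by rewrite invr_gt0 exprn_gt0.
  have [k [fk hk]] : exists k, E k \is a fin_num /\ `|0 - fine (E k)| < 2 ^- j.
    by have [k _ /(_ k (leqnn k))] := filterI fE hE; exists k.
  exists k; rewrite -(fineK fk) lee_fin; apply/ltW; apply: le_lt_trans hk.
  by rewrite sub0r normrN ler_norm.
have /choice[f fP] := kP.
by exists (phi_ \o f); split => j /=; [exact: tp|exact: fP].
Qed.

(** The identity defining a weak gradient passes to L^1 limits: its defect for (u, G) is at most (C'
    + C) eps_k, where C and C' bound the test function and its partial derivative. *)
Lemma W110_intro Om u (G : 'rV[R]_n.+1 -> 'rV[R]_n.+1) (phi_ : nat -> 'rV[R]_n.+1 -> R) (eps_ : nat -> R) :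
  open Om -> lrow.-integrable Om (EFin \o u) ->
  (forall i, lrow.-integrable Om (EFin \o (fun x => G x ord0 i))) ->
  (forall k, test_function Om (phi_ k)) ->
  (forall k, \int[lrow]_(x in Om) `|u x - phi_ k x|%:E <= (eps_ k)%:E)%E ->
  (forall k, \int[lrow]_(x in Om) (eucl_norm (G x - gradient (phi_ k) x))%:E <= (eps_ k)%:E)%E ->
  eps_ @ \oo --> (0 : R) ->
  weak_gradient Om u G /\ W110 Om u.
Proof.
move=> oO iu iG tp ue Ge e0; have mO := open_row_measurable oO.
have wG : weak_gradient Om u G.
  move=> i; split; first exact: iG.
  move=> psi ts; have [C C0 pC] := test_bounded ts; have [C' C'0 pC'] := test_partial_bounded i ts.
  have mp := @test_measurable _ _ Om ts; have mpp := @test_partial_measurable _ _ i Om ts.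
  have i1 : lrow.-integrable Om (EFin \o (fun x => u x * partial i psi x)).
    by apply: (integrable_mul_bounded (C := C')).
  have i3 : lrow.-integrable Om (EFin \o (fun x => G x ord0 i * psi x)).
    by apply: (integrable_mul_bounded (C := C)).
  pose a := (\int[lrow]_(x in Om) (u x * partial i psi x))%R.
  pose b := (\int[lrow]_(x in Om) (G x ord0 i * psi x))%R.
  have aE : (\int[lrow]_(x in Om) (u x * partial i psi x)%:E)%E = a%:E.
    by rewrite /a fineK//; exact: integrable_fin_num i1.
  have bE : (\int[lrow]_(x in Om) (G x ord0 i * psi x)%:E)%E = b%:E.
    by rewrite /b fineK//; exact: integrable_fin_num i3.
  rewrite aE bE -EFinN; congr EFin; apply/eqP; rewrite -subr_eq0 opprK -normr_le0.
  have ab k : `|a + b| <= (C' + C) * eps_ k.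
    have i2 : lrow.-integrable Om (EFin \o (fun x => phi_ k x * partial i psi x)).
      by apply: (integrable_mul_bounded (C := C')) => //; exact: test_integrable (tp k).
    have i4 : lrow.-integrable Om (EFin \o (fun x => partial i (phi_ k) x * psi x)).
      by apply: (integrable_mul_bounded (C := C)) => //; exact: test_partial_integrable (tp k).
    have /(_ i)[_ /(_ _ ts) E] := weak_gradient_test mO (tp k).
    have {}E : (\int[lrow]_(x in Om) (phi_ k x * partial i psi x) =
                - \int[lrow]_(x in Om) (partial i (phi_ k) x * psi x))%R.
      rewrite /Rintegral E fineN; congr (- fine _).
      by apply: eq_integral => x _; rewrite mxE.
    have -> : a + b = (\int[lrow]_(x in Om) ((u x - phi_ k x) * partial i psi x) +
       \int[lrow]_(x in Om) ((G x ord0 i - partial i (phi_ k) x) * psi x))%R.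
      under eq_Rintegral do rewrite mulrBl.
      under [X in _ = _ + X]eq_Rintegral do rewrite mulrBl.
      by rewrite !RintegralB// E opprK -/a -/b; lra.
    rewrite mulrDl; apply: (le_trans (ler_normD _ _)); apply: lerD.
      apply: normr_Rintegral_mul_le => //.
      by apply: integrable_subr => //; exact: test_integrable (tp k).
    apply: normr_Rintegral_mul_le => //.
      by apply: integrable_subr => //; exact: test_partial_integrable (tp k).
    apply: le_trans (Ge k); apply: le_integralT => x Ox; rewrite lee_fin.
    by apply: le_trans (ler_coord_eucl_norm _ i); rewrite !mxE.
  apply/ler_addgt0Pl => d d0; rewrite addr0.
  have CC0 : 0 < C' + C + 1 by rewrite ltr_wpDl// addr_ge0.
  have /cvgrPdist_lt /(_ _ (divr_gt0 d0 CC0)) [k _ /(_ k (leqnn k))] := e0.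
  rewrite /= sub0r normrN ltr_pdivlMr// => ek.
  apply: (le_trans (ab k)); apply: le_trans (ltW ek).
  rewrite mulrC; apply: (@le_trans _ _ (`|eps_ k| * (C' + C))).
    by rewrite ler_wpM2r ?addr_ge0// ler_norm.
  by rewrite ler_wpM2l// lerDl.
split => //; split; first by split => //; exists G.
exists phi_; split => //.
have h0 : (fun=> 0%E : \bar R) @ \oo --> (0%E : \bar R) by exact: cvg_cst.
have h1 : (fun k => (eps_ k + eps_ k)%:E) @ \oo --> (0%E : \bar R).
  apply: cvg_EFin; first exact: nearW.
  by rewrite -[X in _ --> X](addr0 (0 : R)); apply: cvgD.
apply: squeeze_cvge h0 h1; apply: nearW => k; apply/andP; split.
  by rewrite adde_ge0// integral_ge0// => x _; rewrite lee_fin// eucl_norm_ge0.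
rewrite /W11_norm EFinD leeD//; first exact: ue.
apply: le_trans (Ge k); apply: ae_le_integral.
have wB : weak_gradient Om (u \- phi_ k) (fun x => G x - gradient (phi_ k) x).
  by apply: weak_gradientB => //; [exact: test_integrable (tp k)|exact: weak_gradient_test].
have wg : weak_gradient Om (u \- phi_ k) (grad Om (u \- phi_ k)).
  by apply: getPex; eexists; exact: wB.
have := weak_gradient_unique oO wg wB.
by apply: filterS => x xE Ox; rewrite xE.
Qed.

End weak_gradients.

(** * Absolutely continuous functions *)

Section interval_chains.
Context {R : realType}.
Implicit Types (l : seq (R * R)) (u G : R -> R) (p : R * R).

(* Disjoint intervals are handled as sorted lists, which are easy to refine and to
   concatenate. *)
Fixpoint chain (a : R) l (b : R) : bool :=
  if l is p :: l' then [&& a <= p.1, p.1 <= p.2 & chain p.2 l' b] else a <= b.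

Definition len l : R := \sum_(p <- l) (p.2 - p.1).
Definition var u l : R := \sum_(p <- l) `|u p.2 - u p.1|.

Lemma chain_cat a l1 l2 b : chain a (l1 ++ l2) b <-> exists2 m, chain a l1 m & chain m l2 b.
Proof.
elim: l1 a => [a|p l1 IHl a] /=; split.
- by move=> h; exists a.
- move=> [m am h]; elim: l2 m am h => [|p l2 _] m am /=; first exact: le_trans.
  by move=> /and3P[h1 -> ->]; rewrite (le_trans am h1).
- by move=> /and3P[h1 h2 /IHl[m h3 h4]]; exists m => //; rewrite h1 h2.
- move=> [m /and3P[h1 h2 h3] h4]; rewrite h1 h2/=; apply/IHl; by exists m.
Qed.

Lemma chain_widen a a' l b b' : a' <= a -> b <= b' -> chain a l b -> chain a' l b'.
Proof.
elim: l a a' => [a a' h1 h2 h3|p l IHl a a' h1 h2 /and3P[h3 h4 h5]] /=.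
  exact: le_trans (le_trans h1 h3) h2.
by rewrite (le_trans h1 h3) h4 (IHl _ _ (lexx _) h2 h5).
Qed.

(** Absolute continuity on the whole line, over chains of any extent. A function on [a, b] enters
    this setting through [clamp], which extends it by constants and does not lengthen intervals. *)
Definition line_ac G := forall e : R, 0 < e -> exists2 d : R, 0 < d &
  forall a l b, chain a l b -> len l < d -> var G l < e.

Definition clamp (a b x : R) : R := Num.max a (Num.min b x).

Lemma clamp_le a b x y : x <= y -> clamp a b x <= clamp a b y.
Proof.
move=> xy; have h : Num.min b x <= Num.min b y by rewrite le_min !ge_min lexx/= xy orbT.
by rewrite /clamp ge_max !le_max lexx/= h orbT.
Qed.

Lemma clamp_itv a b x : a <= b -> a <= clamp a b x <= b.
Proof. by move=> ab; rewrite /clamp le_max lexx ge_max ab ge_min lexx. Qed.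

Lemma clamp_id a b x : a <= x <= b -> clamp a b x = x.
Proof. by move=> /andP[ax xb]; rewrite /clamp min_r// max_r. Qed.

Lemma clamp_lip a b x y : x <= y -> clamp a b y - clamp a b x <= y - x.
Proof.
move=> xy; rewrite /clamp; case: (leP b y) => h1; case: (leP b x) => h2.
- by rewrite subrr subr_ge0.
- by case: (leP a b) => h3; case: (leP a x) => h4; lra.
- by have := lt_le_trans h1 (le_trans h2 xy); rewrite ltxx.
- by case: (leP a y) => h3; case: (leP a x) => h4; lra.
Qed.

Lemma absolutely_continuous_line_ac a b u : a <= b ->
  absolutely_continuous a b u -> line_ac (u \o clamp a b).
Proof.
move=> ab acu e e0; have [d d0 hd] := acu _ e0; exists d => // a0 l b0 ch ld.
pose s (k : 'I_(size l)) := clamp a b (nth (0, 0) l k).1.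
pose t (k : 'I_(size l)) := clamp a b (nth (0, 0) l k).2.
have le12 k : (k < size l)%N -> (nth (0, 0) l k).1 <= (nth (0, 0) l k).2.
  elim: l a0 ch {s t ld} k => //= p l IHl a0 /and3P[h1 h2 h3] [|k]//=; rewrite ltnS => kl.
  exact: IHl h3 _ kl.
have lt21 j k : (j < k)%N -> (k < size l)%N -> (nth (0, 0) l j).2 <= (nth (0, 0) l k).1.
  elim: l a0 ch {s t ld le12} j k => //= p l IHl a0 /and3P[h1 h2 h3] j [//|k] jk; rewrite ltnS => kl.
  case: j jk => [_|j]/=; last by rewrite ltnS => jk; exact: IHl h3 _ _ jk kl.
  elim: l p.2 h3 k kl {IHl h1 h2} => //= q l IHl c /and3P[h1 h2 h3] [|k]//=; rewrite ltnS => kl.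
  exact: le_trans (le_trans h1 h2) (IHl _ h3 _ kl).
have -> : var (u \o clamp a b) l = \sum_k `|u (t k) - u (s k)|.
  by rewrite /var (big_nth (0, 0)) big_mkord.
apply: hd.
- move=> k; split.
  + by have /andP[] := clamp_itv (nth (0, 0) l k).1 ab.
  + by apply: clamp_le; exact: le12.
  + by have /andP[] := clamp_itv (nth (0, 0) l k).2 ab.
- apply/trivIsetP => j k _ _ jk; apply/seteqP; split => // x /=; rewrite !in_itv/= => -[/andP[h1 h2] /andP[h3 h4]].
  move: jk; rewrite -val_eqE/= neq_ltn => /orP[jk|kj].
    have := clamp_le a b (lt21 j k jk (ltn_ord k)).
    by rewrite leNgt (lt_trans h3 h2).
  have := clamp_le a b (lt21 k j kj (ltn_ord j)).
  by rewrite leNgt (lt_trans h1 h4).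
- apply: le_lt_trans ld; rewrite /len [leRHS](big_nth (0, 0)) [leRHS]big_mkord.
  by apply: ler_sum => k _; apply: clamp_lip; exact: le12.
Qed.

Lemma line_ac_continuous G : line_ac G -> continuous G.
Proof.
move=> aG x; apply/cvgrPdist_lt => e e0; have [d d0 hd] := aG _ e0.
apply/nbhs_ballP; exists d => // y; rewrite /ball/= => xy.
have [h|h] := leP x y.
  have := hd x [:: (x, y)] y; rewrite /len /var /= !big_seq1/= !lexx h/= distrC; apply => //.
  by apply: le_lt_trans xy; rewrite distrC ler_norm.
have := hd y [:: (y, x)] x; rewrite /len /var /= !big_seq1/= !lexx (ltW h)/=; apply => //.
by apply: le_lt_trans xy; rewrite ler_norm.
Qed.

Lemma line_acD G H : line_ac G -> line_ac H -> line_ac (fun x => G x + H x).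
Proof.
move=> aG aH e e0; have e2 : 0 < e / 2 by rewrite divr_gt0.
have [d d0 hd] := aG _ e2; have [d' d'0 hd'] := aH _ e2.
exists (Num.min d d') => [|a l b ch]; first by rewrite lt_min d0.
rewrite lt_min => /andP[h1 h2]; apply: (@le_lt_trans _ _ (var G l + var H l)).
  rewrite -big_split/=; apply: ler_sum => p _.
  by rewrite opprD addrACA ler_normD.
by rewrite [e]splitr ltrD// ?(hd a l b)// (hd' a l b).
Qed.

Fixpoint pairs (s : R) (r : seq R) : seq (R * R) :=
  if r is x :: r' then (s, x) :: pairs x r' else [::].

Lemma chain_pairs s t r : itv_partition s t r -> chain s (pairs s r) t.
Proof.
elim: r s => [|x r IHr] s /=; first by move=> /itv_partition_nil ->.
move=> [/= /andP[sx xr] lt]; rewrite lexx (ltW sx)/=; exact: IHr.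
Qed.

Lemma len_pairs s t r : itv_partition s t r -> len (pairs s r) = t - s.
Proof.
rewrite /len; elim: r s => [|x r IHr] s /=.
  by move=> /itv_partition_nil ->; rewrite big_nil subrr.
by move=> [/= /andP[sx xr] lt]; rewrite big_cons IHr//= addrC addrA subrK.
Qed.

Lemma var_pairs u s t r : itv_partition s t r -> variation s t u r = var u (pairs s r).
Proof.
move=> h; rewrite variation_zip// /var; elim: r s {h} => [|x r IHr] s /=; first by rewrite !big_nil.
by rewrite !big_cons IHr.
Qed.

(** Refining the intervals of a chain keeps its total length, so the variation stays below e/2 for
    all refinements, hence for their suprema, the total variations. *)
Lemma line_ac_total_variation u : line_ac u -> (forall a b, a <= b -> bounded_variation a b u) ->
  forall e : R, 0 < e -> exists2 d : R, 0 < d & forall a l b, chain a l b -> len l < d ->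
    \sum_(p <- l) fine (total_variation p.1 p.2 u) < e.
Proof.
move=> au bv e e0; have e2 : 0 < e / 2 by rewrite divr_gt0.
have [d d0 hd] := au _ e2; exists d => // a l b ch ld.
apply: (@le_lt_trans _ _ (e / 2)); last by rewrite ltr_pdivrMr// ltr_pMr// ltr1n.
(* The suprema are taken one interval at a time: [l1] gathers the intervals already replaced by
   arbitrary partitions, [l2] those that still carry a total variation. *)
suff : forall l2 l1, chain a (l1 ++ l2) b -> len (l1 ++ l2) < d ->
    var u l1 + \sum_(p <- l2) fine (total_variation p.1 p.2 u) <= e / 2.
  by move=> /(_ l [::] ch ld); rewrite /var big_nil add0r.
elim=> [|p l2 IHl] l1 ch1 ld1.
  by rewrite big_nil addr0 ltW//; move: ch1 ld1; rewrite cats0 => ch1 ld1; exact: (hd a l1 b).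
have [m chm /= /and3P[mp p12 chp]] := (chain_cat _ _ _ _).1 ch1.
rewrite big_cons addrCA -lerBrDr -lee_fin fineK; last first.
  exact/(bounded_variationP _ p12)/bv.
apply: ge_ereal_sup => _ [_ [r pr <-] <-]; rewrite lee_fin lerBrDr (var_pairs _ pr).
have := IHl (l1 ++ pairs p.1 r).
rewrite {1}/var big_cat/= -/(var u l1) -/(var u (pairs p.1 r)) addrCA addrA; apply.
  rewrite -catA; apply/chain_cat; exists m => //; apply/chain_cat; exists p.2 => //.
  exact: chain_widen mp (lexx _) (chain_pairs pr).
move: ld1; rewrite /len !big_cat !big_cons/= -/(len (pairs p.1 r)) (len_pairs pr).
by rewrite -addrA.
Qed.

(** The variation is at most 1 on any interval shorter than d, and finitely many steps of length d/2
    lead from a to b. *)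
Lemma line_ac_bounded_variation u a b : line_ac u -> a <= b -> bounded_variation a b u.
Proof.
move=> au ab; have [d d0 hd] := au 1 ltr01.
have small c c' : c <= c' -> c' - c < d -> bounded_variation c c' u.
  move=> cc' ccd; exists 1 => _ [r pr <-]; rewrite (var_pairs _ pr) ltW//.
  by apply: (hd c _ c') (chain_pairs pr) _; rewrite (len_pairs pr).
have d2 : 0 < d / 2 by rewrite divr_gt0.
have main (k : nat) c : a <= c -> c <= a + k%:R * (d / 2) -> bounded_variation a c u.
  elim: k c => [|k IHk] c ac.
    rewrite mul0r addr0 => ca; have -> : c = a by apply/eqP; rewrite eq_le ca ac.
    exact: bounded_variationxx.
  move=> ck; have [h|h] := leP c (a + k%:R * (d / 2)); first exact: IHk.
  set c0 := a + _ in h; have ac0 : a <= c0 by rewrite lerDl mulr_ge0// ltW.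
  have b1 : bounded_variation a c0 u by exact: IHk.
  have b2 : bounded_variation c0 c u.
    apply: small; first exact: ltW.
    have : c - c0 <= d / 2 by move: ck; rewrite -natr1 mulrDl mul1r addrA -/c0 lerBlDl.
    by move=> /le_lt_trans; apply; rewrite ltr_pdivrMr// ltr_pMr// ltr1n.
  apply/(bounded_variationP _ ac).
  rewrite (total_variationD _ ac0 (ltW h)) fin_numD.
  by apply/andP; split; apply/bounded_variationP => //; exact: ltW.
apply: (main (Num.truncn ((b - a) / (d / 2))).+1) => //.
by rewrite -lerBlDl -ler_pdivrMr// ltW// truncnS_gt.
Qed.

End interval_chains.

(** * Lebesgue-Stieltjes measures; absolutely continuous functions as integrals *)

Section stieltjes_ac.
Context {R : realType}.
Notation leb := (@lebesgue_measure R).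
Implicit Types (G : cumulative R R).

Lemma stieltjes_itv G (s t : R) : s <= t ->
  lebesgue_stieltjes_measure G `]s, t]%classic = (G t - G s)%:E.
Proof.
move=> st; rewrite /lebesgue_stieltjes_measure /measure_extension/= measurable_mu_extE//=; last first.
  by exists (s, t).
rewrite wlength_itv/= lte_fin; case: ltP => [//|ts].
by have -> : t = s; [apply/eqP; rewrite eq_le ts st|rewrite subrr].
Qed.

Section grid.
Variables (U : set R) (n : nat).

Let c : R := n.+1%:R.
Let M := (2 * n.+1 * n.+1)%N.
(** The mesh is 1/(n+1) and the grid starts at -(n+1), so that the M = 2 (n+1)^2 cells cover
    ]-(n+1), n+1]: it becomes both finer and wider as n grows. *)
Definition gridpt (k : nat) : R := k%:R / n.+1%:R - n.+1%:R.
Definition cell (k : nat) : set R := `]gridpt k, gridpt k.+1]%classic.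
Definition cell_in (k : nat) : bool := `[< cell k `<=` U >].
Definition cells : set R := \big[setU/set0]_(k < M | cell_in k) cell k.

Let c0 : 0 < c. Proof. by rewrite ltr0n. Qed.

Lemma gridpt_le (j k : nat) : (j <= k)%N -> gridpt j <= gridpt k.
Proof. by move=> jk; rewrite lerB// ler_pM2r ?invr_gt0// ler_nat. Qed.

Lemma gridptS k : gridpt k.+1 = gridpt k + n.+1%:R^-1.
Proof. by rewrite /gridpt -natr1 mulrDl mul1r addrAC. Qed.

Lemma trivIset_cell : trivIset setT (fun k : 'I_M => cell k).
Proof.
apply/trivIsetP => j k _ _ jk; apply/seteqP; split => // x [].
rewrite /cell/= !in_itv/= => /andP[h1 h2] /andP[h3 h4].
move: jk; rewrite -val_eqE/= neq_ltn => /orP[jk|kj].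
  by have := gridpt_le jk; rewrite leNgt (lt_le_trans h3 h2).
by have := gridpt_le kj; rewrite leNgt (lt_le_trans h1 h4).
Qed.

Lemma cells_sub : cells `<=` U.
Proof.
rewrite /cells; elim/big_ind: _ => [//|A B AU BU x [/AU|/BU]//|k].
by move=> /asboolP.
Qed.

Lemma measurable_cells : measurable (cells : set (measurableTypeR R)).
Proof. by apply: bigsetU_measurable => k _; exact: measurable_itv. Qed.

Lemma chain_cells (m j : nat) : chain (gridpt j)
  [seq (gridpt k, gridpt k.+1) | k <- iota j m & cell_in k] (gridpt (j + m)).
Proof.
elim: m j => [|m IHm] j /=; first by rewrite addn0.
rewrite addnS -addSn; case: ifP => _ /=.
  by rewrite lexx gridpt_le//= IHm.
by apply: chain_widen (IHm j.+1) => //; exact: gridpt_le.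
Qed.

Lemma measure_cells G : lebesgue_stieltjes_measure G cells =
  (\sum_(p <- [seq (gridpt k, gridpt k.+1) | k <- iota 0 M & cell_in k]) (G p.2 - G p.1))%:E.
Proof.
have -> : \sum_(p <- [seq (gridpt k, gridpt k.+1) | k <- iota 0 M & cell_in k]) (G p.2 - G p.1)
    = \sum_(k < M | cell_in k) (G (gridpt k.+1) - G (gridpt k)).
  rewrite big_map big_filter.
  have -> : iota 0 M = index_iota 0 M by rewrite /index_iota subn0.
  by rewrite big_mkord.
rewrite /cells measure_bigsetU_ord; [|by move=> k; exact: measurable_itv|exact: trivIset_cell].
rewrite -sumEFin; apply: eq_bigr => k _; apply: stieltjes_itv; exact: gridpt_le.
Qed.

Lemma mem_cells (x e : R) : ball x e `<=` U -> n.+1%:R^-1 < e -> `|x| < n.+1%:R -> cells x.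
Proof.
move=> xU ce; rewrite ltr_norml => /andP[xc1 xc2].
pose y := (x + c) * c.
have y0 : 0 < y by rewrite mulr_gt0// addrC -ltrBlDl sub0r.
have yM : y <= M%:R.
  by rewrite /M natrM natrM ler_pM2r// mulr_natl mulr2n lerD2r ltW.
(* The right end of the cell of x is indexed by the least integer m >= y. *)
have exm : exists m : nat, y <= m%:R by exists M.
case: (ex_minnP exm) => -[|k] yk kmin; first by move: yk; rewrite leNgt y0.
have kM : (k < M)%N by exact: kmin.
have ky : k%:R < y by rewrite ltNge; apply/negP => /kmin; rewrite ltnn.
have ck : cell k x.
  rewrite /cell /= in_itv/= /gridpt ltrBlDr ltr_pdivrMr// lerBrDr ler_pdivlMr//.
  by rewrite ky.
rewrite /cells (bigD1 (Ordinal kM))/=; last first.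
  apply/asboolP => z; move: ck; rewrite /cell/= !in_itv/= gridptS => /andP[h1 h2] /andP[h3 h4].
  apply: xU; rewrite /ball/=; move: ce h1 h2 h3 h4; move: (n.+1%:R^-1) => i *.
  by rewrite ltr_norml; apply/andP; split; lra.
by left.
Qed.

End grid.

(* By outer regularity, it suffices to control open sets, which the finite unions of
   grid cells that they contain exhaust. *)
Lemma line_ac_dominates_le G : line_ac G -> forall A, measurable A -> leb A = 0%E ->
  lebesgue_stieltjes_measure G A = 0%E.
Proof.
move=> aG A mA A0; apply/eqP; rewrite eq_le measure_ge0 andbT; apply/lee_addgt0Pr => e e0.
rewrite add0e; have [d d0 hd] := aG _ e0.
have Aoo : (leb A < +oo)%E by rewrite A0.
have [U [oU AU Ud]] := lebesgue_regularity_outer mA Aoo d0.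
have mU : measurable (U : set (measurableTypeR R)) by exact: open_measurable.
have lU : (leb U < d%:E)%E.
  apply: le_lt_trans Ud; have {1}-> : U = A `|` (U `\` A) by rewrite setDUK.
  apply: (le_trans (measureU2 _ mA _)); first exact: measurableD.
  by rewrite [X in (X + _)%E](_ : _ = 0%E) ?add0e.
(* The sets [cells U n] need not be monotone in n, since grids of different meshes are not nested;
   their tail intersections increase, and still exhaust U. *)
pose V N := \bigcap_(n in [set n | (N <= n)%N]) cells U n.
have mV N : measurable (V N : set (measurableTypeR R)).
  by apply: bigcap_measurable; [exists N => /=|move=> n _; exact: measurable_cells].
have VU : \bigcup_N V N = U.
  apply/seteqP; split=> [x [N _ VN]|x Ux].
    by apply: (@cells_sub U N); apply: VN => /=.
  have /nbhs_ballP[r /= r0 xr] := open_nbhs_nbhs (conj oU Ux).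
  exists (maxn (Num.truncn r^-1) (Num.truncn `|x|)) => // n /= Nn.
  apply: (mem_cells xr).
    rewrite -(invrK r) ltf_pV2 ?posrE// ?invr_gt0//.
    apply: lt_le_trans (truncnS_gt _) _; rewrite ler_nat ltnS.
    by apply: leq_trans Nn; exact: leq_maxl.
  apply: lt_le_trans (truncnS_gt _) _; rewrite ler_nat ltnS.
  by apply: leq_trans Nn; exact: leq_maxr.
have cV : lebesgue_stieltjes_measure G (V N) @[N --> \oo] --> lebesgue_stieltjes_measure G U.
  rewrite -VU; apply: nondecreasing_cvg_mu => //; first by rewrite VU.
  move=> N N' NN'; apply/subsetPset => x VN n /= h; apply: VN => /=; exact: leq_trans h.
apply: (@le_trans _ _ (lebesgue_stieltjes_measure G U)); first by rewrite le_measure ?inE.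
rewrite -(cvg_lim _ cV)//; apply: lime_le; first by apply/cvg_ex; exists (lebesgue_stieltjes_measure G U).
apply: nearW => N; apply: (@le_trans _ _ (lebesgue_stieltjes_measure G (cells U N))).
  rewrite le_measure ?inE//; first exact: measurable_cells.
  by move=> x; apply => /=.
rewrite measure_cells lee_fin.
set l := [seq _ | _ <- _ & _].
have ch : chain (gridpt N 0) l (gridpt N (0 + 2 * N.+1 * N.+1)) by exact: chain_cells.
apply: (@le_trans _ _ (var G l)); first by apply: ler_sum => p _; exact: ler_norm.
apply/ltW/(hd _ _ _ ch); rewrite -lte_fin; apply: le_lt_trans lU.
have -> : (len l)%:E = leb (cells U N) by rewrite /lebesgue_measure measure_cells.
rewrite le_measure ?inE//; first exact: measurable_cells.
exact: cells_sub.
Qed.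

(** The Radon-Nikodym theorem for the Stieltjes measure of G, restricted to ]a, b] to make it
    finite; the previous lemma provides the domination by Lebesgue measure. *)
Lemma line_ac_nondecreasing_integral (G : R -> R) (a b : R) : line_ac G ->
  {homo G : x y / x <= y} -> a <= b -> exists h : R -> R,
  leb.-integrable `]a, b] (EFin \o h) /\
  forall x, a <= x -> x <= b -> G x - G a = \int[leb]_(t in `]a, x]) h t.
Proof.
move=> aG ndG ab.
have rG : right_continuous G by move=> x; apply: cvg_at_right_filter; exact: line_ac_continuous.
pose cG := isCumulative.Build R _ R G (fun x y => @ndG x y)
  rG.
pose G' : cumulative R R := HB.pack G cG.
have mD : measurable (`]a, b]%classic : set (measurableTypeR R)) by exact: measurable_itv.
have fD : (lebesgue_stieltjes_measure G' `]a, b]%classic < +oo)%E.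
  by rewrite stieltjes_itv// ltry.
have dom : mfrestr mD fD `<< leb.
  move=> A /= nA B mB BA; rewrite /mfrestr /mrestr.
  apply: (@line_ac_dominates_le G' aG); first exact: measurableI.
  by apply: nA; [exact: measurableI|move=> x [/BA]].
have [f [f0 ffin fint fE]] := @radon_nikodym_sigma_finite _ _ _ leb (mfrestr mD fD) dom.
exists (fine \o f); split.
  apply: (eq_integrable _ f) => [//|x _|]; first by rewrite /= fineK.
  by apply: integrableS fint => //.
move=> x ax xb; apply: EFin_inj.
have Gx : mfrestr mD fD `]a, x]%classic = (G x - G a)%:E.
  rewrite /mfrestr /mrestr (_ : _ `&` _ = `]a, x]%classic); first exact: stieltjes_itv.
  apply/setIidl => z/=; rewrite !in_itv/= => /andP[-> h]; exact: le_trans h xb.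
rewrite -Gx fE; last exact: measurable_itv.
rewrite /Rintegral fineK; first by apply: eq_integral => z _; rewrite /= fineK.
rewrite (_ : (\int[leb]_(x0 in _) _)%E = (G x - G a)%:E)//.
rewrite -Gx fE; last exact: measurable_itv.
by apply: eq_integral => z _; rewrite /= fineK.
Qed.

(** Jordan decomposition u = (T + u) - T, where T is the total variation from a: T and T + u are
    nondecreasing and again absolutely continuous. Clamping to [a, b] makes T a function on the
    line. *)
Lemma line_ac_integral (u : R -> R) (a b : R) : line_ac u -> a <= b -> exists h : R -> R,
  leb.-integrable `]a, b] (EFin \o h) /\
  forall x, a <= x -> x <= b -> u x - u a = \int[leb]_(t in `]a, x]) h t.
Proof.
move=> au ab; have bv c c' : c <= c' -> bounded_variation c c' u by exact: line_ac_bounded_variation.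
have fT c c' : c <= c' -> total_variation c c' u \is a fin_num.
  by move=> cc'; apply/bounded_variationP => //; exact: bv.
pose T x := fine (total_variation a (clamp a b x) u).
have clb (x : R) := clamp_itv x ab.
have TD x y : x <= y -> T y - T x = fine (total_variation (clamp a b x) (clamp a b y) u).
  move=> xy; have h := clamp_le a b xy; have /andP[h1 _] := clb x.
  rewrite /T (total_variationD _ h1 h) fineD ?fT//.
  by rewrite addrC addKr.
have uT x y : x <= y -> `|u (clamp a b y) - u (clamp a b x)| <= T y - T x.
  move=> xy; rewrite TD// -lee_fin fineK ?fT ?clamp_le//.
  by rewrite total_variation_ge// clamp_le.
have ndT : {homo T : x y / x <= y}.
  by move=> x y /uT h; rewrite -subr_ge0; exact: le_trans h.
have cl_chain l c c' : chain c l c' ->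
    chain (clamp a b c) [seq (clamp a b p.1, clamp a b p.2) | p <- l] (clamp a b c') /\
    len [seq (clamp a b p.1, clamp a b p.2) | p <- l] <= len l.
  elim: l c => [|p l IHl] c /= h; first by rewrite clamp_le// /len !big_nil.
  move: h => /and3P[h1 h2 /IHl[-> h3]]; rewrite !clamp_le//; split => //.
  by rewrite /len !big_cons/= lerD// clamp_lip.
have aT : line_ac T.
  move=> e e0; have [d d0 hd] := line_ac_total_variation au bv e0.
  exists d => // c l c' ch ld; have [ch' l'] := cl_chain _ _ _ ch.
  have -> : var T l = \sum_(p <- [seq (clamp a b p.1, clamp a b p.2) | p <- l])
      fine (total_variation p.1 p.2 u).
    rewrite /var big_map; elim: l c ch {ld ch' l'} => [|p l IHl] c /=; first by rewrite !big_nil.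
    move=> /and3P[_ h1 /IHl h2]; rewrite !big_cons h2/= ger0_norm ?TD//.
    by rewrite -TD// subr_ge0 ndT.
  by apply: (hd _ _ _ ch'); exact: le_lt_trans l' ld.
have auc : line_ac (u \o clamp a b).
  move=> e e0; have [d d0 hd] := au _ e0.
  exists d => // c l c' ch ld; have [ch' l'] := cl_chain _ _ _ ch.
  have := hd _ _ _ ch'; rewrite /var big_map; apply; exact: le_lt_trans l' ld.
have ndTu : {homo (fun x => T x + u (clamp a b x)) : x y / x <= y}.
  move=> x y xy; have := uT _ _ xy; rewrite ler_norml => /andP[h1 h2]; lra.
have [h1 [i1 e1]] := line_ac_nondecreasing_integral (line_acD aT auc) ndTu ab.
have [h2 [i2 e2]] := line_ac_nondecreasing_integral aT ndT ab.
exists (fun x => h1 x - h2 x); split.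
  rewrite (_ : EFin \o _ = (fun x => (EFin \o h1) x - (EFin \o h2) x)%E)//.
  exact: integrableB.
move=> x ax xb; have mx : measurable (`]a, x]%classic : set (measurableTypeR R)) by exact: measurable_itv.
have sub : (`]a, x]%classic : set R) `<=` `]a, b]%classic.
  move=> z/=; rewrite !in_itv/= => /andP[-> h]; exact: le_trans h xb.
have j1 : leb.-integrable `]a, x] (EFin \o h1) by apply: integrableS i1 => //; exact: measurable_itv.
have j2 : leb.-integrable `]a, x] (EFin \o h2) by apply: integrableS i2 => //; exact: measurable_itv.
rewrite RintegralB//.
have cx : clamp a b x = x by apply: clamp_id; rewrite ax.
have ca : clamp a b a = a by apply: clamp_id; rewrite lexx.
rewrite -e1// -e2//= cx ca; lra.
Qed.

End stieltjes_ac.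

(** * Differentiation almost everywhere and primitives *)

Section derivatives.
Context {R : realType}.
Notation leb := (@lebesgue_measure R).
Implicit Types (u h : R -> R) (a b : R).

(** Extended by 0 outside ]a, b], h is locally integrable on the line, so its primitive has
    derivative h a.e.; near an interior point this primitive is u up to a constant. *)
Lemma integral_derive1 u h a b : leb.-integrable `]a, b] (EFin \o h) ->
  (forall x, a <= x -> x <= b -> u x - u a = \int[leb]_(t in `]a, x]) h t) ->
  {ae leb, forall x : R, a < x -> x < b -> derivable u x 1 /\ derive1 u x = h x}.
Proof.
move=> ih uE.
have mab : measurable (`]a, b]%classic : set (measurableTypeR R)) by exact: measurable_itv.
pose h' : R -> R := h \_ `]a, b]%classic.
have ih' : leb.-integrable setT (EFin \o h').
  by have := (integrable_mkcond _ mab).1 ih; rewrite restrict_EFin.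
have loch' : locally_integrable setT h'.
  split => //; first by have /integrableP[/measurable_EFinP] := ih'.
    exact: openT.
  move=> K _ cK; have /integrableP[mh'] := ih'; apply: le_lt_trans.
  apply: ge0_subset_integral => //.
  - by apply: closed_measurable; apply: compact_closed => //; exact: Rhausdorff.
  - by apply/measurable_EFinP; apply: measurableT_comp => //; exact/measurable_EFinP.
have ihy y : leb.-integrable [set` Interval (BRight a) (BRight y)] (EFin \o h').
  by apply: integrableS ih' => //; exact: measurable_itv.
have := FTC1 ihy loch'; apply: filterS; first exact: (ae_filter_ringOfSetsType leb).
move=> x /= hx ax xb.
have [//|dF FE] := hx; have hh' : h' x = h x.
  by rewrite /h' /patch mem_setE in_itv/= ax (ltW xb).
have nF : \forall y \near x, \int[leb]_(t in `]a, y]) h' t + u a = u y.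
  near=> y; have ya : a < y by near: y; exact: (cvgr_gt x).
  have yb : y < b by near: y; exact: (cvgr_lt x).
  rewrite (_ : \int[leb]_(t in `]a, y]) h' t = \int[leb]_(t in `]a, y]) h t).
    by rewrite -uE ?subrK// ltW.
  apply: eq_Rintegral => t; rewrite mem_setE in_itv/= => /andP[at' ty].
  by rewrite /h' /patch mem_setE in_itv/= at'/= (le_trans ty (ltW yb)).
have dh : is_derive x 1 (fun y => \int[leb]_(t in `]a, y]) h' t + u a) (h x).
  have d1 : is_derive x 1 (fun y => \int[leb]_(t in `]a, y]) h' t) (h x).
    by apply: DeriveDef => //; rewrite -derive1E FE.
  by have := is_deriveD d1 (is_derive_cst (u a) x 1); rewrite addr0.
have [du duE] := near_eq_is_derive nF dh.
by rewrite derive1E.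
Unshelve. all: by end_near. Qed.

Lemma measurable_bigcap_rat d (T : measurableType d) (F : rat -> set T) :
  (forall i, measurable (F i)) -> measurable (\bigcap_i F i).
Proof.
move=> mF; rewrite -[X in measurable X]setCK setC_bigcap; apply: measurableC.
by apply: bigcupT_measurable_rat => i; apply: measurableC.
Qed.

Definition diff_quot u (p x : R) : R := p^-1 *: (u (p + x) - u x).

(** On the set D where the difference quotients converge, [derive1 u] is a limit of continuous
    functions; off D it is constant. D is measurable because, u being continuous, the Cauchy
    criterion can be tested on rational increments and rational approximate limits. *)
Lemma measurable_derive1 u : continuous u -> measurable_fun setT (derive1 u : R -> measurableTypeR R).
Proof.
move=> cu.
have cqx p : continuous (diff_quot u p).
  move=> x; apply: cvgZr; apply: cvgB; last exact: cu.
  apply: continuous_comp; last exact: cu.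
  by apply: cvgD; [exact: cvg_cst|exact: cvg_id].
have cqp x (p : R) : p != 0 -> {for p, continuous (diff_quot u ^~ x)}.
  move=> p0; apply: cvgZ; first exact: cvgV.
  apply: cvgB; last exact: cvg_cst.
  apply: continuous_comp; last exact: cu.
  by apply: cvgD; [exact: cvg_id|exact: cvg_cst].
pose D := \bigcap_(k : nat) \bigcup_(m : nat) \bigcup_(c : rat) \bigcap_(p : rat)
  [set x : R | 0 < `|ratr p : R| < m.+1%:R^-1 -> `|diff_quot u (ratr p) x - ratr c| <= k.+1%:R^-1].
have mD : measurable (D : set (measurableTypeR R)).
  apply: bigcapT_measurable => k; apply: bigcupT_measurable => m.
  apply: bigcupT_measurable_rat => c; apply: measurable_bigcap_rat => p.
  have [h|h] := boolP (0 < `|ratr p : R| < m.+1%:R^-1); last first.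
    rewrite (_ : [set x | _] = setT)//; apply/seteqP; split => // x _ /=.
  rewrite (_ : [set x | _] = [set x | `|diff_quot u (ratr p) x - ratr c| <= k.+1%:R^-1]).
    apply: closed_measurable.
    rewrite (_ : [set x | _] = (fun x => `|diff_quot u (ratr p) x - ratr c|) @^-1` [set y | y <= k.+1%:R^-1])//.
    apply: closed_comp; last exact: closed_le.
    move=> x _; apply: cvg_norm; apply: cvgB; [exact: cqx|exact: cvg_cst].
  by apply/seteqP; split => x /= hx; [exact: hx|move=> _; exact: hx].
have DE x : D x <-> cvg (diff_quot u ^~ x @ 0^').
  split.
    move=> Dx; apply/cauchy_cvgP/cauchy_exP => e e0.
    have [k ke] : exists k : nat, k.+1%:R^-1 < e.
      exists (Num.truncn e^-1); rewrite -(invrK e) ltf_pV2 ?posrE ?invr_gt0//.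
      by rewrite invrK truncnS_gt.
    have [m _ [c _ hc]] := Dx k I; exists (ratr c).
    apply/nbhs_ballP; exists m.+1%:R^-1 => /=; first by rewrite invr_gt0.
    move=> p; rewrite /ball/= sub0r normrN => pm p0.
    rewrite /ball/= distrC; apply: le_lt_trans ke.
    rewrite leNgt; apply/negP => hp.
    have : \forall q \near p, [/\ k.+1%:R^-1 < `|diff_quot u q x - ratr c|,
        q != 0 & `|q| < m.+1%:R^-1].
      near=> q; split.
      - near: q; apply: (@cvgr_gt _ _ (nbhs p) _ _ `|diff_quot u p x - ratr c|) hp.
        by apply: cvg_norm; apply: cvgB; [exact: cqp|exact: cvg_cst].
      - by near: q; apply: cvgr_neq0 p0; exact: cvg_id.
      - by near: q; apply: (cvgr_lt `|p|) pm; apply: cvg_norm; exact: cvg_id.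
    move=> /nbhs_ballP[r /= r0 hr].
    have /rat_in_itvoo[q] : p < p + r by rewrite ltrDl.
    rewrite in_itv/= => /andP[q1 q2].
    have [|h1 h2 h3] := hr (ratr q); first by rewrite /ball/= ltr_norml; apply/andP; split; lra.
    by move: h1; rewrite ltNge hc//= normr_gt0 h2.
  move=> /cauchy_cvgP /cauchyP cx k _.
  have k20 : (0 : R) < (2 * k.+1%:R)^-1 by rewrite invr_gt0 mulr_gt0.
  have [l /nbhs_ballP[e /= e0 he]] := cx _ k20.
  have [m me] : exists m : nat, m.+1%:R^-1 < e.
    exists (Num.truncn e^-1); rewrite -(invrK e) ltf_pV2 ?posrE ?invr_gt0//.
    by rewrite invrK truncnS_gt.
  have /rat_in_itvoo[c] : l < l + (2 * k.+1%:R)^-1 by rewrite ltrDl.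
  rewrite in_itv/= => /andP[c1 c2].
  exists m => //; exists c => // p _ /= /andP[p0 pm].
  have := he (ratr p); rewrite /ball/= sub0r normrN (lt_trans pm me) -normr_gt0 => /(_ isT p0).
  move: c1 c2; rewrite invfM; move: (k.+1%:R^-1) => i c1 c2.
  by rewrite ltr_norml ler_norml => /andP[h1 h2]; apply/andP; split; lra.
rewrite -(setUv D); apply/measurable_funU => //; first exact: measurableC.
split.
  apply: (@measurable_fun_cvg _ _ R D (fun n => diff_quot u n.+1%:R^-1)).
    by move=> n; apply: measurable_funTS; exact: continuous_measurable_fun.
  move=> x /DE; rewrite /derive1 => cx.
  apply: cvg_trans cx => A /nbhs_ballP[e /= e0 he].
  have [m me] : exists m : nat, m.+1%:R^-1 < e.
    exists (Num.truncn e^-1); rewrite -(invrK e) ltf_pV2 ?posrE ?invr_gt0//.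
    by rewrite invrK truncnS_gt.
  exists m => // n /= mn; apply: he => /=.
    rewrite /ball/= sub0r normrN gtr0_norm ?invr_gt0//; apply: le_lt_trans me.
    by rewrite lef_pV2 ?posrE// ler_nat.
  by rewrite gt_eqF// invr_gt0.
(* Where the limit does not exist, [derive1] takes the default value [point]. *)
apply: (eq_measurable_fun (cst point)) => // x; rewrite inE => /= nD.
by rewrite /derive1 dvgP// => /DE.
Unshelve. all: by end_near. Qed.

Lemma continuous_within_clamp u a b : a <= b -> absolutely_continuous a b u ->
  continuous (u \o clamp a b).
Proof. by move=> ab /(absolutely_continuous_line_ac ab)/line_ac_continuous. Qed.

Lemma derive1_clamp u a b x : a < x -> x < b ->
  derive1 (u \o clamp a b) x = derive1 u x.
Proof.
move=> ax xb; rewrite !derive1E; apply: near_eq_derive.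
near=> y; rewrite /= clamp_id// ; apply/andP; split; apply/ltW.
  by near: y; exact: (cvgr_gt x).
by near: y; exact: (cvgr_lt x).
Unshelve. all: by end_near. Qed.

Lemma itv_oo_bigcup (rho : R) :
  `]0, rho[%classic = \bigcup_(k : nat) `]k.+1%:R^-1, rho[%classic :> set R.
Proof.
apply/seteqP; split => x /=.
  rewrite in_itv/= => /andP[x0 xr]; exists (Num.truncn x^-1) => //=.
  rewrite in_itv/= xr andbT -(invrK x) ltf_pV2 ?posrE ?invr_gt0//.
  by rewrite invrK truncnS_gt.
move=> [k _ /=]; rewrite !in_itv/= => /andP[h1 ->]; rewrite andbT.
by apply: lt_trans h1; rewrite invr_gt0.
Qed.

Lemma measurable_derive1_itv u (rho : R) :
  (forall a, 0 < a -> a < rho -> exists2 w : R -> R, continuous w &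
     forall x, a < x -> x < rho -> derive1 w x = derive1 u x) ->
  measurable_fun `]0, rho[ (derive1 u : R -> measurableTypeR R).
Proof.
move=> hu; rewrite itv_oo_bigcup; apply/measurable_fun_bigcup => [k|k]; first exact: measurable_itv.
have k0 : (0 : R) < k.+1%:R^-1 by rewrite invr_gt0.
have [kr|kr] := ltP k.+1%:R^-1 rho; last first.
  rewrite set_itv_ge; first exact: measurable_fun_set0.
  by rewrite bnd_simp -leNgt.
have [w cw wE] := hu _ k0 kr.
apply: (eq_measurable_fun (derive1 w)); last by apply: measurable_funTS; exact: measurable_derive1.
by move=> x; rewrite inE/= in_itv/= => /andP[h1 h2]; rewrite wE.
Qed.

Lemma AC_loc_measurable_derive1 u (rho : R) : AC_loc rho u ->
  measurable_fun `]0, rho[ (derive1 u : R -> measurableTypeR R).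
Proof.
move=> acu; apply: measurable_derive1_itv => a a0 ar; exists (u \o clamp a rho).
  by apply: continuous_within_clamp; [exact: ltW|apply: acu => //; exact: ltW].
by move=> x ax xr; exact: derive1_clamp.
Qed.

Lemma ae_eq_integrable d (T : measurableType d) (mu : {measure set T -> \bar R})
    (D : set T) (f g : T -> \bar R) :
  measurable D -> measurable_fun D g -> mu.-integrable D f ->
  {ae mu, forall x, D x -> f x = g x} -> mu.-integrable D g.
Proof.
move=> mD mg /integrableP[mf foo] fg; apply/integrableP; split => //.
apply: le_lt_trans foo; apply: ae_le_integral.
by apply: filterS fg => x + Dx => ->.
Qed.

Lemma AC_loc_integral u (rho a : R) : AC_loc rho u -> 0 < a -> a < rho ->
  leb.-integrable `]a, rho[ (EFin \o derive1 u) /\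
  u rho - u a = \int[leb]_(t in `]a, rho[) derive1 u t.
Proof.
move=> acu a0 ar; have acu' := acu _ _ a0 (ltW ar) (lexx _).
have [h [ih hE]] := line_ac_integral (absolutely_continuous_line_ac (ltW ar) acu') (ltW ar).
have ma : measurable (`]a, rho[%classic : set (measurableTypeR R)) by exact: measurable_itv.
have ih' : leb.-integrable `]a, rho[ (EFin \o h).
  apply: integrableS ih => //.
  by move=> x/=; rewrite !in_itv/= => /andP[-> /ltW].
have dE : {ae leb, forall x : R, a < x -> x < rho -> derive1 u x = h x}.
  have := integral_derive1 ih hE; apply: filterS; first exact: (ae_filter_ringOfSetsType leb).
  by move=> x hx ax xr; have [_ <-] := hx ax xr; rewrite derive1_clamp.
have mdu : measurable_fun `]a, rho[ (derive1 u : R -> measurableTypeR R).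
  apply: measurable_funS (AC_loc_measurable_derive1 acu); first exact: measurable_itv.
  by move=> x/=; rewrite !in_itv/= => /andP[h1 ->]; rewrite (lt_trans a0 h1).
have idu : leb.-integrable `]a, rho[ (EFin \o derive1 u).
  apply: (ae_eq_integrable ma _ ih'); first exact/measurable_EFinP.
  move: dE; apply: filterS; first exact: (ae_filter_ringOfSetsType leb).
  move=> x hx /=; rewrite in_itv/= => /andP[h1 h2].
  by rewrite hx.
split => //; transitivity ((u \o clamp a rho) rho - (u \o clamp a rho) a).
  by rewrite /= !clamp_id ?lexx ?ltW.
rewrite (hE _ (ltW ar) (lexx _)) -Rintegral_itv_bndo_bndc; last exact: ih'.
congr fine; apply: ae_eq_integralT.
move: dE; apply: filterS; first exact: (ae_filter_ringOfSetsType leb).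
move=> x hx /=; rewrite in_itv/= => /andP[h1 h2].
by rewrite hx.
Qed.

Lemma primitive_increment u h (rho a : R) :
  leb.-integrable `]a, rho[ (EFin \o h) ->
  (forall r, a <= r -> r <= rho -> u r = - \int[leb]_(t in `]r, rho[) h t) ->
  leb.-integrable setT (EFin \o (h \_ `]a, rho[)) /\
  forall s t, a <= s -> s <= t -> t <= rho ->
    u t - u s = \int[leb]_(x in `]s, t]) (h \_ `]a, rho[) x.
Proof.
move=> ih uE.
have mab : measurable (`]a, rho[%classic : set (measurableTypeR R)) by exact: measurable_itv.
have ih' : leb.-integrable setT (EFin \o (h \_ `]a, rho[)).
  by have := (integrable_mkcond _ mab).1 ih; rewrite restrict_EFin.
split => // s t as_ st tr.
have iS (i : interval R) : leb.-integrable [set` i] (EFin \o (h \_ `]a, rho[)).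
  by apply: integrableS ih' => //; exact: measurable_itv.
have uE' r : a <= r -> r <= rho -> u r = - \int[leb]_(t in `]r, rho]) (h \_ `]a, rho[) t.
  move=> ar rr; rewrite -Rintegral_itv_bndo_bndc// uE//; congr (- _).
  apply: eq_Rintegral => x; rewrite mem_setE in_itv/= => /andP[h1 h2].
  by rewrite /patch mem_setE in_itv/= h2 (le_lt_trans ar h1).
rewrite (uE' t) ?(le_trans as_)// (uE' s)//; last exact: le_trans tr.
have := @Rintegral_itvB R (h \_ `]a, rho[) (BRight s) (BRight rho) t.
rewrite !bnd_simp => /(_ (iS _) st tr) <-; lra.
Qed.

(** The absolute continuity of the integral of |h| provides [d]. Since h need not be integrable up
    to 0, the derivative is computed on each ]1/(k+1), rho[, and the countably many exceptional sets
    are joined. *)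
Lemma primitive_AC u h (rho : R) :
  (forall a, 0 < a -> leb.-integrable `]a, rho[ (EFin \o h)) ->
  (forall r, 0 < r -> r <= rho -> u r = - \int[leb]_(t in `]r, rho[) h t) ->
  AC_loc rho u /\ {ae leb, forall r : R, 0 < r -> r < rho -> derive1 u r = h r}.
Proof.
move=> ih uE.
have inc a : 0 < a -> leb.-integrable setT (EFin \o (h \_ `]a, rho[)) /\
  forall s t, a <= s -> s <= t -> t <= rho ->
    u t - u s = \int[leb]_(x in `]s, t]) (h \_ `]a, rho[) x.
  move=> a0; apply: primitive_increment; first exact: ih.
  by move=> r ar rr; rewrite uE// (lt_le_trans a0).
split.
  move=> a b a0 ab brho e e0; have [ih' incE] := inc _ a0.
  have [d [d0 hd]] := integral_normr_continuous ih' e0; exists d => // m s t st tst lst.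
  have mF k : measurable (`]s k, t k[%classic : set (measurableTypeR R)) by exact: measurable_itv.
  pose A := \big[setU/set0]_(k < m) (`]s k, t k[%classic : set (measurableTypeR R)).
  have mA : measurable A by apply: bigsetU_measurable => k _; exact: mF.
  have h0 : leb.-integrable setT (fun x => `|(h \_ `]a, rho[) x|%:E).
    exact: integrable_norm.
  apply: le_lt_trans (hd A mA _); last first.
    rewrite /A measure_bigsetU_ord//; apply: le_lt_trans (_ : ((\sum_k (t k - s k))%:E < _)%E).
      rewrite -sumEFin; apply: lee_sum => k _.
      have [_ stk _] := st k; rewrite [leLHS](_ : _ = leb `]s k, t k[%classic)//.
      by rewrite lebesgue_measure_itv/= lte_fin; case: ifPn => // _; rewrite lee_fin subr_ge0.
    by rewrite lte_fin.
  rewrite -lee_fin /Rintegral fineK; last first.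
    apply: integrable_fin_num => //; apply: integrableS h0 => //.
  rewrite /A ge0_integral_bigsetU//; last 3 first.
  - by rewrite index_enum_uniq.
  - by apply: sub_trivIset tst.
  - by apply: measurable_funTS; have /integrableP[] := h0.
  rewrite -sumEFin; apply: lee_sum => k _; have [ak stk kb] := st k.
  rewrite (incE _ _ ak stk (le_trans kb brho)) -Rintegral_itv_bndo_bndc; last first.
    by apply: integrableS ih' => //; exact: measurable_itv.
  apply: (@le_trans _ _ (\int[leb]_(x in `]s k, t k[) `|(h \_ `]a, rho[) x|)%:E).
    rewrite lee_fin; apply: le_normr_Rintegral => //.
    by apply: integrableS ih' => //; exact: measurable_itv.
  rewrite /Rintegral fineK//; apply: integrable_fin_num => //.
  by apply: integrableS h0 => //.
have : {ae leb, forall x : R, forall k : nat, k.+1%:R^-1 < x -> x < rho -> derive1 u x = h x}.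
  apply: ae_foralln => k; have [kr|kr] := ltP k.+1%:R^-1 rho; last first.
    by apply: nearW => x h1 /(lt_trans h1); rewrite ltNge kr.
  have k0 : (0 : R) < k.+1%:R^-1 by rewrite invr_gt0.
  have [ih' incE] := inc _ k0.
  have iS : leb.-integrable `]k.+1%:R^-1, rho] (EFin \o (h \_ `]k.+1%:R^-1, rho[)).
    by apply: integrableS ih' => //; exact: measurable_itv.
  have := integral_derive1 iS (fun x => incE _ x (lexx _)).
  apply: filterS; first exact: (ae_filter_ringOfSetsType leb).
  move=> x hx h1 h2; have [_ ->] := hx h1 h2.
  by rewrite /patch mem_setE in_itv/= h1 h2.
apply: filterS; first exact: (ae_filter_ringOfSetsType leb).
move=> x hx x0 xr; apply: (hx (Num.truncn x^-1)) => //.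
rewrite -[ltRHS]invrK ltf_pV2 ?posrE ?invr_gt0//; exact: truncnS_gt.
Qed.

End derivatives.

(** * Density of radial profiles *)

Section radial_density.
Context {R : realType} (n : nat) (rho : R) (rho0 : 0 < rho).
Notation leb := (@lebesgue_measure R).
Let D : set (measurableTypeR R) := `]0, rho[%classic.
Implicit Types (g h q : R -> R) (A : set (measurableTypeR R)).

Import HBSimple.

Let mD : measurable D. Proof. exact: measurable_itv. Qed.

Let D_in t : D t -> 0 < t < rho. Proof. by rewrite /D/= in_itv. Qed.

(** The variable stands for |x|^2, so that composing with |x|^2 gives a smooth function of x. The
    support stays away from the origin and from the sphere of radius [rho]. *)
Definition radial_profile q := gen_smooth1 q /\
  exists2 p : R * R, 0 < p.1 /\ p.2 < rho ^+ 2 &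
    forall s, ~ (p.1 < s < p.2) -> q s = 0.

(** The function g plays the role of t^n v'(t): if V' = q/2, then V(t^2) has derivative t q(t^2),
    and t^(n+1) q(t^2) is t^n times this derivative. *)
Definition radial_approx g := measurable_fun D g /\ forall e : R, 0 < e ->
  exists2 q, radial_profile q &
    (\int[leb]_(t in D) `|g t - t ^+ n.+1 * q (t ^+ 2)|%:E <= e%:E)%E.

Lemma measurable_radial_profile q : gen_smooth1 q -> measurable_fun D (fun t => t ^+ n.+1 * q (t ^+ 2)).
Proof.
move=> sq; apply: measurable_funTS; apply: continuous_measurable_fun => t.
apply: cvgM; first exact: exprn_continuous.
apply: continuous_comp; first exact: exprn_continuous.
exact: (smooth1_continuous (gen_smooth1P sq)).
Qed.

Lemma L1dist_trans g h (k : R -> R) : measurable_fun D g -> measurable_fun D h -> measurable_fun D k ->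
  (\int[leb]_(t in D) `|g t - k t|%:E <=
   \int[leb]_(t in D) `|g t - h t|%:E + \int[leb]_(t in D) `|h t - k t|%:E)%E.
Proof.
move=> mg mh mk; rewrite -ge0_integralD//; last 2 first.
- by apply/measurable_EFinP; apply: measurableT_comp => //; exact: measurable_funB.
- by apply/measurable_EFinP; apply: measurableT_comp => //; exact: measurable_funB.
apply: le_integralT => t _; rewrite -EFinD lee_fin.
by rewrite (_ : g t - k t = (g t - h t) + (h t - k t)) ?ler_normD//; lra.
Qed.

Lemma radial_profileD q1 q2 : radial_profile q1 -> radial_profile q2 ->
  radial_profile (fun s => q1 s + q2 s).
Proof.
move=> [s1 [[a1 b1] /= [a10 b10] h1]] [s2 [[a2 b2] /= [a20 b20] h2]]; split; first exact: gen_smooth1_add.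
exists (Num.min a1 a2, Num.max b1 b2) => /=; first by rewrite lt_min a10 gt_max b10.
move=> s /negP; rewrite gt_min lt_max => hs; rewrite h1 ?h2 ?addr0//.
  by apply/negP; apply: contra hs => /andP[-> ->]; rewrite !orbT.
by apply/negP; apply: contra hs => /andP[-> ->].
Qed.

Lemma radial_profileZ c q : radial_profile q -> radial_profile (fun s => c * q s).
Proof.
move=> [s1 [p hp h1]]; split; first by apply: gen_smooth1_mul => //; exact: gen_smooth1_cst.
by exists p => // s /h1 ->; rewrite mulr0.
Qed.

Lemma radial_profile0 : radial_profile (fun=> 0).
Proof. by split; [exact: gen_smooth1_cst|exists (1, 0) => //=; rewrite exprn_gt0]. Qed.

Lemma radial_approxD g h : radial_approx g -> radial_approx h ->
  radial_approx (fun t => g t + h t).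
Proof.
move=> [mg ag] [mh ah]; split; first exact: measurable_funD.
move=> e e0; have e2 : 0 < e / 2 by rewrite divr_gt0.
have [q1 p1 i1] := ag _ e2; have [q2 p2 i2] := ah _ e2.
exists (fun s => q1 s + q2 s); first exact: radial_profileD.
have mq1 := measurable_radial_profile p1.1; have mq2 := measurable_radial_profile p2.1.
rewrite [e]splitr EFinD; apply: le_trans (leeD i1 i2).
rewrite -ge0_integralD//; last 2 first.
- by apply/measurable_EFinP; apply: measurableT_comp => //; exact: measurable_funB.
- by apply/measurable_EFinP; apply: measurableT_comp => //; exact: measurable_funB.
apply: le_integralT => t _; rewrite -EFinD lee_fin.
apply: le_trans (ler_normD _ _); rewrite mulrDr opprD addrACA; exact: lexx.
Qed.

Lemma radial_approxZ c g : radial_approx g -> radial_approx (fun t => c * g t).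
Proof.
move=> [mg ag]; split; first by apply: measurable_funM => //; exact: measurable_cst.
move=> e e0; have c0 : 0 < `|c| + 1 by rewrite ltr_wpDl.
have [q p i] := ag (e / (`|c| + 1)) (divr_gt0 e0 c0).
exists (fun s => c * q s); first exact: radial_profileZ.
have mq := measurable_radial_profile p.1.
have mgq : measurable_fun D (fun t => `|g t - t ^+ n.+1 * q (t ^+ 2)|%:E).
  by apply/measurable_EFinP; apply: measurableT_comp => //; exact: measurable_funB.
apply: (@le_trans _ _ ((`|c| + 1)%:E * \int[leb]_(t in D) `|g t - t ^+ n.+1 * q (t ^+ 2)|%:E)%E).
  rewrite -ge0_integralZl_EFin//.
  apply: le_integralT => t _; rewrite -EFinM lee_fin mulrCA -mulrBr normrM.
  by rewrite ler_wpM2r// lerDl.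
apply: le_trans (lee_wpmul2l _ i) _; first by rewrite lee_fin ltW.
by rewrite -EFinM mulrCA divff ?gt_eqF// mulr1.
Qed.

Lemma radial_approx_lim g : measurable_fun D g -> (forall e : R, 0 < e ->
  exists2 h, radial_approx h & (\int[leb]_(t in D) `|g t - h t|%:E <= e%:E)%E) -> radial_approx g.
Proof.
move=> mg ag; split => // e e0; have e2 : 0 < e / 2 by rewrite divr_gt0.
have [h [mh ah] i1] := ag _ e2; have [q p i2] := ah _ e2; exists q => //.
rewrite [e]splitr EFinD; apply: le_trans (leeD i1 i2).
by apply: L1dist_trans => //; exact: measurable_radial_profile p.1.
Qed.

Lemma radial_approx0 : radial_approx (fun=> 0).
Proof.
split => // e e0; exists (fun=> 0); first exact: radial_profile0.
by under eq_integral do rewrite mulr0 subrr normr0; rewrite integral0 lee_fin ltW.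
Qed.

Lemma radial_approx_sum (I : Type) (s : seq I) (F : I -> R -> R) :
  (forall i, radial_approx (F i)) -> radial_approx (fun t => \sum_(i <- s) F i t).
Proof.
move=> aF; elim: s => [|i s IHs].
  by under eq_fun do rewrite big_nil; exact: radial_approx0.
by under eq_fun do rewrite big_cons; exact: radial_approxD.
Qed.

Lemma L1dist_cvg0 (w : R -> R) (h : nat -> R -> R) (C e : R) : 0 < e ->
  leb.-integrable D (EFin \o w) -> (forall k, measurable_fun D (h k)) ->
  (forall k t, D t -> `|h k t| <= C) ->
  (forall t, D t -> h k t @[k --> \oo] --> 0) ->
  exists k, (\int[leb]_(t in D) `|w t * h k t|%:E <= e%:E)%E.
Proof.
move=> e0 iw mh hC h0.
have iw' : leb.-integrable D (EFin \o (fun t => `|w t|)) by exact: integrable_norm.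
have := @cvg_integral_mul_bounded R _ _ leb D _ (fun=> 0) (fun k t => `|h k t|) C mD iw'.
have mh' k : measurable_fun D (fun t => `|h k t|) by apply: measurableT_comp.
have h0' : {ae leb, forall t, D t -> `|h k t| @[k --> \oo] --> (0 : R)}.
  by apply: nearW => t Dt; rewrite -(@normr0 _ R); apply: cvg_norm; exact: h0.
have hC' k t : D t -> `| `|h k t| | <= C by move=> Dt; rewrite normr_id hC.
move=> /(_ mh' (measurable_cst _) hC' h0').
rewrite (_ : \int[leb]_(x in D) (`|w x| * 0)%:E = 0)%E; last first.
  by under eq_integral do rewrite mulr0; rewrite integral0.
move=> /fine_cvgP[fin /cvgrPdist_le/(_ e e0) H1].
near \oo => k; exists k.
have fk : (\int[leb]_(x in D) (`|w x| * `|h k x|)%:E)%E \is a fin_num by near: k.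
have hk : `|0 - fine (\int[leb]_(x in D) (`|w x| * `|h k x|)%:E)%E| <= e by near: k.
under eq_integral do rewrite normrM.
rewrite -(fineK fk) lee_fin; apply: le_trans hk.
by rewrite sub0r normrN ler_norm.
Unshelve. all: by end_near. Qed.

Lemma itv_bounded_integrable g (C : R) : measurable_fun D g ->
  (forall t, D t -> `|g t| <= C) -> leb.-integrable D (EFin \o g).
Proof.
move=> mg gC; apply: (@le_integrable _ _ _ leb D mD _ (fun=> C%:E)).
- exact/measurable_EFinP.
- by move=> t Dt /=; rewrite lee_fin (le_trans (gC t Dt))// ler_norm.
- apply/integrableP; split => //; rewrite integral_cst//= /D lebesgue_measure_itv/=.
  by case: ifPn => _; rewrite ?mule0// -EFinB -EFinM ltry.
Qed.

(** The factor t^(n+1) is kept exact; only the indicator function is approximated, by bumps between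
    a^2 and b^2 evaluated at t^2. *)
Lemma radial_approx_itv (a b : R) : 0 < a -> 0 < b -> b < rho ->
  radial_approx (fun t => t ^+ n.+1 * (a < t < b)%R%:R).
Proof.
move=> a0 b0 brho.
have mI : measurable_fun D (fun t => (a < t < b)%R%:R : R).
  rewrite (_ : (fun _ => _) = \1_(`]a, b[%classic)); first exact: measurable_indic.
  by apply/funext => t; rewrite indicE mem_setE in_itv.
have mX : measurable_fun D (fun t : R => t ^+ n.+1).
  by apply: measurable_funTS; apply: continuous_measurable_fun; exact: exprn_continuous.
split; first exact: measurable_funM.
move=> e e0.
have mb k : measurable_fun D (fun t => bump (a ^+ 2) (b ^+ 2) k (t ^+ 2)).
  apply: measurable_funTS; apply: continuous_measurable_fun => t.
  apply: (@continuous_comp _ _ _ (fun t : R => t ^+ 2) (bump (a ^+ 2) (b ^+ 2) k)).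
    exact: exprn_continuous.
  exact: (smooth1_continuous (gen_smooth1P (gen_smooth1_bump _ _ _))).
have iX : leb.-integrable D (EFin \o (fun t => t ^+ n.+1)).
  apply: (@itv_bounded_integrable _ (rho ^+ n.+1)) => // t /D_in /andP[t0 tr].
  by rewrite ger0_norm ?exprn_ge0 ?ltW// ltr_pXn2r// ?nnegrE ltW.
have [|||k hk] := @L1dist_cvg0 (fun t => t ^+ n.+1)
    (fun k t => (a < t < b)%R%:R - bump (a ^+ 2) (b ^+ 2) k (t ^+ 2)) 2 e e0 iX.
- by move=> k; exact: measurable_funB.
- move=> k t _; apply: (le_trans (ler_normB _ _)); rewrite [2]splitr divff// lerD//.
    by rewrite normr_nat; case: (_ < _ < _).
  by rewrite ger0_norm ?bump_ge0// bump_le1.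
- move=> t /D_in /andP[t0 tr].
  have -> : (a < t < b)%R = (a ^+ 2 < t ^+ 2 < b ^+ 2)%R.
    by rewrite !ltr_pXn2r// ?nnegrE ?ltW.
  rewrite -(subrr ((a ^+ 2 < t ^+ 2 < b ^+ 2)%R%:R : R)).
  by apply: cvgB; [exact: cvg_cst|exact: cvg_bump].
exists (bump (a ^+ 2) (b ^+ 2) k).
  split; first exact: gen_smooth1_bump.
  exists (a ^+ 2, b ^+ 2) => /=; first by rewrite exprn_gt0// ltr_pXn2r// ?nnegrE ?ltW.
  by move=> s; exact: bump_out.
apply: le_trans hk; apply: le_integralT => t _; rewrite lee_fin mulrBr; exact: lexx.
Qed.

(** Dynkin induction from the half-lines ]x, +oo[, which merely raise the lower end a. Complements
    and disjoint unions are handled by linearity and by L^1 limits. *)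
Lemma radial_approx_indic (a b : R) A : 0 < a -> 0 < b -> b < rho -> measurable A ->
  radial_approx (fun t => t ^+ n.+1 * (a < t < b)%R%:R * \1_A t).
Proof.
move=> a0 b0 br.
set w := fun t : R => t ^+ n.+1 * (a < t < b)%R%:R.
have aw : radial_approx w by exact: radial_approx_itv.
have iw : leb.-integrable D (EFin \o w).
  apply: (@itv_bounded_integrable _ (rho ^+ n.+1)); first by case: aw.
  move=> t /D_in /andP[t0 tr]; have tn : 0 <= t ^+ n.+1 by rewrite exprn_ge0// ltW.
  rewrite normrM normr_nat (ger0_norm tn).
  apply: (@le_trans _ _ (t ^+ n.+1)).
    by case: (_ < _ < _); rewrite ?mulr1 ?mulr0.
  by rewrite lerXn2r// ?nnegrE ltW.
have mG := RGenOInfty.measurableE R.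
suff H : <<s @RGenOInfty.G R >> `<=` (fun A => radial_approx (fun t => w t * \1_A t)).
  by move=> mA; have : (@ocitv R).-sigma.-measurable A by []; rewrite mG => /H.
apply: (dynkin_induction mG).
- move=> _ _ [x ->] [y ->]; exists (Num.max x y).
  by apply/seteqP; split => t /=; rewrite !in_itv/= !andbT gt_max => /andP.
- by under eq_fun do rewrite indicT mulr1.
- move=> _ [x ->].
  rewrite (_ : (fun _ => _) = (fun t => t ^+ n.+1 * (Num.max a x < t < b)%R%:R)).
    by apply: radial_approx_itv => //; rewrite lt_max a0.
  apply/funext => t; rewrite /w indicE mem_setE in_itv/= andbT -mulrA -natrM mulnb.
  by rewrite gt_max andbAC.
- move=> {}A mA PA.
  rewrite (_ : (fun _ => _) = (fun t => w t + -1 * (w t * \1_A t))).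
    by apply: radial_approxD => //; exact: radial_approxZ.
  by apply/funext => t; rewrite !indicE in_setC; case: (_ \in A); rewrite /= ?mulr0 ?mulr1 ?mulN1r ?subrr ?addr0.
move=> F mF tF PF.
have mP k : measurable_fun D (\1_(\big[setU/set0]_(i < k) F i) : R -> R).
  by apply: measurable_indic; apply: bigsetU_measurable.
have mU : measurable_fun D (\1_(\bigcup_k F k) : R -> R).
  by apply: measurable_indic; exact: bigcupT_measurable.
apply: radial_approx_lim; first by apply: measurable_funM => //; case: aw.
move=> e e0.
have [|||k hk] := @L1dist_cvg0 w (fun k t =>
  \1_(\bigcup_k F k) t - \1_(\big[setU/set0]_(i < k) F i) t) 2 e e0 iw.
- by move=> k; exact: measurable_funB.
- move=> k t _; apply: (le_trans (ler_normB _ _)); rewrite [2]splitr divff// lerD// !indicE normr_nat.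
    by case: (_ \in _).
  by case: (_ \in _).
- move=> t _; apply: cvg_near_cst.
  have [[k _ Fk]|nF] := pselect ((\bigcup_k F k) t).
    exists k.+1 => // j /= kj; rewrite !indicE !mem_set ?subrr//; last by exists k.
    by rewrite -bigcup_mkord; exists k.
  apply: nearW => k; rewrite !indicE !memNset ?subrr// -bigcup_mkord.
  by move=> [j _ Fj]; apply: nF; exists j.
exists (fun t => w t * \1_(\big[setU/set0]_(i < k) F i) t).
  rewrite (_ : (fun _ => _) = (fun t => \sum_(i < k) w t * \1_(F i) t)).
    by apply: radial_approx_sum => i; exact: PF.
  apply/funext => t; rewrite -mulr_sumr; congr (_ * _).
  elim: k {hk} => [|k IHk]; first by rewrite !big_ord0 indic0.
  rewrite !big_ord_recr/= -IHk !indicE in_setU.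
  have [|_] := boolP (t \in \big[setU/set0]_(i < k) F i); last by rewrite add0r.
  rewrite inE -bigcup_mkord => -[j /= jk Fj]; rewrite memNset ?addr0// => Fk.
  have FF : F j `&` F k = set0 by move/trivIsetP : tF; apply => //; rewrite neq_ltn jk.
  have : (F j `&` F k) t by split.
  by rewrite FF.
apply: le_trans hk; apply: le_integralT => t _; rewrite lee_fin mulrBr; exact: lexx.
Qed.

Lemma radial_approx_itv_integrable (a b : R) h : 0 < a -> 0 < b -> b < rho ->
  leb.-integrable D (EFin \o h) -> radial_approx (fun t => t ^+ n.+1 * (a < t < b)%R%:R * h t).
Proof.
move=> a0 b0 br ih; have mh : measurable_fun D h by case/integrableP: ih => /measurable_EFinP.
set w := fun t : R => t ^+ n.+1 * (a < t < b)%R%:R.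
have mw : measurable_fun D w by case: (radial_approx_itv a0 b0 br).
apply: radial_approx_lim; first exact: measurable_funM.
have [g_ [ig_ _ g0]] := approximation_sfun_integrable mD ih.
move=> e e0; have r0 : 0 < rho ^+ n.+1 by rewrite exprn_gt0.
have e'0 : 0 < e / rho ^+ n.+1 by rewrite divr_gt0.
move: g0 => /fine_cvgP[fin /cvgrPdist_le/(_ _ e'0) H1].
near \oo => k; exists (fun t => w t * g_ k t).
  pose s : seq R := finmap.enum_fset (fset_set (g_ k @` setT)).
  rewrite (_ : (fun _ => _) = fun t => \sum_(i < size s) s`_i * (w t * \1_(g_ k @^-1` [set s`_i]) t)).
    by apply: radial_approx_sum => i; apply: radial_approxZ; exact: radial_approx_indic.
  by apply/funext => t; rewrite fimfunEord mulr_sumr; apply: eq_bigr => i _; rewrite mulrCA.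
have fk : (\int[leb]_(z in D) `|(EFin \o h) z - (g_ k z)%:E|)%E \is a fin_num by near: k.
have hk : `|0 - fine (\int[leb]_(z in D) `|(EFin \o h) z - (g_ k z)%:E|)%E| <= e / rho ^+ n.+1 by near: k.
apply: (@le_trans _ _ ((rho ^+ n.+1)%:E * \int[leb]_(z in D) `|(EFin \o h) z - (g_ k z)%:E|)%E).
  have mg : measurable_fun D (g_ k) by case/integrableP: (ig_ k) => /measurable_EFinP.
  rewrite -ge0_integralZl_EFin//; last 2 first.
  - by apply/measurable_EFinP; apply: measurableT_comp => //; exact: measurable_funB.
  - exact: ltW.
  apply: le_integralT => t /D_in /andP[t0 tr]; rewrite -EFinB -EFinM lee_fin -mulrBr normrM.
  rewrite ler_wpM2r// /w normrM normr_nat.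
  have tn : 0 <= t ^+ n.+1 by rewrite exprn_ge0// ltW.
  rewrite (ger0_norm tn); apply: (@le_trans _ _ (t ^+ n.+1)).
    by case: (_ < _ < _); rewrite ?mulr1 ?mulr0.
  by rewrite lerXn2r// ?nnegrE ltW.
rewrite -(fineK fk) -EFinM lee_fin mulrC -ler_pdivlMr//; apply: le_trans hk.
by rewrite sub0r normrN ler_norm.
Unshelve. all: by end_near. Qed.

Lemma radial_dense W (e : R) : leb.-integrable D (EFin \o W) -> 0 < e ->
  exists2 q, radial_profile q &
    (\int[leb]_(t in D) `|W t - t ^+ n.+1 * q (t ^+ 2)|%:E <= e%:E)%E.
Proof.
move=> iW e0; have mW : measurable_fun D W by case/integrableP: iW => /measurable_EFinP.
suff [_] : radial_approx W by apply.
apply: radial_approx_lim => // {}e {}e0.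
(* W is first cut off to the intervals ]a_k, b_k[, which are compactly contained in ]0, rho[ and
   exhaust it. *)
pose a k : R := rho / k.+3%:R; pose b k := rho - a k.
have a0 k : 0 < a k by rewrite divr_gt0.
have ar k : a k < rho by rewrite ltr_pdivrMr// ltr_pMr// ltr1n.
have mI k : measurable_fun D (fun t => (a k < t < b k)%R%:R : R).
  rewrite (_ : (fun _ => _) = \1_(`]a k, b k[%classic)); first exact: measurable_indic.
  by apply/funext => t; rewrite indicE mem_setE in_itv.
have [|||k hk] := @L1dist_cvg0 W (fun k t => 1 - (a k < t < b k)%R%:R) 1 e e0 iW.
- by move=> k; apply: measurable_funB => //; exact: measurable_cst.
- by move=> k t _; case: (_ < _ < _); rewrite ?subrr ?subr0 ?normr0 ?normr1.
- move=> t /D_in /andP[t0 tr]; apply: cvg_near_cst.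
  have : \forall k \near \oo, a k < Num.min t (rho - t).
    have h : 0 < Num.min t (rho - t) / rho by rewrite divr_gt0// lt_min t0 subr_gt0.
    exists (Num.truncn (Num.min t (rho - t) / rho)^-1) => // k /= hk.
    rewrite /a mulrC -ltr_pdivlMr// invf_plt ?posrE//.
    by apply: lt_le_trans (truncnS_gt _) _; rewrite ler_nat; apply: leq_trans hk _; rewrite leqW.
  apply: filterS => k; rewrite lt_min => /andP[h1 h2].
  by rewrite h1 /b ltrBrDl -ltrBrDr h2 subrr.
have W' : leb.-integrable D (EFin \o (fun t => W t * ((a k < t)%R%:R / t ^+ n.+1))).
  apply: (@integrable_mul_bounded R _ _ leb D W _ (a k ^- n.+1)) => //.
    apply: measurable_funM.
      rewrite (_ : (fun _ => _) = \1_(`]a k, +oo[%classic)); first exact: measurable_indic.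
      by apply/funext => t; rewrite indicE mem_setE in_itv/= andbT.
    apply: (measurableT_comp (@measurable_invr R)).
    by apply: measurable_funTS; apply: continuous_measurable_fun; exact: exprn_continuous.
  move=> t /D_in /andP[t0 tr]; rewrite normrM normr_nat.
  have [h|h] := ltP (a k) t; last by rewrite mul0r invr_ge0 exprn_ge0// ltW.
  by rewrite mul1r normfV ger0_norm ?exprn_ge0 ?(ltW t0)// lef_pV2 ?posrE ?exprn_gt0// lerXn2r// ?nnegrE// ltW.
(* This is W on ]a_k, b_k[ and 0 elsewhere. The division by t^(n+1) sits in the integrable factor,
   whose own cut-off at a_k keeps it integrable up to 0. *)
exists (fun t => t ^+ n.+1 * (a k < t < b k)%R%:R * (W t * ((a k < t)%R%:R / t ^+ n.+1))).
  apply: radial_approx_itv_integrable => //.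
    rewrite subr_gt0; exact: ar.
  by rewrite /b ltrBlDr ltrDl.
apply: le_trans hk; apply: le_integralT => t /D_in /andP[t0 tr]; rewrite lee_fin.
have tn : t ^+ n.+1 != 0 by rewrite expf_neq0// gt_eqF.
case: (ltP (a k) t) => /= h; last by rewrite mul0r !mulr0 !subr0 mulr1.
by rewrite mul1r mulrCA (mulrAC (t ^+ n.+1)) divff// mul1r mulrBr mulr1.
Qed.

End radial_density.

(** * Integrals of radial functions *)

Section radial_integral.
Context {R : realType} (n : nat) (rho : R) (rho0 : 0 < rho).
Notation leb := (@lebesgue_measure R).
Notation lrow := (@lebesgue_row R n.+1).
Notation I := (`]0%R, rho[%classic : set (measurableTypeR R)).
Notation A := (@annulus R n).
Notation C := (@polar_cst R n).

(** The annulus contains the cube ]c, 2c[^(n+1) with c = (n+1)^(-1/2), since the point with all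
    coordinates equal to c has norm 1. *)
Lemma lebesgue_row_annulus_gt0 : (0 < lrow A)%E.
Proof.
pose c : R := (Num.sqrt n.+1%:R)^-1.
have s0 : 0 < Num.sqrt n.+1%:R :> R by rewrite sqrtr_gt0.
have c0 : 0 < c by rewrite invr_gt0.
have mI : measurable (`]c, 2 * c[%classic : set (measurableTypeR R)) by exact: measurable_itv.
have c2 : \sum_(i < n.+1) c ^+ 2 = 1.
  rewrite sumr_const card_ord exprVn sqr_sqrtr// -[LHS]mulr_natr mulVf//.
apply: (@lt_le_trans _ _ (lrow (row_box (fun=> `]c, 2 * c[%classic)))).
  have -> : lrow (row_box (fun=> `]c, 2 * c[%classic)) = (\prod_(i < n.+1) c%:E)%E.
    have -> : lrow (row_box (fun=> `]c, 2 * c[%classic)) =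
        (\prod_(i < n.+1) leb `]c, (2 * c)%R[%classic)%E.
      exact: (@lebesgue_row_box R n.+1 (fun=> `]c, 2 * c[%classic)).
    apply: eq_bigr => i _; rewrite lebesgue_measure_itv/= lte_fin ltr_pMl// ltr1n.
    by rewrite -EFinB; congr EFin; lra.
  by rewrite prodEFin lte_fin prodr_gt0.
rewrite le_measure ?inE//; [by apply: measurable_row_box|exact: measurable_annulus|].
move=> x xI; rewrite /annulus/=.
have xi i : c < x ord0 i < 2 * c by have := xI i; rewrite /= in_itv.
rewrite -(@ltr_pXn2r _ 2) ?nnegrE ?eucl_norm_ge0//.
rewrite -(@ltr_pXn2r _ 2 _ (eucl_norm x)) ?nnegrE ?eucl_norm_ge0// sqr_eucl_norm.
apply/andP; split.
  rewrite expr1n -c2; apply: ltr_sum; first by apply/hasP; exists ord0.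
  by move=> i _; have /andP[h1 h2] := xi i; rewrite ltr_pXn2r ?nnegrE ?ltW// (lt_trans c0).
have c4 : \sum_(i < n.+1) (2 * c) ^+ 2 = 2 ^+ 2.
  by under eq_bigr do rewrite exprMn; rewrite -mulr_sumr c2 mulr1.
rewrite -c4; apply: ltr_sum; first by apply/hasP; exists ord0.
move=> i _; have /andP[h1 h2] := xi i; rewrite ltr_pXn2r// nnegrE ltW//.
  by rewrite (lt_trans c0).
by rewrite mulr_gt0.
Qed.

Lemma lebesgue_row_annulus_fin : lrow A \is a fin_num.
Proof.
rewrite ge0_fin_numE//; apply: (@le_lt_trans _ _ (lrow (eucl_ball 2))).
  by apply: le_measure; rewrite ?inE; [exact: measurable_annulus|exact: measurable_eucl_ball|move=> x /andP[]].
exact: lebesgue_row_ball_lty.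
Qed.

Lemma measurable_row_set0 : measurable [set 0 : 'rV[R]_n.+1].
Proof.
rewrite (_ : [set 0] = row_box (fun=> [set 0%R : R])).
  by apply: measurable_row_box => i; exact: measurable_set1.
by apply/seteqP; split => [x -> i|x h]; [rewrite /= mxE|apply/rowP => i; rewrite mxE; exact: h].
Qed.

Lemma ae_neq0 : {ae lrow, forall x : 'rV[R]_n.+1, x != 0}.
Proof.
exists [set 0]; split => //.
- exact: measurable_row_set0.
- exact: lebesgue_row_set0.
- by move=> x /= /negP; rewrite negbK => /eqP.
Qed.

(** For a radial function the inner integral in [polar] does not depend on y. *)
Lemma ge0_polar_radial (G : R -> \bar R) : measurable_fun I G ->
  (forall r, (0 < r)%R -> (r < rho)%R -> (0 <= G r)%E) ->
  (C * \int[lrow]_(x in eucl_ball rho) G (eucl_norm x) =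
   lrow A * \int[leb]_(s in I) ((s ^+ n)%:E * G s))%E.
Proof.
move=> mG G0; have mI : measurable I by exact: measurable_itv.
pose G' : R -> \bar R := G \_ I.
have G'E r : 0 < r -> r < rho -> G' r = G r.
  by move=> r0 rr; rewrite /G' patchE mem_setE in_itv/= r0 rr.
have G'0 r : (0 <= G' r)%E.
  rewrite /G' patchE mem_setE in_itv/=; case: ifPn => // /andP[]; exact: G0.
have mG' : measurable_fun setT G' by apply/(measurable_restrictT _ mI).
transitivity (C * \int[lrow]_x G' (eucl_norm x))%E.
  congr (_ * _)%E; rewrite integral_mkcond; apply: ae_eq_integralT.
  apply: filterS ae_neq0 => x x0 _; rewrite patchE.
  case: ifPn; rewrite ?inE /eucl_ball/=.
    move=> xr; rewrite G'E// lt_neqAle eucl_norm_ge0 andbT eq_sym.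
    by apply: contra x0 => /eqP/eucl_norm_eq0 ->.
  rewrite notin_setE /= => /negP; rewrite -leNgt => xr.
  have xr' : (eucl_norm x < rho) = false by apply/negbTE; rewrite -leNgt.
  by rewrite /G' patchE mem_setE in_itv/= xr' andbF.
rewrite polar//; last by apply: measurableT_comp => //; exact: measurable_eucl_norm.
transitivity (\int[lrow]_(y in A) cst (\int[leb]_(s in I) ((s ^+ n)%:E * G s)) y)%E; last first.
  transitivity (\int[leb]_(s in I) ((s ^+ n)%:E * G s) * lrow A)%E; last exact: muleC.
  by apply: integral_cst; exact: measurable_annulus.
apply: eq_integral => y; rewrite inE => Ay.
rewrite [RHS]integral_mkcond [LHS]integral_mkcond; apply: eq_integral => s _.
rewrite !patchE !mem_setE !in_itv/= andbT.
case: (ltP 0 s) => s0 //=; rewrite eucl_norm_ray// /G' patchE mem_setE in_itv/= s0/=.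
by case: ifP => //; rewrite mule0.
Qed.

(** The case +oo - +oo = -oo is included, so that [polar_radial] carries over even to integrands
    with two infinite parts. *)
Lemma EFin_mulB (c : R) (a b : \bar R) : 0 < c -> (0 <= a)%E -> (0 <= b)%E ->
  (c%:E * (a - b) = c%:E * a - c%:E * b)%E.
Proof.
move=> c0; case: a => [a| |] //; case: b => [b| |] // _ _.
- by rewrite -EFinB -!EFinM -EFinB mulrBr.
- by rewrite /= !(gt0_muleNy, gt0_muley) ?lte_fin.
- by rewrite /= gt0_muley ?lte_fin// addye.
- by rewrite /= gt0_muley ?lte_fin// addeNy gt0_muleNy ?lte_fin.
Qed.

Lemma polar_radial (G : R -> \bar R) : measurable_fun I G ->
  (C * \int[lrow]_(x in eucl_ball rho) G (eucl_norm x) =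
   lrow A * \int[leb]_(s in I) ((s ^+ n)%:E * G s))%E.
Proof.
move=> mG; have mI : measurable I by exact: measurable_itv.
have hC : C = (fine C)%:E by rewrite fineK ?polar_cst_fin.
have hA : lrow A = (fine (lrow A))%:E by rewrite fineK ?lebesgue_row_annulus_fin.
have C0 : 0 < fine C by rewrite fine_gt0// polar_cst_gt0 polar_cst_lty.
have A0 : 0 < fine (lrow A).
  by rewrite fine_gt0// lebesgue_row_annulus_gt0/= ltey_eq lebesgue_row_annulus_fin.
rewrite integralE [X in (_ = _ * X)%E]integralE hC hA.
rewrite [LHS](EFin_mulB C0); [|exact: integral_ge0|exact: integral_ge0].
rewrite [RHS](EFin_mulB A0); [|exact: integral_ge0|exact: integral_ge0].
rewrite -hC -hA; congr (_ - _)%E.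
  have := @ge0_polar_radial (funepos G) (measurable_funepos mG) (fun _ _ _ => funepos_ge0 _ _).
  move=> E; transitivity (C * \int[lrow]_(x in eucl_ball rho) (funepos G) (eucl_norm x))%E.
  by congr (_ * _)%E; apply: eq_integral => x _; rewrite !funeposE.
rewrite E; congr (_ * _)%E; apply: eq_integral => s; rewrite mem_setE in_itv/= => /andP[s0 _].
  by rewrite !funeposE maxe_pMr ?mule0// lee_fin exprn_ge0// ltW.
have := @ge0_polar_radial (funeneg G) (measurable_funeneg mG) (fun _ _ _ => funeneg_ge0 _ _).
move=> E; transitivity (C * \int[lrow]_(x in eucl_ball rho) (funeneg G) (eucl_norm x))%E.
  by congr (_ * _)%E; apply: eq_integral => x _; rewrite !funenegE.
rewrite E; congr (_ * _)%E; apply: eq_integral => s; rewrite mem_setE in_itv/= => /andP[s0 _].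
by rewrite !funenegE maxe_pMr ?mule0 ?muleN// lee_fin exprn_ge0// ltW.
Qed.

(** [ge0_polar_radial] for the indicator function of a null set of radii: its right-hand side is 0
    and the constant on the left is positive. *)
Lemma ae_radial (P : R -> Prop) : {ae leb, forall r : R, 0 < r -> r < rho -> P r} ->
  {ae lrow, forall x, 0 < eucl_norm x -> eucl_norm x < rho -> P (eucl_norm x)}.
Proof.
move=> [N [mN N0 PN]].
have mB : measurable (eucl_ball rho `&` @eucl_norm R n.+1 @^-1` N).
  apply: measurableI; first exact: measurable_eucl_ball.
  by rewrite -[X in measurable X]setTI; exact: measurable_eucl_norm.
exists (eucl_ball rho `&` @eucl_norm R n.+1 @^-1` N); split => //; last first.
  move=> x /= /not_implyP[x0] /not_implyP[xr nP]; split => //; apply: PN => /=.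
  by apply/not_implyP; split => //; apply/not_implyP.
have mN1 : measurable_fun I (EFin \o (\1_N : R -> R)) by apply/measurable_EFinP.
have h0 (r : R) : 0 < r -> r < rho -> (0 <= (EFin \o (\1_N : R -> R)) r)%E by rewrite /= lee_fin.
have := ge0_polar_radial mN1 h0.
rewrite [X in _ = (_ * X)%E](_ : _ = 0%E); last first.
  transitivity (\int[leb]_(s in I) cst 0%E s)%E; last by rewrite integral0.
  apply: ae_eq_integralT; exists N; split => // s /= /not_implyP[_ hs].
  by apply: contrapT => Ns; apply: hs; rewrite indicE memNset// mule0.
rewrite mule0 => /eqP; rewrite mule_eq0 gt_eqF ?polar_cst_gt0//= => /eqP.
move=> E; rewrite setIC -integral_indic//; last 2 first.
- exact: measurable_eucl_ball.
- by rewrite -[X in measurable X]setTI; exact: measurable_eucl_norm.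
Qed.

(** G is controlled on ]0, rho[ only, so the origin is split off as a singleton. *)
Lemma measurable_radial d (T : measurableType d) (G : R -> T) : measurable_fun I G ->
  measurable_fun (eucl_ball rho) (fun x : 'rV[R]_n.+1 => G (eucl_norm x)).
Proof.
move=> mG; have m0 := measurable_row_set0.
rewrite (_ : eucl_ball rho = [set 0] `|` (eucl_ball rho `\` [set 0])); last first.
  rewrite setDUK// => x ->; rewrite /eucl_ball/= eucl_norm0//.
have mB : measurable (eucl_ball rho `\` [set 0 : 'rV[R]_n.+1]).
  by apply: measurableD => //; exact: measurable_eucl_ball.
apply/measurable_funU => //; split; first exact: measurable_fun_set1.
apply: (measurable_comp (F := I) _ _ mG); first exact: measurable_itv.
  move=> _ [x [xr /= x0] <-]; rewrite in_itv/= xr andbT.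
  by rewrite lt_neqAle eucl_norm_ge0 andbT eq_sym; apply/eqP => /eucl_norm_eq0.
by apply: measurable_funTS; exact: measurable_eucl_norm.
Qed.

End radial_integral.

(** * Radial Sobolev functions *)

Section radial_test.
Context {R : realType} (n : nat) (rho : R) (rho0 : 0 < rho).
Notation leb := (@lebesgue_measure R).
Notation lrow := (@lebesgue_row R n.+1).
Implicit Types (q V : R -> R).

Lemma Rintegral_derive (F f : R -> R) (a b : R) : (forall x : R, is_derive x 1 F (f x)) ->
  continuous f -> a <= b -> \int[leb]_(x in `]a, b[) f x = F b - F a.
Proof.
move=> dF cf; rewrite le_eqVlt => /predU1P[<-|ab].
  by rewrite set_itv_ge ?bnd_simp// Rintegral_set0 subrr.
have cF x : {for x, continuous F}.
  by apply: differentiable_continuous; apply/derivable1_diffP; have [] := dF x.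
have cfw : {within `[a, b], continuous f} by exact: continuous_subspaceT.
have ifc : leb.-integrable `[a, b] (EFin \o f).
  by apply: continuous_compact_integrable => //; exact: segment_compact.
have io : leb.-integrable `]a, b[ (EFin \o f).
  apply: integrableS ifc => //; exact: subset_itv_oo_cc.
have io' : leb.-integrable `]a, b] (EFin \o f).
  apply: integrableS ifc => //; exact: subset_itv_oc_cc.
rewrite Rintegral_itv_bndo_bndc// Rintegral_itv_obnd_cbnd//.
rewrite /Rintegral (@continuous_FTC2 _ f F)//.
- split.
  + by move=> x _; have [] := dF x.
  + by apply: cvg_at_right_filter; exact: cF.
  + by apply: cvg_at_left_filter; exact: cF.
- by move=> x _; rewrite derive1E derive_val.
Qed.

(** Since q vanishes up to a > z, the primitive based at z is 0 around every x < a, including the x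
    <= z that the fundamental theorem does not reach. *)
Lemma is_derive_primitive (q : R -> R) (z a : R) : z < a -> continuous q ->
  (forall s, s <= a -> q s = 0) ->
  forall x : R, is_derive x 1 (fun x => \int[leb]_(t in `[z, x]) q t) (q x).
Proof.
move=> za cq q0 x.
have iq y : leb.-integrable `[z, y] (EFin \o q).
  apply: continuous_compact_integrable; first exact: segment_compact.
  exact: continuous_subspaceT.
have [xa|ax] := ltP x a; last first.
  have zx : z < x by exact: lt_le_trans ax.
  have x1 : x < x + 1 by rewrite ltrDl.
  have [d1 d2] := continuous_FTC1_closed x1 (iq (x + 1)) zx (cq x).
  exact: (DeriveDef d1 (etrans (esym (derive1E _ _)) d2)).
rewrite q0 ?ltW//; apply: (near_eq_is_derive (f := fun=> 0 : R)).
near=> y; have ya : y < a by near: y; exact: (cvgr_lt x).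
apply/esym; rewrite (@eq_Rintegral _ _ _ leb _ (fun=> 0)).
  by rewrite Rintegral_cst// mul0r.
move=> t; rewrite mem_setE in_itv/= => /andP[t0 ty]; apply: q0.
by rewrite (le_trans ty)// ltW.
Unshelve. all: by end_near. Qed.

Lemma radial_profile_primitive q : radial_profile rho q ->
  exists V : R -> R, [/\ smooth1 V, forall x : R, is_derive x 1 V (q x) &
    exists2 b : R, 0 < b < rho ^+ 2 & forall x, b <= x -> V x = 0].
Proof.
move=> [sq [[a b] /= [a0 br] q0]].
have cq : continuous q by exact: smooth1_continuous (gen_smooth1P sq).
pose V0 x := \int[leb]_(t in `[0, x]) q t.
have dV (x : R) : is_derive x 1 V0 (q x).
  apply: is_derive_primitive a0 cq _ x => s sa; apply: q0 => /andP[].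
  by rewrite ltNge sa.
(* The primitive is normalized to vanish beyond c < rho^2; rho^2 / 2 keeps c positive whatever b
   is. *)
pose c := Num.max b (rho ^+ 2 / 2).
have r2 : 0 < rho ^+ 2 by rewrite exprn_gt0.
exists (fun x => V0 x - V0 c).
have dV' (x : R) : is_derive x 1 (fun x => V0 x - V0 c) (q x).
  by have := is_deriveB (dV x) (is_derive_cst (V0 c) x 1); rewrite subr0.
split => //; first by apply: smooth1_antiderivative dV' _; exact: gen_smooth1P.
exists c; first by rewrite lt_max divr_gt0 ?orbT// gt_max br ltr_pdivrMr// ltr_pMr// ltr1n.
move=> x cx; rewrite -(Rintegral_derive dV cq cx).
rewrite (@eq_Rintegral _ _ _ leb _ (fun=> 0)); first by rewrite Rintegral_cst// mul0r.
move=> t; rewrite mem_setE in_itv/= => /andP[t0 ty]; apply: q0 => /andP[_].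
by rewrite ltNge ltW// (le_lt_trans _ t0)// le_max lexx.
Qed.

Lemma is_derive_sumsq (x : 'rV[R]_n.+1) (i : 'I_n.+1) : is_derive x (delta_mx ord0 i)
  (fun x : 'rV[R]_n.+1 => \sum_j x ord0 j ^+ 2) (2 * x ord0 i).
Proof.
rewrite (_ : (fun x : 'rV[R]_n.+1 => _) =
    \sum_(j < n.+1) (fun x : 'rV[R]_n.+1 => x ord0 j * x ord0 j)); last first.
  by apply/funext => y; rewrite fct_sumE; apply: eq_bigr => j _; rewrite expr2.
have dj j : is_derive x (delta_mx ord0 i) (fun x : 'rV[R]_n.+1 => x ord0 j * x ord0 j)
    (x ord0 j * (j == i)%:R + x ord0 j * (j == i)%:R).
  by apply: is_deriveM; exact: is_derive_coord.
apply: (is_derive_eq (is_derive_sum dj)).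
rewrite (bigD1 i)//= eqxx mulr1 big1 ?addr0; first by rewrite mulr_natl mulr2n.
by move=> j /negPf ->; rewrite !mulr0 addr0.
Qed.

Lemma radial_test q : radial_profile rho q ->
  exists V : R -> R, [/\ (forall x : R, is_derive x 1 V (q x)),
    V (rho ^+ 2) = 0,
    test_function (eucl_ball rho) (fun x : 'rV[R]_n.+1 => V (eucl_norm x ^+ 2)) &
    forall x : 'rV[R]_n.+1, gradient (fun x => V (eucl_norm x ^+ 2)) x =
      (2 * q (eucl_norm x ^+ 2)) *: x].
Proof.
move=> /radial_profile_primitive[V [sV dV [b /andP[b0 br] Vb]]].
have NE : (fun x : 'rV[R]_n.+1 => V (eucl_norm x ^+ 2)) = (fun x => V (\sum_i x ord0 i ^+ 2)).
  by apply/funext => x; rewrite sqr_eucl_norm.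
have sm : smooth (fun x : 'rV[R]_n.+1 => V (eucl_norm x ^+ 2)).
  by rewrite NE; apply: gen_smoothP; apply: gen_smooth_comp => //; exact: gen_smooth_sumsq.
have ss := @is_derive_sumsq.
exists V; split => //; first by apply: Vb; exact: ltW.
- apply: (@test_functionI _ _ _ _ [set x | eucl_norm x ^+ 2 <= b] rho) => //.
  + rewrite (_ : [set x | _] = (fun x : 'rV[R]_n.+1 => \sum_i x ord0 i ^+ 2) @^-1` [set y | y <= b]).
      apply: closed_comp; last exact: closed_le.
      by move=> x _; exact: continuous_sumsq.
    by apply/seteqP; split => x /=; rewrite sqr_eucl_norm.
  + move=> x /= xb; apply: (le_trans (ler_norm_eucl_norm x)).
    by rewrite -(@ler_pXn2r _ 2) ?nnegrE ?eucl_norm_ge0 ?(ltW rho0)// (le_trans xb)// ltW.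
  + move=> x /= xb; rewrite /eucl_ball/=.
    by rewrite -(@ltr_pXn2r _ 2) ?nnegrE ?eucl_norm_ge0 ?(ltW rho0)// (le_lt_trans xb).
  + by move=> x /= /negP; rewrite -ltNge => /ltW/Vb.
move=> x; apply/rowP => i; rewrite !mxE NE.
have dP (y : 'rV[R]_n.+1) : is_derive y (delta_mx ord0 i)
    (fun x : 'rV[R]_n.+1 => V (\sum_j x ord0 j ^+ 2)) (q (\sum_j y ord0 j ^+ 2) * (2 * y ord0 i)).
  exact: (is_derive_comp1 (dV _) (ss y i)).
by rewrite (partialE dP) -sqr_eucl_norm mulrA (mulrC _ 2).
Qed.

End radial_test.

Section radial_sobolev.
Context {R : realType} (n : nat) (rho : R) (rho0 : 0 < rho).
Notation leb := (@lebesgue_measure R).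
Notation lrow := (@lebesgue_row R n.+1).
Notation I := (`]0%R, rho[%classic : set (measurableTypeR R)).
Notation B := (@eucl_ball R n.+1 rho).

Lemma polar_radial_le (G : R -> \bar R) (e : R) : measurable_fun I G ->
  (forall r, 0 < r -> r < rho -> (0 <= G r)%E) ->
  (\int[leb]_(s in I) ((s ^+ n)%:E * G s) <= e%:E)%E ->
  (\int[lrow]_(x in B) G (eucl_norm x) <=
    ((fine (lrow (@annulus R n))) / (fine (@polar_cst R n)) * e)%:E)%E.
Proof.
move=> mG G0 Ge; have E := ge0_polar_radial n mG G0.
have hC : @polar_cst R n = (fine (@polar_cst R n))%:E by rewrite fineK ?polar_cst_fin.
have hA : lrow (@annulus R n) = (fine (lrow (@annulus R n)))%:E.
  by rewrite fineK//; exact: lebesgue_row_annulus_fin.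
have C0 : 0 < fine (@polar_cst R n) by rewrite fine_gt0// polar_cst_gt0 polar_cst_lty.
have A0 : 0 <= fine (lrow (@annulus R n)) by rewrite fine_ge0.
have : ((fine (@polar_cst R n))%:E * \int[lrow]_(x in B) G (eucl_norm x) <=
    (fine (lrow (@annulus R n)) * e)%:E)%E.
  by rewrite -hC E hA EFinM lee_wpmul2l// -hA.
rewrite -lee_pdivlMl//; move=> /le_trans; apply.
by rewrite -EFinM lee_fin mulrA (mulrC _^-1).
Qed.

(** On ]r, rho[ the weight t^n is at least r^n. This controls w near 0, where it may be
    unbounded. *)
Lemma radial_growth (h w : R -> R) (e : R) : measurable_fun I h ->
  (forall r, 0 < r -> r < rho -> leb.-integrable `]r, rho[ (EFin \o h) /\
     w r = - \int[leb]_(t in `]r, rho[) h t) ->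
  (\int[leb]_(t in I) (t ^+ n * `|h t|)%:E <= e%:E)%E ->
  forall r, 0 < r -> r < rho -> r ^+ n * `|w r| <= e.
Proof.
move=> mh hw he r r0 rr; have [ih ->] := hw r r0 rr.
have mr : measurable (`]r, rho[%classic : set (measurableTypeR R)) by exact: measurable_itv.
have rn : 0 <= r ^+ n by rewrite exprn_ge0// ltW.
have sub : (`]r, rho[%classic : set R) `<=` `]0, rho[%classic.
  by move=> t/=; rewrite !in_itv/= => /andP[h1 ->]; rewrite (lt_trans r0).
rewrite -lee_fin normrN EFinM; apply: le_trans he.
apply: (@le_trans _ _ ((r ^+ n)%:E * \int[leb]_(t in `]r, rho[) `|h t|%:E)%E).
  rewrite lee_wpmul2l ?lee_fin//.
  have in' : leb.-integrable `]r, rho[ (EFin \o (fun t => `|h t|)) by exact: integrable_norm.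
  have := le_normr_Rintegral mr ih; rewrite -lee_fin /Rintegral [X in (_ <= X)%E -> _]fineK//.
  exact: integrable_fin_num.
rewrite -ge0_integralZl_EFin//; last first.
  apply/measurable_EFinP; apply: measurableT_comp => //.
  by apply: measurable_funS mh => //; exact: measurable_itv.
apply: (@le_trans _ _ (\int[leb]_(t in `]r, rho[) (t ^+ n * `|h t|)%:E)%E).
  apply: le_integralT => t; rewrite /= in_itv/= => /andP[rt _]; rewrite -EFinM lee_fin.
  by rewrite ler_wpM2r// lerXn2r// ?nnegrE ltW// (lt_trans r0).
apply: le_integral_sub => // t; rewrite /= in_itv/= => /andP[t0 _].
by rewrite lee_fin mulr_ge0// exprn_ge0// ltW.
Qed.

Lemma AC_loc_measurable (v : R -> R) : AC_loc rho v -> measurable_fun I v.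
Proof.
move=> acv; rewrite itv_oo_bigcup; apply/measurable_fun_bigcup => [k|k]; first exact: measurable_itv.
have k0 : (0 : R) < k.+1%:R^-1 by rewrite invr_gt0.
have [kr|kr] := ltP k.+1%:R^-1 rho; last first.
  rewrite set_itv_ge; first exact: measurable_fun_set0.
  by rewrite bnd_simp -leNgt.
apply: (eq_measurable_fun (v \o clamp k.+1%:R^-1 rho)).
  by move=> x; rewrite inE/= in_itv/= => /andP[h1 h2]; rewrite /= clamp_id// !ltW.
apply: measurable_funTS; apply: continuous_measurable_fun; apply: continuous_within_clamp.
  exact: ltW.
by apply: acv => //; exact: ltW.
Qed.

Lemma Wrad_derive1 (v : R -> R) : Wrad n.+1 rho v ->
  [/\ measurable_fun I (derive1 v),
    (forall r, 0 < r -> r < rho -> leb.-integrable `]r, rho[ (EFin \o derive1 v) /\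
     v r = - \int[leb]_(t in `]r, rho[) derive1 v t) &
    leb.-integrable I (EFin \o (fun t => t ^+ n * derive1 v t))].
Proof.
move=> [acv v0 iv]; have mv := AC_loc_measurable_derive1 acv; split => //.
  move=> r r0 rr; have [h1 h2] := AC_loc_integral acv r0 rr; split => //.
  by rewrite -h2 v0 sub0r opprK.
have mW : measurable_fun I (fun t => t ^+ n * derive1 v t).
  apply: measurable_funM; last exact: mv.
  by apply: measurable_funTS; apply: continuous_measurable_fun; exact: exprn_continuous.
have mI : measurable I by exact: measurable_itv.
apply: (@le_integrable _ _ _ leb I mI _ _ _ _ iv); first exact/measurable_EFinP.
by move=> t _ /=; rewrite lee_fin !normrM normr_id.
Qed.

(** By [radial_dense], t^n v'(t) is approximated in L^1 by t^(n+1) q(t^2). The primitive V of q/2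
    vanishing at rho^2 then gives test functions V(|x|^2) that converge to v(|x|) together with
    their gradients, which is what [W110_intro] requires. *)
Lemma Wrad_W110 (v : R -> R) : Wrad n.+1 rho v ->
  W110 B (fun x : 'rV[R]_n.+1 => v (eucl_norm x)) /\
  {ae lrow, forall x, B x ->
    eucl_norm (grad B (fun x : 'rV[R]_n.+1 => v (eucl_norm x)) x) = `|derive1 v (eucl_norm x)|}.
Proof.
move=> Wv; have [mh hv iW] := Wrad_derive1 Wv; have [acv _ _] := Wv.
set h := derive1 v in mh hv iW *; pose W t := t ^+ n * h t.
have mv := AC_loc_measurable acv.
pose c := fine (lrow (@annulus R n)) / fine (@polar_cst R n).
have c0 : 0 <= c by rewrite divr_ge0 ?fine_ge0// ltW// polar_cst_gt0.
have mX : measurable_fun I (fun t : R => t).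
  by apply: measurable_funTS; exact: measurable_id.
have oB : open B by exact: open_eucl_ball.
have mB : measurable B by exact: measurable_eucl_ball.
have mN : measurable_fun B (@eucl_norm R n.+1 : _ -> measurableTypeR R).
  by apply: measurable_funTS; exact: measurable_eucl_norm.
(* The expected weak gradient v'(|x|) x/|x|; the convention on division makes it 0 at the origin. *)
pose G (x : 'rV[R]_n.+1) : 'rV[R]_n.+1 := (h (eucl_norm x) / eucl_norm x) *: x.
have GE x : eucl_norm (G x) <= `|h (eucl_norm x)|.
  rewrite eucl_normZ normrM normfV (ger0_norm (eucl_norm_ge0 x)).
  have [->|x0] := eqVneq (eucl_norm x) 0; first by rewrite mulr0.
  by rewrite mulfVK.
(* In polar coordinates the L^1 norm of w(|.|) is c times the integral of s^n |w(s)| over ]0, rho[,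
   and [radial_growth] bounds that integrand by e. *)
have growth (w k : R -> R) (e : R) : measurable_fun I w -> measurable_fun I k ->
    (forall r, 0 < r -> r < rho -> leb.-integrable `]r, rho[ (EFin \o k) /\
     w r = - \int[leb]_(t in `]r, rho[) k t) ->
    (\int[leb]_(t in I) (t ^+ n * `|k t|)%:E <= e%:E)%E ->
    (\int[lrow]_(x in B) `|w (eucl_norm x)|%:E <= (c * (e * rho))%:E)%E.
  move=> mw mk kw ke; apply: (polar_radial_le (G := fun s => `|w s|%:E)).
  - by apply/measurable_EFinP; apply: measurableT_comp.
  - by move=> r _ _; rewrite lee_fin.
  apply: (@le_trans _ _ (\int[leb]_(s in I) cst e%:E s)%E).
    apply: le_integralT => s; rewrite /= in_itv/= => /andP[s0 sr].
    by rewrite -EFinM lee_fin; exact: radial_growth kw ke s s0 sr.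
  rewrite integral_cst//= lebesgue_measure_itv/= lte_fin rho0 -EFinB -EFinM subr0//.
pose E0 := fine (\int[leb]_(t in I) (t ^+ n * `|h t|)%:E)%E.
have E0E : (\int[leb]_(t in I) (t ^+ n * `|h t|)%:E <= E0%:E)%E.
  rewrite /E0 fineK// ge0_fin_numE; last first.
    by apply: integral_ge0 => t; rewrite /= in_itv/= => /andP[t0 _]; rewrite lee_fin mulr_ge0// exprn_ge0// ltW.
  have /integrableP[_] := iW; apply: le_lt_trans; apply: le_integralT => t.
  rewrite /= in_itv/= => /andP[t0 _].
  by rewrite lee_fin normrM (ger0_norm (exprn_ge0 _ (ltW t0))).
have iu : lrow.-integrable B (EFin \o (fun x : 'rV[R]_n.+1 => v (eucl_norm x))).
  apply/integrableP; split.
    by apply/measurable_EFinP; exact: measurable_radial mv.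
  by apply: le_lt_trans (growth v h E0 mv mh hv E0E) _; rewrite ltry.
have iG i : lrow.-integrable B (EFin \o (fun x => G x ord0 i)).
  have mG : measurable_fun B (fun x => G x ord0 i : measurableTypeR R).
    rewrite (_ : (fun _ => _) = (fun x => h (eucl_norm x) / eucl_norm x * x ord0 i)); last first.
      by apply/funext => x; rewrite mxE.
    apply: measurable_funM; last by apply: measurable_funTS; exact: measurable_coord.
    apply: measurable_funM; first exact: measurable_radial mh.
    by apply: (measurableT_comp (@measurable_invr R)).
  apply/integrableP; split; first exact/measurable_EFinP.
  apply: (@le_lt_trans _ _ (\int[lrow]_(x in B) `|h (eucl_norm x)|%:E)%E).
    apply: le_integralT => x _; rewrite lee_fin; apply: le_trans (GE x).
    exact: ler_coord_eucl_norm.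
  apply: (@le_lt_trans _ _ (c * E0)%:E); last by rewrite ltry.
  apply: (polar_radial_le (G := fun s => `|h s|%:E)) => //.
  by apply/measurable_EFinP; apply: measurableT_comp.
have approx k : exists phi : 'rV[R]_n.+1 -> R, [/\ test_function B phi,
    (\int[lrow]_(x in B) `|v (eucl_norm x) - phi x|%:E <= (c * (k.+1%:R^-1 * rho))%:E)%E &
    (\int[lrow]_(x in B) (eucl_norm (G x - gradient phi x))%:E <= (c * k.+1%:R^-1)%:E)%E].
  have e0 : (0 : R) < k.+1%:R^-1 by rewrite invr_gt0.
  have [q pq qW] := radial_dense n rho0 iW e0.
  (* The factor 1/2 makes q(|x|^2) x the gradient of V(|x|^2). *)
  have [V [dV V0 tV gV]] := radial_test n rho0 (radial_profileZ 2^-1 pq).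
  have sq : continuous q by exact: smooth1_continuous (gen_smooth1P pq.1).
  (* K is a.e. the derivative of v(t) - V(t^2), so one bound on K controls both the functions and
     their gradients. *)
  pose K t := h t - t * q (t ^+ 2).
  have cq2 : continuous (fun t : R => t * q (t ^+ 2)).
    move=> t; apply: cvgM; first exact: cvg_id.
    apply: (@continuous_comp _ _ _ (fun t : R => t ^+ 2) q); first exact: exprn_continuous.
    exact: sq.
  have mK : measurable_fun I K.
    by apply: measurable_funB => //; apply: measurable_funTS; exact: continuous_measurable_fun.
  have KE : (\int[leb]_(t in I) (t ^+ n * `|K t|)%:E <= (k.+1%:R^-1)%:E)%E.
    apply: le_trans qW; apply: le_integralT => t; rewrite /= in_itv/= => /andP[t0 _].
    rewrite lee_fin /K (exprSr t n) -(mulrA (t ^+ n)) -mulrBr normrM (ger0_norm (exprn_ge0 _ (ltW t0))); exact: lexx.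
  have dV2 (t : R) : is_derive t 1 (fun t => V (t ^+ 2)) (t * q (t ^+ 2)).
    have := @is_derive1_comp _ V (fun s : R => s ^+ 2) t _ _ (dV (t ^+ 2)) (is_derive_exprn 2 t).
    rewrite (_ : 2^-1 * q (t ^+ 2) * (2 * t ^+ 2.-1) = t * q (t ^+ 2))//.
    by rewrite expr1; move: (q (t ^+ 2)) => y; lra.
  exists (fun x => V (eucl_norm x ^+ 2)); split => //.
    have mV : measurable_fun I (fun s => V (s ^+ 2)).
      apply: measurable_funTS; apply: continuous_measurable_fun => s.
      by apply: differentiable_continuous; apply/derivable1_diffP; have [] := dV2 s.
    apply: (growth (fun s => v s - V (s ^+ 2)) K k.+1%:R^-1 _ mK) => //.
      exact: measurable_funB.
    move=> r r0 rr; have [ih vr] := hv r r0 rr.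
    have iq : leb.-integrable `]r, rho[ (EFin \o (fun t => t * q (t ^+ 2))).
      apply: (@integrableS _ _ _ leb `[r, rho]) => //; first exact: subset_itv_oo_cc.
      apply: continuous_compact_integrable; first exact: segment_compact.
      exact: continuous_subspaceT.
    split; first by apply: integrable_subr => //; exact: measurable_itv.
    rewrite RintegralB// (Rintegral_derive dV2 cq2 (ltW rr)) V0 vr; lra.
  apply: (@le_trans _ _ (\int[lrow]_(x in B) `|K (eucl_norm x)|%:E)%E); last first.
    apply: (polar_radial_le (G := fun s => `|K s|%:E)) => //.
    by apply/measurable_EFinP; apply: measurableT_comp.
  apply: le_integralT => x _; rewrite lee_fin gV /G -scalerBl eucl_normZ.
  rewrite mulrA divff ?pnatr_eq0// mul1r.
  have [->|x0] := eqVneq (eucl_norm x) 0; first by rewrite mulr0.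
  rewrite /K -[X in _ * X](ger0_norm (eucl_norm_ge0 x)) -normrM mulrBl mulfVK// (mulrC (q _)).
  exact: lexx.
have /choice[phi_ phiP] := approx.
have [wG Wu] : weak_gradient B (fun x : 'rV[R]_n.+1 => v (eucl_norm x)) G /\
    W110 B (fun x : 'rV[R]_n.+1 => v (eucl_norm x)).
  (* [rho + 1] dominates both the factor [rho] in the error of the functions and the factor 1 in
     that of the gradients. *)
  apply: (W110_intro oB iu iG (phi_ := phi_) (eps_ := fun k => c * (k.+1%:R^-1 * (rho + 1)))).
  - by move=> k; have [] := phiP k.
  - move=> k; have [_ h1 _] := phiP k; apply: (le_trans h1); rewrite lee_fin.
    by rewrite ler_wpM2l// ler_wpM2l ?invr_ge0// lerDl.
  - move=> k; have [_ _ h1] := phiP k; apply: (le_trans h1); rewrite lee_fin.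
    by rewrite ler_wpM2l// ler_peMr ?invr_ge0// lerDr ltW.
  - rewrite -[X in _ --> X](mulr0 c); apply: cvgMr; rewrite -[X in _ --> X](mul0r (rho + 1)).
    by apply: cvgMl; exact: cvg_harmonic.
split => //; have [[_ gu] _] := Wu.
have := weak_gradient_unique oB (getPex gu) wG.
have n0 := @ae_neq0 R n; apply: filterS2 n0 => x x0 gG Bx.
rewrite /grad gG// /G eucl_normZ normrM normfV (ger0_norm (eucl_norm_ge0 x)).
by rewrite mulfVK//; apply: contra x0 => /eqP/eucl_norm_eq0 ->.
Qed.

End radial_sobolev.

(** * Derivatives along rotations *)

Section ae_cvg.
Local Open Scope ereal_scope.

(** The integrals are summable, so the series of the f_k has a finite integral and converges a.e.;
    its terms then tend to 0. *)
Lemma ae_cvg0 d (T : measurableType d) (R : realType) (mu : {measure set T -> \bar R})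
    (D : set T) (f_ : nat -> T -> \bar R) : measurable D ->
  (forall k, measurable_fun D (f_ k)) -> (forall k x, D x -> 0 <= f_ k x) ->
  (forall k, \int[mu]_(x in D) f_ k x <= (2 ^- k)%:E) ->
  {ae mu, forall x, D x -> f_ k x @[k --> \oo] --> 0}.
Proof.
move=> mD mf f0 fk.
have S : \int[mu]_(x in D) (\sum_(k <oo) f_ k x) < +oo.
  rewrite integral_nneseries//.
  apply: (@le_lt_trans _ _ (\sum_(k <oo) (2 / (2 ^ (k + 1))%N%:R)%:E)).
    apply: lee_nneseries; [by move=> k *; apply: integral_ge0 => x; exact: f0|move=> k *].
    apply: (le_trans (fk k)); rewrite lee_fin natrX addn1 exprS invfM mulrA divff ?mul1r//.
  by rewrite (cvg_lim _ (@cvg_geometric_eseries_half R 2 0))// ltry.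
have mS : measurable_fun D (fun x => \sum_(k <oo) f_ k x).
  by apply: ge0_emeasurable_sum => // k x Dx _; exact: f0.
have S0 x : D x -> 0 <= \sum_(k <oo) f_ k x.
  by move=> Dx; apply: nneseries_ge0 => k _ _; exact: f0.
have iS : mu.-integrable D (fun x => \sum_(k <oo) f_ k x).
  apply/integrableP; split => //.
  by under eq_integral => x /set_mem Dx do rewrite gee0_abs ?S0//.
have := integrable_ae mD iS; apply: filterS => x hx Dx.
have /nneseries_tail_cvg : \sum_(k <oo) f_ k x < +oo by rewrite -ge0_fin_numE ?hx// S0.
move=> /(_ (fun k _ => f0 k x Dx)); apply: squeeze_cvge; last first.
- exact: cvg_cst.
- apply: nearW => k; rewrite f0//=.
  rewrite (@nneseries_split _ _ k 1); last by move=> j _; exact: f0.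
  rewrite addn1 big_nat1 leeDl//; apply: nneseries_ge0 => j _ _; exact: f0.
Qed.

End ae_cvg.

Lemma W110_elim_ae (R : realType) (n : nat) (Om : set 'rV[R]_n.+1) w : open Om -> W110 Om w ->
  exists phi_ : nat -> 'rV[R]_n.+1 -> R, [/\ forall j, test_function Om (phi_ j),
    forall j, (\int[lebesgue_row n.+1]_(x in Om) `|w x - phi_ j x|%:E +
      \int[lebesgue_row n.+1]_(x in Om) (eucl_norm (grad Om w x - gradient (phi_ j) x))%:E <= (2 ^- j)%:E)%E &
    {ae lebesgue_row n.+1, forall x, Om x -> phi_ j x @[j --> \oo] --> w x}].
Proof.
move=> oO Ww; have [phi_ [tphi phiE]] := W110_elim oO Ww; exists phi_; split => //.
have mO := open_row_measurable oO; have [[iw _] _] := Ww.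
have mw : measurable_fun Om w by case/integrableP: iw => /measurable_EFinP.
have mphi k : measurable_fun Om (phi_ k : _ -> R) by exact: test_measurable (tphi k).
have mphiw k : measurable_fun Om (fun x => `|w x - phi_ k x|%:E).
  by apply/measurable_EFinP; apply: measurableT_comp => //; exact: measurable_funB.
have : {ae lebesgue_row n.+1, forall x, Om x -> (`|w x - phi_ k x|%:E)%E @[k --> \oo] --> (0%E : \bar R)}.
  apply: ae_cvg0 => // k; apply: le_trans (phiE k); rewrite leeDl//.
  by apply: integral_ge0 => x _; rewrite lee_fin eucl_norm_ge0.
apply: filterS => x hx Ox; have /fine_cvgP[_ /cvgrPdist_lt h] := hx Ox.
apply/cvgrPdist_lt => e0 e00; have := h _ e00; apply: filterS => k /=.
by rewrite sub0r normrN normr_id.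
Qed.

Lemma measurable_eucl_norm_row d (T : measurableType d) (R : realType) (n : nat) (D : set T)
    (G : T -> 'rV[R]_n) : (forall i, measurable_fun D (fun x => G x ord0 i : measurableTypeR R)) ->
  measurable_fun D (fun x => eucl_norm (G x) : measurableTypeR R).
Proof.
move=> mG; apply: (measurableT_comp (continuous_measurable_fun (@sqrt_continuous R))).
by apply: measurable_sum => i; apply: measurable_funX; exact: mG.
Qed.

Lemma cvg_Rintegral d (T : measurableType d) (R : realType) (mu : {measure set T -> \bar R})
    (D : set T) (f_ : nat -> T -> R) (f : T -> R) : measurable D ->
  mu.-integrable D (EFin \o f) ->
  (\int[mu]_(x in D) (f_ k x)%:E @[k --> \oo] --> \int[mu]_(x in D) (f x)%:E)%E ->
  \int[mu]_(x in D) f_ k x @[k --> \oo] --> \int[mu]_(x in D) f x.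
Proof.
move=> mD iff H; apply: fine_cvg; rewrite /Rintegral fineK//.
exact: integrable_fin_num.
Qed.

Section rotation.
Context {R : realType} (n : nat).
Notation lrow := (@lebesgue_row R n.+1).
Notation e i := (delta_mx ord0 i : 'rV[R]_n.+1).
Implicit Types (i j : 'I_n.+1) (phi psi : 'rV[R]_n.+1 -> R) (g x : 'rV[R]_n.+1).

(* derivative along the rotation in the plane of the coordinates [i] and [j],
   of a function with gradient [g] at [x] *)
Definition rot i j g x : R := x ord0 i * g ord0 j - x ord0 j * g ord0 i.

Lemma gen_smooth_rot i j phi : smooth phi -> gen_smooth (fun x => rot i j (gradient phi x) x).
Proof.
move=> sp; rewrite (_ : (fun _ => _) =
    (fun x => x ord0 i * partial j phi x + (-1) * (x ord0 j * partial i phi x))).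
  apply: gen_smooth_add; first by apply: gen_smooth_mul; [exact: gen_smooth_coord|exact/gen_smooth_smooth/smooth_partial].
  apply: gen_smooth_mul; first exact: gen_smooth_cst.
  by apply: gen_smooth_mul; [exact: gen_smooth_coord|exact/gen_smooth_smooth/smooth_partial].
by apply/funext => x; rewrite /rot !mxE mulN1r.
Qed.

Lemma bounded_supp_partial i phi : smooth phi -> bounded_supp phi -> bounded_supp (partial i phi).
Proof. by move=> sp; apply: bounded_supp_is_derive => x; exact: smooth_is_derive. Qed.

Lemma bounded_supp_mul (F G : 'rV[R]_n.+1 -> R) : bounded_supp G -> bounded_supp (fun x => F x * G x).
Proof. by move=> [M M0 GM]; exists M => // x /GM ->; rewrite mulr0. Qed.

(** The integrand is the difference of the partial derivatives d_j (x_i phi) and d_i (x_j phi), in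
    which the terms phi times the Kronecker symbol cancel. *)
Lemma integral_rot0 i j phi : smooth phi -> bounded_supp phi ->
  (\int[lrow]_x (rot i j (gradient phi x) x)%:E = 0)%E.
Proof.
move=> sp bp.
pose F (k l : 'I_n.+1) x := x ord0 k * partial l phi x + phi x * (k == l)%:R.
have F0 k l : (\int[lrow]_x (F k l x)%:E = 0)%E.
  apply: (@integral_partial0 _ _ l (fun x => x ord0 k * phi x)).
  - by move=> x; apply: is_deriveM; [exact: is_derive_coord|exact: smooth_is_derive].
  - apply: gen_smooth_continuous; apply: gen_smooth_add.
      by apply: gen_smooth_mul; [exact: gen_smooth_coord|exact/gen_smooth_smooth/smooth_partial].
    by apply: gen_smooth_mul; [exact: gen_smooth_smooth|exact: gen_smooth_cst].
  - exact: bounded_supp_mul.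
have iF k l : lrow.-integrable setT (EFin \o F k l).
  apply: bounded_supp_integrable.
    apply: gen_smooth_continuous; apply: gen_smooth_add.
      by apply: gen_smooth_mul; [exact: gen_smooth_coord|exact/gen_smooth_smooth/smooth_partial].
    by apply: gen_smooth_mul; [exact: gen_smooth_smooth|exact: gen_smooth_cst].
  have [M M0 pM] := bp; have [M' M'0 pM'] := bounded_supp_partial l sp bp.
  exists (Num.max M M') => [|x]; first by rewrite lt_max M0.
  by rewrite ge_max => /andP[h1 h2]; rewrite /F pM// pM'// mulr0 mul0r addr0.
transitivity (\int[lrow]_x ((EFin \o F i j) x - (EFin \o F j i) x))%E.
  apply: eq_integral => x _; rewrite /= -EFinB; congr EFin.
  by rewrite /rot /F !mxE eq_sym; lra.
by rewrite integralB// !F0 sube0.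
Qed.

Lemma rot_chain i j (b B : R -> R) phi psi : smooth1 B -> (forall t : R, is_derive t 1 B (b t)) ->
  smooth phi -> smooth psi -> forall x,
  rot i j (gradient (fun x => B (phi x) * psi x) x) x =
  rot i j (gradient phi x) x * (b (phi x) * psi x) + rot i j (gradient psi x) x * B (phi x).
Proof.
move=> sB dB sp ss x.
have pE k : partial k (fun x => B (phi x) * psi x) x =
    B (phi x) * partial k psi x + psi x * (b (phi x) * partial k phi x).
  suff /partialE -> : forall y, is_derive y (e k) (fun x => B (phi x) * psi x)
      (B (phi y) * partial k psi y + psi y * (b (phi y) * partial k phi y)) by [].
  move=> y; apply: is_deriveM; last exact: smooth_is_derive.
  exact: (is_derive_comp1 (dB _) (smooth_is_derive _ _ sp)).
by rewrite /rot !mxE !pE; lra.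
Qed.

Lemma rot_bound i j g x (rho : R) : eucl_norm x <= rho -> `|rot i j g x| <= 2 * rho * eucl_norm g.
Proof.
move=> xr; have h k l : `|x ord0 k * g ord0 l| <= rho * eucl_norm g.
  rewrite normrM ler_pM//; last exact: ler_coord_eucl_norm.
  exact: le_trans (ler_coord_eucl_norm _ _) xr.
apply: (le_trans (ler_normB _ _)); apply: (le_trans (lerD (h i j) (h j i))).
by rewrite mulrDl -mulrDl; lra.
Qed.

Lemma rotB i j g h x : rot i j (g - h) x = rot i j g x - rot i j h x.
Proof. by rewrite /rot !mxE; lra. Qed.

(* |x|^2 |g|^2 - (x . g)^2 is the sum of the squares of the (x_i g_j - x_j g_i), i < j *)
Lemma lagrange_rot0 g x : (forall i j, rot i j g x = 0) -> eucl_norm x = 1 ->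
  eucl_norm g = `|\sum_i x ord0 i * g ord0 i|.
Proof.
move=> r0 x1; rewrite -[LHS]mulr1 -[X in _ * X]x1.
set c := \sum_i _.
have gE : g = c *: x.
  apply/rowP => j; rewrite mxE /c mulr_suml.
  have -> : \sum_i x ord0 i * g ord0 i * x ord0 j = \sum_i x ord0 i ^+ 2 * g ord0 j.
    apply: eq_bigr => i _; have := r0 i j; rewrite /rot => /eqP; rewrite subr_eq0 => /eqP h.
    by rewrite -mulrA (mulrC (g _ _)) -h expr2 mulrA.
  by rewrite -mulr_suml -sqr_eucl_norm x1 expr1n mul1r.
by rewrite {1}gE eucl_normZ x1 !mulr1.
Qed.

(** Expansion of 0 <= |g - c x|^2 for c = x . g and |x| = 1. *)
Lemma cauchy_schwarz g x : eucl_norm x = 1 -> `|\sum_i x ord0 i * g ord0 i| <= eucl_norm g.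
Proof.
move=> x1; set c := \sum_i _.
rewrite -(@ler_pXn2r _ 2) ?nnegrE ?eucl_norm_ge0// real_normK ?num_real// sqr_eucl_norm.
have : 0 <= \sum_i (g ord0 i - c * x ord0 i) ^+ 2 by apply: sumr_ge0 => i _; exact: sqr_ge0.
have E (a : R) : \sum_i (g ord0 i - a * x ord0 i) ^+ 2 =
    \sum_i g ord0 i ^+ 2 - 2 * a * (\sum_i x ord0 i * g ord0 i) + a ^+ 2 * \sum_i x ord0 i ^+ 2.
  by rewrite !mulr_sumr -sumrB -big_split/=; apply: eq_bigr => i _; rewrite !expr2; lra.
by rewrite E -(sqr_eucl_norm x) x1 expr1n -/c; lra.
Qed.

Section sobolev_rotation.
Variables (rho : R) (rho0 : 0 < rho).
Notation Ball := (@eucl_ball R n.+1 rho).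

Lemma integrable_rot i j (G : 'rV[R]_n.+1 -> 'rV[R]_n.+1) :
  (forall i, lrow.-integrable Ball (EFin \o (fun x => G x ord0 i))) ->
  lrow.-integrable Ball (EFin \o (fun x => rot i j (G x) x)).
Proof.
move=> iG; have mB : measurable Ball by exact: measurable_eucl_ball.
have ix (k l : 'I_n.+1) : lrow.-integrable Ball (EFin \o (fun x => G x ord0 k * x ord0 l)).
  apply: (@integrable_mul_bounded R _ _ lrow Ball _ _ rho mB (iG k)).
    by apply: measurable_funTS; exact: measurable_coord.
  by move=> x Bx; apply: (le_trans (ler_coord_eucl_norm x l)); exact: ltW.
rewrite (_ : (fun x => rot i j (G x) x) =
    (fun x => G x ord0 j * x ord0 i - G x ord0 i * x ord0 j)); last first.
  by apply/funext => x; rewrite /rot; lra.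
by apply: integrable_subr => //; exact: ix.
Qed.

Lemma test_integrable_rot i j phi : test_function Ball phi ->
  lrow.-integrable Ball (EFin \o (fun x => rot i j (gradient phi x) x)).
Proof.
move=> tq; apply: integrable_rot => k.
rewrite (_ : (fun x => _) = partial k phi).
  by apply: test_partial_integrable tq; exact: measurable_eucl_ball.
by apply/funext => x; rewrite mxE.
Qed.

Variables (w : 'rV[R]_n.+1 -> R) (Ww : W110 Ball w).

(** With a test function phi_k in place of w, this is [integral_rot0] for B(phi_k) psi. The
    boundedness of b and B allows the passage to the limit in k. *)
Lemma sobolev_chain_rot i j (b B : R -> R) (Cb CB : R) psi : smooth1 B ->
  (forall t : R, is_derive t 1 B (b t)) -> continuous b ->
  (forall t, `|b t| <= Cb) -> (forall t, `|B t| <= CB) -> test_function Ball psi ->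
  \int[lrow]_(x in Ball) (rot i j (grad Ball w x) x * (b (w x) * psi x)) +
  \int[lrow]_(x in Ball) (rot i j (gradient psi x) x * B (w x)) = 0.
Proof.
move=> sB dB cb bC BC tp.
have oB : open Ball by exact: open_eucl_ball.
have mB := open_row_measurable oB.
have [phi_ [tphi phiE phi_cvg]] := W110_elim_ae oB Ww.
have [[iw gw] _] := Ww; have wg : weak_gradient Ball w (grad Ball w) := getPex gw.
set g := grad Ball w in wg phiE *.
have Cb0 : 0 <= Cb by exact: le_trans (bC 0).
have [Cp Cp0 pC] := test_bounded tp.
have mw : measurable_fun Ball w by case/integrableP: iw => /measurable_EFinP.
have cB : continuous B by exact: smooth1_continuous.
have mcomp (q : R -> R) (f : 'rV[R]_n.+1 -> R) : continuous q -> measurable_fun Ball f ->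
    measurable_fun Ball (fun x => q (f x)).
  by move=> cq mf; apply: (measurableT_comp (continuous_measurable_fun cq)).
have mpsi : measurable_fun Ball (psi : _ -> R) by exact: test_measurable tp.
have ig : lrow.-integrable Ball (EFin \o (fun x => rot i j (g x) x)).
  by apply: integrable_rot => k; have [] := wg k.
have itest := test_integrable_rot i j.
have mphi k : measurable_fun Ball (phi_ k : _ -> R) by exact: test_measurable (tphi k).
have ibd (f h : 'rV[R]_n.+1 -> R) : lrow.-integrable Ball (EFin \o f) -> measurable_fun Ball h ->
    lrow.-integrable Ball (EFin \o (fun x => f x * (b (h x) * psi x))).
  move=> iff mh; apply: (@integrable_mul_bounded R _ _ lrow Ball f _ (Cb * Cp) mB iff).
    by apply: measurable_funM => //; exact: mcomp.
  by move=> x _; rewrite normrM ler_pM.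
have iBd (f h : 'rV[R]_n.+1 -> R) : lrow.-integrable Ball (EFin \o f) -> measurable_fun Ball h ->
    lrow.-integrable Ball (EFin \o (fun x => f x * B (h x))).
  move=> iff mh; apply: (@integrable_mul_bounded R _ _ lrow Ball f _ CB mB iff) => //.
  exact: mcomp.
have ab0 k : \int[lrow]_(x in Ball) (rot i j (gradient (phi_ k) x) x * (b (phi_ k x) * psi x)) +
    \int[lrow]_(x in Ball) (rot i j (gradient psi x) x * B (phi_ k x)) = 0.
  have sp : smooth (phi_ k) by case: (tphi k).
  have sq : smooth psi by case: tp.
  rewrite -RintegralD//; [|by apply: ibd => //; exact: itest|by apply: iBd => //; exact: itest].
  have sS : smooth (fun x => B (phi_ k x) * psi x).
    by apply/gen_smoothP/gen_smooth_mul; [apply: gen_smooth_comp => //|]; exact: gen_smooth_smooth.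
  have bS : bounded_supp (fun x => B (phi_ k x) * psi x).
    by apply: bounded_supp_mul; exact: test_bounded_supp tp.
  rewrite -[RHS]/(fine 0%E) -(integral_rot0 i j sS bS); congr fine.
  rewrite integral_mkcond; apply: eq_integral => x _; rewrite patchE.
  case: ifPn => [_|]; first by rewrite (rot_chain i j sB dB sp sq).
  rewrite notin_setE => /= Bx; rewrite (rot_chain i j sB dB sp sq).
  rewrite (test_out tp Bx) (test_gradient_out tp Bx) /rot !mxE; congr EFin; lra.
have cvgb : \int[lrow]_(x in Ball) (rot i j (gradient psi x) x * B (phi_ k x)) @[k --> \oo] -->
    \int[lrow]_(x in Ball) (rot i j (gradient psi x) x * B (w x)).
  apply: cvg_Rintegral => //; first by apply: iBd => //; exact: itest.
  apply: (cvg_integral_mul_bounded (C := CB)) => //; first exact: itest.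
  - by move=> k; exact: mcomp.
  - exact: mcomp.
  - apply: filterS phi_cvg => x hx Bx; apply: continuous_cvg; [exact: cB|exact: hx].
have cvga : \int[lrow]_(x in Ball) (rot i j (gradient (phi_ k) x) x * (b (phi_ k x) * psi x)) @[k --> \oo] -->
    \int[lrow]_(x in Ball) (rot i j (g x) x * (b (w x) * psi x)).
  have -> : (fun k => \int[lrow]_(x in Ball) (rot i j (gradient (phi_ k) x) x * (b (phi_ k x) * psi x))) =
    (fun k => \int[lrow]_(x in Ball) (rot i j (g x) x * (b (phi_ k x) * psi x)) -
      \int[lrow]_(x in Ball) (rot i j (g x - gradient (phi_ k) x) x * (b (phi_ k x) * psi x))).
    apply/funext => k; rewrite -RintegralB//; last 2 first.
    - exact: ibd.
    - apply: ibd => //; rewrite (_ : (fun x => _) = (fun x => rot i j (g x) x - rot i j (gradient (phi_ k) x) x)); last first.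
        by apply/funext => x; rewrite rotB.
      by apply: integrable_subr => //; exact: itest.
    by apply: eq_Rintegral => x _; rewrite rotB; lra.
  rewrite -[X in _ --> X]subr0; apply: cvgB.
    apply: cvg_Rintegral => //; first exact: ibd.
    apply: (cvg_integral_mul_bounded (C := Cb * Cp)) => //.
    - by move=> k; apply: measurable_funM => //; exact: mcomp.
    - by apply: measurable_funM => //; exact: mcomp.
    - by move=> k x _; rewrite normrM ler_pM.
    - apply: filterS phi_cvg => x hx Bx; apply: cvgMl.
      by apply: continuous_cvg; [exact: cb|exact: hx].
  have E0 : (fun k => Cb * Cp * (2 * rho * 2 ^- k)) @ \oo --> (0 : R).
    rewrite -[X in _ --> X](mulr0 (Cb * Cp)); apply: cvgMr.
    rewrite -[X in _ --> X](mulr0 (2 * rho)); apply: cvgMr.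
    under eq_fun do rewrite -exprVn.
    by apply: cvg_expr; rewrite ger0_norm ?invr_ge0// invf_lt1// ltr1n.
  apply: (@squeeze_cvgr _ _ _ _ (fun k => - (Cb * Cp * (2 * rho * 2 ^- k))) (fun k => Cb * Cp * (2 * rho * 2 ^- k))).
  - apply: nearW => k; rewrite -ler_norml; apply: normr_Rintegral_mul_le => //.
    + rewrite (_ : (fun x => _) = (fun x => rot i j (g x) x - rot i j (gradient (phi_ k) x) x)); last first.
        by apply/funext => x; rewrite rotB.
      by apply: integrable_subr => //; exact: itest.
    + by apply: measurable_funM => //; exact: mcomp.
    + exact: mulr_ge0.
    + by move=> x _; rewrite normrM ler_pM.
    + apply: (@le_trans _ _ ((2 * rho)%:E * \int[lrow]_(x in Ball) (eucl_norm (g x - gradient (phi_ k) x))%:E)%E).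
        rewrite -ge0_integralZl_EFin//; last 3 first.
        * by move=> x _; rewrite lee_fin eucl_norm_ge0.
        * apply/measurable_EFinP/measurable_eucl_norm_row => l.
          rewrite (_ : (fun x => _) = (fun x => g x ord0 l - partial l (phi_ k) x)).
            apply: measurable_funB; last exact: test_partial_measurable (tphi k).
            by have [/integrableP[/measurable_EFinP]] := wg l.
          by apply/funext => x; rewrite !mxE.
        * by rewrite mulr_ge0// ltW.
        apply: le_integralT => x Bx; rewrite -EFinM lee_fin; apply: rot_bound; exact: ltW.
      rewrite [leRHS]EFinM lee_wpmul2l//; first by rewrite lee_fin mulr_ge0// ltW.
      by apply: le_trans (phiE k); rewrite leeDr//; apply: integral_ge0.
  - by rewrite -oppr0; apply: cvgN.
  - exact: E0.
have := cvgD cvga cvgb; rewrite [X in X @ _](_ : _ = fun=> 0); last first.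
  by apply/funext => k; exact: ab0.
move=> /(_ _) H; rewrite -(cvg_lim (@Rhausdorff R) H).
by apply: lim_cst; exact: Rhausdorff.
Qed.

End sobolev_rotation.

End rotation.

Section bump_primitive.
Context {R : realType}.
Notation leb := (@lebesgue_measure R).

(** The last clause writes B(t) as an integral over the s < t, so that B(w(x)) becomes an integral
    over pairs (x, s) with s < w(x). The window ]-K, K[ keeps the measure of the set of these pairs
    finite. *)
Lemma bump_primitive (c d K : R) (m : nat) : - K <= c -> d <= K -> 0 < K ->
  exists B : R -> R, [/\ smooth1 B, (forall t : R, is_derive t 1 B (bump c d m t)),
    (forall t, `|B t| <= 2 * K) &
    forall t, (\int[leb]_(s in `](- K)%R, K[) ((s < t)%R%:R * bump c d m s)%:E = (B t)%:E)%E].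
Proof.
move=> Kc dK K0; set q := bump c d m.
have cq : continuous q by exact: smooth1_continuous (gen_smooth1P (gen_smooth1_bump _ _ _)).
(* Based at -K - 1, strictly to the left of the support of q, as [is_derive_primitive] requires. *)
pose B t := \int[leb]_(s in `[- K - 1, t]) q s.
have dB t : is_derive (t : R) 1 B (q t).
  apply: (@is_derive_primitive R q _ (- K)) => //; first lra.
  move=> s sK; apply: bump_out => /andP[cs _].
  by have := le_lt_trans (le_trans sK Kc) cs; rewrite ltxx.
have mI : measurable (`]- K, K[%classic : set (measurableTypeR R)) by exact: measurable_itv.
have iq t : leb.-integrable `[- K - 1, t] (EFin \o q).
  apply: continuous_compact_integrable; first exact: segment_compact.
  exact: continuous_subspaceT.
have BE t : (\int[leb]_(s in `](- K)%R, K[) ((s < t)%R%:R * q s)%:E = (B t)%:E)%E.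
  rewrite /B /Rintegral fineK; last by apply: integrable_fin_num => //; exact: measurable_itv.
  rewrite [LHS]integral_mkcond [RHS]integral_mkcond; apply: (@ae_eq_integralT _ _ _ leb).
  exists [set t]; split; [exact: measurable_set1|exact: lebesgue_measure_set1|].
  move=> s /= /not_implyP[_]; apply: contra_notP => st.
  rewrite !patchE !mem_setE !in_itv/=.
  have [sq|sq] := boolP (c < s < d).
    move: (sq) => /andP[cs sd].
    rewrite (le_lt_trans Kc cs) (lt_le_trans sd dK)/=.
    have -> : (- K - 1 <= s) by move: (le_lt_trans Kc cs) => h; lra.
    by case: ltgtP st => // h _; rewrite ?mul1r ?mul0r.
  by rewrite /q (bump_out _ (negP sq)) mulr0; case: ifP; case: ifP.
exists B; split => //.
  by apply: smooth1_antiderivative dB _; exact/gen_smooth1P/gen_smooth1_bump.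
move=> t; rewrite -lee_fin.
have B0 : 0 <= B t.
  by rewrite -lee_fin -BE; apply: integral_ge0 => s _; rewrite lee_fin mulr_ge0// bump_ge0.
rewrite ger0_norm// -BE; apply: (@le_trans _ _ (\int[leb]_(s in `](- K)%R, K[) cst 1%E s)%E).
  apply: le_integralT => s _; rewrite lee_fin.
  by case: (s < t); rewrite ?mul1r ?mul0r// bump_le1.
rewrite integral_cst//= mul1e lebesgue_measure_itv/= lte_fin.
by case: ifPn => _; rewrite ?lee_fin//; lra.
Qed.

End bump_primitive.

Section null_sections.
Context d1 d2 (T1 : measurableType d1) (T2 : measurableType d2) (R : realType).
Variables (m1 : {sigma_finite_measure set T1 -> \bar R}) (m2 : {sigma_finite_measure set T2 -> \bar R}).
Local Open Scope ereal_scope.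

Lemma null_ysection (S : set (T1 * T2)) : measurable S ->
  (m1 \x m2) S = 0 <-> {ae m2, forall y, {ae m1, forall x, ~ S (x, y)}}.
Proof.
move=> mS.
have mf : measurable_fun setT (fun p => (\1_S p : R)%:E).
  by apply/measurable_EFinP; exact: measurable_indic.
have f0 p : 0 <= (\1_S p : R)%:E by rewrite lee_fin.
have mG := @measurable_fun_fubini_tonelli_G _ _ T1 T2 R m1 _ mf f0.
have mx y : measurable_fun setT (fun x => (\1_S (x, y) : R)%:E).
  by apply: (measurableT_comp mf); exact: measurable_fun_pair.
have -> : (m1 \x m2) S = \int[m2]_y \int[m1]_x (\1_S (x, y) : R)%:E.
  transitivity (\int[m1 \x m2]_p (\1_S p : R)%:E); first by rewrite integral_indic// setIT.
  exact: (fubini_tonelli2 (fun p => (\1_S p : R)%:E)).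
split.
  move=> /(ge0_integral_eq0_ae measurableT mG) -/(_ _).
  move=> h; have {}h := h (fun y _ => integral_ge0 _ (fun x _ => f0 _)).
  apply: filterS h => y /(_ I).
  move=> /(ge0_integral_eq0_ae measurableT (mx y)) h.
  have {}h := h (fun x _ => f0 _).
  apply: filterS h => x /(_ I); rewrite indicE => /eqP; rewrite eqe pnatr_eq0 eqb0.
  by rewrite notin_setE.
move=> h; transitivity (\int[m2]_y (cst 0 y)); last by rewrite integral0.
apply: ae_eq_integralT; apply: filterS h => y hy _.
transitivity (\int[m1]_x (cst 0 x)); last by rewrite integral0.
by apply: ae_eq_integralT; apply: filterS hy => x nS _; rewrite indicE memNset.
Qed.

End null_sections.

(** * The signed measure Xw psi dx seen through (|x|^2, w) *)

Section rot_level_sets.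
Context {R : realType} (n : nat) (rho : R) (rho0 : 0 < rho).
Notation leb := (@lebesgue_measure R).
Notation lrow := (@lebesgue_row R n.+1).
Notation Ball := (@eucl_ball R n.+1 rho).
Implicit Types (i j : 'I_n.+1) (psi : 'rV[R]_n.+1 -> R).
Variables (w : 'rV[R]_n.+1 -> R) (Ww : W110 Ball w).
Let g := grad Ball w.

(** The terms with the derivative of [al] carry the factor x_i x_j - x_j x_i and cancel. *)
Lemma test_radial_mul (al : R -> R) psi : smooth1 al -> test_function Ball psi ->
  test_function Ball (fun x => al (eucl_norm x ^+ 2) * psi x) /\
  forall i j x, rot i j (gradient (fun x => al (eucl_norm x ^+ 2) * psi x) x) x =
    rot i j (gradient psi x) x * al (eucl_norm x ^+ 2).
Proof.
move=> sal [sp cp sB].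
have NE : (fun x : 'rV[R]_n.+1 => al (eucl_norm x ^+ 2) * psi x) =
    (fun x => al (\sum_i x ord0 i ^+ 2) * psi x).
  by apply/funext => x; rewrite sqr_eucl_norm.
have sub : [set x | al (eucl_norm x ^+ 2) * psi x != 0] `<=` [set x | psi x != 0].
  by move=> x /=; apply: contra => /eqP ->; rewrite mulr0.
split.
  split.
  - by rewrite NE; apply/gen_smoothP/gen_smooth_mul; [apply: gen_smooth_comp => //; exact: gen_smooth_sumsq|exact: gen_smooth_smooth].
  - by apply: subclosed_compact cp _; [exact: closed_closure|exact: closureS].
  - by apply: subset_trans sB; exact: closureS.
move=> i j x; rewrite NE /rot !mxE.
have pE k : partial k (fun x : 'rV[R]_n.+1 => al (\sum_i x ord0 i ^+ 2) * psi x) x =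
    al (\sum_i x ord0 i ^+ 2) * partial k psi x +
    psi x * (derive1 al (\sum_i x ord0 i ^+ 2) * (2 * x ord0 k)).
  suff /partialE -> : forall y : 'rV[R]_n.+1, is_derive y (delta_mx ord0 k)
      (fun x : 'rV[R]_n.+1 => al (\sum_i x ord0 i ^+ 2) * psi x)
      (al (\sum_i y ord0 i ^+ 2) * partial k psi y +
       psi y * (derive1 al (\sum_i y ord0 i ^+ 2) * (2 * y ord0 k))) by [].
  move=> y; apply: is_deriveM; last exact: smooth_is_derive.
  exact: (is_derive_comp1 (smooth1_is_derive _ sal) (is_derive_sumsq y k)).
rewrite !pE sqr_eucl_norm; move: (derive1 al _) (al _) => u v; lra.
Qed.

Variables (K : R) (K0 : 0 < K) (i j : 'I_n.+1) (psi : 'rV[R]_n.+1 -> R).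
Hypothesis tp : test_function Ball psi.

(** The aim is that g1 dx on D1 and g2 dx dt on D2 have the same image under h1 and h2 in the plane
    of pairs (|x|^2, t). The plane is 'rV_2 so that open boxes serve as the pi-system. [w'] extends
    w by 0 to be measurable everywhere, and the window ]-K, K[ gives D2 finite measure. *)
Let w' : 'rV[R]_n.+1 -> R := w \_ Ball.
Let D1 : set 'rV[R]_n.+1 := Ball `&` w' @^-1` `]- K, K[.
Let D2 : set ('rV[R]_n.+1 * measurableTypeR R)%type := Ball `*` `]- K, K[.
Let g1 x : R := rot i j (g x) x * psi x.
Let g2 (p : 'rV[R]_n.+1 * measurableTypeR R) : R := - (rot i j (gradient psi p.1) p.1 * (p.2 < w' p.1)%R%:R).
Let pr2 (s t : R) : 'rV[R]_2 := \row_k (if k == ord0 then s else t).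
Let h1 x : 'rV[R]_2 := pr2 (eucl_norm x ^+ 2) (w' x).
Let h2 (p : 'rV[R]_n.+1 * measurableTypeR R) : 'rV[R]_2 := pr2 (eucl_norm p.1 ^+ 2) p.2.

Let mB : measurable Ball. Proof. exact: measurable_eucl_ball. Qed.

Let wE x : Ball x -> w' x = w x.
Proof. by move=> Bx; rewrite /w' /patch mem_set. Qed.

Let mw' : measurable_fun setT (w' : _ -> measurableTypeR R).
Proof.
apply/(measurable_restrictT _ mB); have [[iw _] _] := Ww.
by case/integrableP: iw => /measurable_EFinP.
Qed.

Let mD1 : measurable D1.
Proof. by apply: measurableI => //; rewrite -[X in measurable X]setTI; apply: mw' => //; exact: measurable_itv. Qed.

Let mD2 : measurable D2.
Proof. by apply: measurableX => //; exact: measurable_itv. Qed.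

Let mN2 : measurable_fun setT (fun x : 'rV[R]_n.+1 => eucl_norm x ^+ 2 : measurableTypeR R).
Proof. by apply: measurable_funX; exact: measurable_eucl_norm. Qed.

Let mh1 : measurable_fun setT h1.
Proof.
apply: measurable_fun_row => k; have [->|k0] := eqVneq k ord0.
  by rewrite (_ : (fun x => _) = (fun x : 'rV[R]_n.+1 => eucl_norm x ^+ 2))//; apply/funext => x; rewrite mxE.
rewrite (_ : (fun x => _) = w')//; apply/funext => x; rewrite mxE (negbTE k0)//.
Qed.

Let mh2 : measurable_fun setT h2.
Proof.
apply: measurable_fun_row => k; have [->|k0] := eqVneq k ord0.
  rewrite (_ : (fun x => _) = (fun x : 'rV[R]_n.+1 => eucl_norm x ^+ 2) \o fst).
    by apply: (measurableT_comp mN2); exact: measurable_fst.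
  by apply/funext => x; rewrite mxE.
rewrite (_ : (fun x => _) = snd); first exact: measurable_snd.
by apply/funext => x; rewrite mxE (negbTE k0).
Qed.

Let wg : weak_gradient Ball w g.
Proof. by have [[_ gw] _] := Ww; exact: getPex gw. Qed.

Let ig1B : lrow.-integrable Ball (EFin \o g1).
Proof.
have [C C0 pC] := test_bounded tp.
apply: (@integrable_mul_bounded R _ _ lrow Ball _ _ C mB) => //.
  by apply: integrable_rot => k; have [] := wg k.
exact: test_measurable tp.
Qed.

Let ig1 : lrow.-integrable D1 (EFin \o g1).
Proof. by apply: integrableS ig1B => // x []. Qed.

Let mlt : measurable_fun setT (fun p : 'rV[R]_n.+1 * measurableTypeR R => (p.2 < w' p.1)%R%:R : measurableTypeR R).
Proof.
pose S := (fun p : 'rV[R]_n.+1 * measurableTypeR R => w' p.1 - p.2) @^-1` `]0, +oo[%classic.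
rewrite (_ : (fun p => _) = \1_S).
  apply: measurable_indic; rewrite -[X in measurable X]setTI.
  apply: (measurable_funB (f := fun p : 'rV[R]_n.+1 * measurableTypeR R => w' p.1)) => //.
  by apply: (measurableT_comp mw').
apply/funext => p; rewrite indicE (_ : (p \in S) = (p.2 < w' p.1))//.
by apply/idP/idP; rewrite inE /S/= in_itv/= andbT subr_gt0.
Qed.

Let mrot : measurable_fun setT (fun p : 'rV[R]_n.+1 * measurableTypeR R =>
  rot i j (gradient psi p.1) p.1 : measurableTypeR R).
Proof.
have mr : measurable_fun setT ((fun x => rot i j (gradient psi x) x) : 'rV[R]_n.+1 -> measurableTypeR R).
  by apply: continuous_row_measurable; apply: gen_smooth_continuous; apply: gen_smooth_rot; case: tp.
by apply: (measurableT_comp mr); exact: measurable_fst.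
Qed.

Let D2_lty : ((lrow \x leb)%E D2 < +oo)%E.
Proof.
have mI : measurable (`]- K, K[%classic : set (measurableTypeR R)) by exact: measurable_itv.
have hI : (leb (`](- K)%R, K[%classic) < +oo)%E.
  by rewrite lebesgue_measure_itv/=; case: ifPn => // _; rewrite -EFinB ltry.
rewrite product_measure1E//.
rewrite lte_mul_pinfty//; first by rewrite ge0_fin_numE//; exact: lebesgue_row_ball_lty rho.
Qed.

Let ig2 : (lrow \x leb)%E.-integrable D2 (EFin \o g2).
Proof.
have [Ci Ci0 pCi] := test_partial_bounded i tp.
have [Cj Cj0 pCj] := test_partial_bounded j tp.
apply: (@le_integrable _ _ _ (lrow \x leb)%E D2 mD2 _ (fun=> (rho * (Cj + Ci))%:E)).
- apply/measurable_EFinP; apply: measurable_funTS; apply: measurableT_comp => //.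
  exact: measurable_funM.
- move=> p [Bp _]; rewrite /= lee_fin normrN normrM normr_nat.
  apply: (@le_trans _ _ (`|rot i j (gradient psi p.1) p.1| * 1)).
    by rewrite ler_wpM2l//; case: (_ < _).
  rewrite mulr1 [leRHS]ger0_norm; last by rewrite mulr_ge0 ?addr_ge0// ltW.
  rewrite /rot !mxE; apply: (le_trans (ler_normB _ _)); rewrite !normrM mulrDr.
  have px k : `|p.1 ord0 k| <= rho by apply: (le_trans (ler_coord_eucl_norm _ _)); exact: ltW.
  by apply: lerD; apply: ler_pM.
- apply/integrableP; split; first exact: measurable_cst.
  by rewrite integral_cst//=; exact: lte_mul_pinfty.
Qed.

Lemma obox2E (a b z : 'rV[R]_2) : obox a b z <->
  (a ord0 ord0 < z ord0 ord0 < b ord0 ord0) && (a ord0 ord_max < z ord0 ord_max < b ord0 ord_max).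
Proof.
split; first by move=> h; rewrite !h.
move=> /andP[h0 h1'] k; have [->//|k0] := eqVneq k ord0.
have -> : k = ord_max by apply/val_inj; case: k k0 => [[|[|]]].
by [].
Qed.

Let bump1 a b m (x : R) : `|bump a b m x| <= 1.
Proof. by rewrite ger0_norm ?bump_ge0// bump_le1. Qed.

Let mbump a b m : measurable_fun setT (bump a b m : R -> measurableTypeR R).
Proof. by apply: continuous_measurable_fun; exact: smooth1_continuous (gen_smooth1P (gen_smooth1_bump _ _ _)). Qed.

(** [sobolev_chain_rot] with b a bump and psi multiplied by a bump in |x|^2; then B(w(x)) is
    expanded by [bump_primitive], and Fubini turns the second term into an integral over pairs. *)
Lemma integral_rot_bump (a b c d : R) (m : nat) : - K <= c -> d <= K ->
  (\int[lrow]_(x in D1) (g1 x * (bump a b m (eucl_norm x ^+ 2) * bump c d m (w' x)))%:E =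
   \int[lrow \x leb]_(p in D2) (g2 p * (bump a b m (eucl_norm p.1 ^+ 2) * bump c d m p.2))%:E)%E.
Proof.
move=> Kc dK; have [B [sB dB B2 BE]] := bump_primitive m Kc dK K0.
have [tal rE] := test_radial_mul (gen_smooth1P (gen_smooth1_bump a b m)) tp.
have cb : continuous (bump c d m) by exact: smooth1_continuous (gen_smooth1P (gen_smooth1_bump _ _ _)).
have H := sobolev_chain_rot rho0 Ww i j sB dB cb (bump1 c d m) B2 tal.
have [C C0 alC] := test_bounded tal.
have mw : measurable_fun Ball (w : _ -> measurableTypeR R).
  by have [[/integrableP[/measurable_EFinP]]] := Ww.
have cB : continuous B by exact: smooth1_continuous.
have i1 : lrow.-integrable Ball (EFin \o (fun x =>
    rot i j (g x) x * (bump c d m (w x) * (bump a b m (eucl_norm x ^+ 2) * psi x)))).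
  apply: (@integrable_mul_bounded R _ _ lrow Ball _ _ (1 * C) mB).
  - by apply: integrable_rot => k; have [] := wg k.
  - apply: measurable_funM; last exact: test_measurable tal.
    by apply: (measurableT_comp (mbump c d m)).
  - by move=> x _; rewrite normrM ler_pM.
have i2 : lrow.-integrable Ball (EFin \o (fun x =>
    rot i j (gradient (fun x => bump a b m (eucl_norm x ^+ 2) * psi x) x) x * B (w x))).
  apply: (@integrable_mul_bounded R _ _ lrow Ball _ _ (2 * K) mB) => //.
  - exact: test_integrable_rot.
  - by apply: (measurableT_comp (continuous_measurable_fun cB)).
transitivity (\int[lrow]_(x in Ball)
    (rot i j (g x) x * (bump c d m (w x) * (bump a b m (eucl_norm x ^+ 2) * psi x)))%:E)%E.
  rewrite /D1 integral_mkcondr; apply: eq_integral => x /set_mem Bx; rewrite patchE.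
  case: ifPn; rewrite ?inE ?notin_setE /= wE// in_itv/= => hw; first by congr EFin; rewrite /g1; lra.
  rewrite (bump_out _ (a := c)) ?mul0r ?mulr0// => /andP[h1' h2'].
  by apply: hw; rewrite (le_lt_trans Kc h1') (lt_le_trans h2' dK).
transitivity (- (\int[lrow]_(x in Ball)
    (rot i j (gradient psi x) x * bump a b m (eucl_norm x ^+ 2) * B (w x))%:E))%E.
  have f1 := integrable_fin_num mB i1; have f2 := integrable_fin_num mB i2.
  move: H; rewrite /Rintegral => /eqP; rewrite addr_eq0 => /eqP H.
  rewrite -(fineK f1) /= H EFinN fineK//; congr (- _)%E.
  by apply: eq_integral => x _; rewrite rE.
have iF : (lrow \x leb)%E.-integrable D2
    (EFin \o (fun p => g2 p * (bump a b m (eucl_norm p.1 ^+ 2) * bump c d m p.2))).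
  apply: (@integrable_mul_bounded R _ _ (lrow \x leb)%E D2 _ _ (1 * 1)) => //.
    apply: measurable_funTS; apply: measurable_funM.
      by apply: (measurableT_comp (mbump a b m)); apply: (measurableT_comp mN2).
    by apply: (measurableT_comp (mbump c d m)).
  by move=> p _; rewrite normrM ler_pM.
rewrite [RHS]integral_mkcond -integral12_prod_meas1; last exact/(integrable_mkcond _ mD2).
have E2 : (fun x => rot i j (gradient (fun x => bump a b m (eucl_norm x ^+ 2) * psi x) x) x * B (w x)) =
    (fun x => rot i j (gradient psi x) x * bump a b m (eucl_norm x ^+ 2) * B (w x)).
  by apply/funext => x; rewrite rE.
rewrite E2 in i2; rewrite -integralN; last exact: integrable_add_def.
rewrite [LHS]integral_mkcond; apply: eq_integral => x _.
rewrite patchE /fubini_F; case: ifPn => [/set_mem Bx|]; last first.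
  rewrite notin_setE => Bx; apply/esym; apply: integral0_eq => t _.
  by rewrite patchE memNset// => -[].
transitivity (\int[leb]_(t in `](- K)%R, K[)
   ((- (rot i j (gradient psi x) x * bump a b m (eucl_norm x ^+ 2)))%:E * ((t < w' x)%R%:R * bump c d m t)%:E))%E.
  rewrite integralZl//; last first.
    have mI : measurable (`]- K, K[%classic : set (measurableTypeR R)) by exact: measurable_itv.
    apply: (@le_integrable _ _ _ leb _ mI _ (fun=> 1%E)).
    - apply/measurable_EFinP; apply: measurable_funTS; apply: measurable_funM; last exact: mbump.
      rewrite (_ : (fun t => _) = \1_(`]-oo, w' x[%classic)); first exact: measurable_indic.
      by apply/funext => t; rewrite indicE mem_setE in_itv.
    - move=> t _; rewrite /= lee_fin normrM normr_nat normr1.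
      by case: (_ < _); rewrite ?mul1r ?mul0r.
    - apply/integrableP; split => //; rewrite integral_cst//= normr1 mul1e lebesgue_measure_itv/=.
      by case: ifPn => // _; rewrite -EFinB ltry.
  by rewrite BE wE// -EFinM -EFinN mulNr.
rewrite [LHS]integral_mkcond; apply: eq_integral => t _; rewrite !patchE.
have -> : ((x, t) \in D2) = (t \in `]- K, K[%classic).
  by apply/idP/idP; rewrite !inE; [case|move=> ?; split].
by case: ifPn => // _; rewrite -EFinM; congr EFin; rewrite /g2 /=; lra.
Qed.

Lemma integral_rot_obox (a b : 'rV[R]_2) :
  (\int[lrow]_(x in D1 `&` h1 @^-1` obox a b) (g1 x)%:E =
   \int[lrow \x leb]_(p in D2 `&` h2 @^-1` obox a b) (g2 p)%:E)%E.
Proof.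
(* The box is cut to the window that the primitive requires, which changes nothing on D1 and D2. *)
pose c := Num.max (- K) (a ord0 ord_max); pose d := Num.min K (b ord0 ord_max).
have Kc : - K <= c by rewrite le_max lexx.
have dK : d <= K by rewrite ge_min lexx.
pose a0 := a ord0 ord0; pose b0 := b ord0 ord0.
have m01 (u v : bool) : u%:R * v%:R = (u && v)%:R :> R by rewrite -natrM mulnb.
have bd (m : nat) (s t : R) : `|bump a0 b0 m s * bump c d m t| <= 1.
  by rewrite -[leRHS]mulr1 normrM ler_pM.
have mlim (p q : R) : measurable_fun setT (fun s : measurableTypeR R => (p < s < q)%R%:R : measurableTypeR R).
  rewrite (_ : (fun _ => _) = \1_(`]p, q[%classic)); first exact: measurable_indic.
  by apply/funext => t; rewrite indicE mem_setE in_itv.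
have cvg1 : (\int[lrow]_(x in D1) (g1 x * (bump a0 b0 m (eucl_norm x ^+ 2) * bump c d m (w' x)))%:E
    @[m --> \oo] --> \int[lrow]_(x in D1) (g1 x * ((a0 < eucl_norm x ^+ 2 < b0)%R%:R * (c < w' x < d)%R%:R))%:E)%E.
  apply: (cvg_integral_mul_bounded (C := 1)) => //.
  - move=> m; apply: measurable_funTS; apply: measurable_funM.
      by apply: (measurableT_comp (mbump a0 b0 m)).
    by apply: (measurableT_comp (mbump c d m)).
  - apply: measurable_funTS; apply: measurable_funM; first by apply: (measurableT_comp (mlim a0 b0)).
    by apply: (measurableT_comp (mlim c d)).
  - by apply: nearW => x _; apply: cvgM; exact: cvg_bump.
have cvg2 : (\int[lrow \x leb]_(p in D2) (g2 p * (bump a0 b0 m (eucl_norm p.1 ^+ 2) * bump c d m p.2))%:E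
    @[m --> \oo] --> \int[lrow \x leb]_(p in D2) (g2 p * ((a0 < eucl_norm p.1 ^+ 2 < b0)%R%:R * (c < p.2 < d)%R%:R))%:E)%E.
  apply: (@cvg_integral_mul_bounded R _ _ (lrow \x leb)%E D2 g2 _ _ 1) => //.
  - move=> m; apply: measurable_funTS; apply: measurable_funM.
      by apply: (measurableT_comp (mbump a0 b0 m)); apply: (measurableT_comp mN2).
    by apply: (measurableT_comp (mbump c d m)).
  - apply: measurable_funTS; apply: measurable_funM.
      by apply: (measurableT_comp (mlim a0 b0)); apply: (measurableT_comp mN2).
    by apply: (measurableT_comp (mlim c d)).
  - by apply: nearW => x _; apply: cvgM; exact: cvg_bump.
have cdE (t : R) : - K < t < K -> (c < t < d) = (a ord0 ord_max < t < b ord0 ord_max).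
  by move=> /andP[h3 h4]; rewrite gt_max lt_min h3 h4.
transitivity (\int[lrow]_(x in D1) (g1 x * ((a0 < eucl_norm x ^+ 2 < b0)%R%:R * (c < w' x < d)%R%:R))%:E)%E.
  rewrite integral_mkcondr; apply: eq_integral => x /set_mem[Bx]; rewrite /= in_itv/= => wK.
  rewrite cdE// m01 patchE.
  have -> : (x \in h1 @^-1` obox a b) = (a0 < eucl_norm x ^+ 2 < b0) && (a ord0 ord_max < w' x < b ord0 ord_max).
    by apply/idP/idP; rewrite inE/= obox2E !mxE.
  by case: (_ && _); rewrite ?mulr1 ?mulr0.
transitivity (\int[lrow \x leb]_(p in D2) (g2 p * ((a0 < eucl_norm p.1 ^+ 2 < b0)%R%:R * (c < p.2 < d)%R%:R))%:E)%E; last first.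
  rewrite [RHS]integral_mkcondr; apply: eq_integral => p /set_mem[Bx]; rewrite /= in_itv/= => wK.
  rewrite cdE// m01 patchE.
  have -> : (p \in h2 @^-1` obox a b) = (a0 < eucl_norm p.1 ^+ 2 < b0) && (a ord0 ord_max < p.2 < b ord0 ord_max).
    by apply/idP/idP; rewrite inE/= obox2E !mxE.
  by case: (_ && _); rewrite ?mulr1 ?mulr0.
rewrite -(cvg_lim _ cvg1)// -(cvg_lim _ cvg2)//; congr (lim (_ @ \oo)).
by apply/funext => m; exact: integral_rot_bump.
Qed.

Lemma integral_rot_preimage (A : set 'rV[R]_2) : measurable A ->
  (\int[lrow]_(x in D1 `&` h1 @^-1` A) (g1 x)%:E =
   \int[lrow \x leb]_(p in D2 `&` h2 @^-1` A) (g2 p)%:E)%E.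
Proof.
apply: (dynkin_integral_eq (@measurable_oboxesE R 2) (@oboxes_setI R 2) mD1 ig1 mh1 mD2 ig2 mh2).
  (* Equality of the total masses: D1 and D2 lie in the preimages of the single box -1 < |x|^2 <
     rho^2, -K < t < K. *)
  have := integral_rot_obox (pr2 (-1) (- K)) (pr2 (rho ^+ 2) K).
  have Nb x : Ball x -> -1 < eucl_norm x ^+ 2 < rho ^+ 2.
    move=> Bx; rewrite ltr_pXn2r ?nnegrE ?eucl_norm_ge0 ?(ltW rho0)//.
    by rewrite (lt_le_trans _ (sqr_ge0 _))// andbT.
  rewrite (setIidl (B := h1 @^-1` _)); last first.
    by move=> x [Bx /=]; rewrite in_itv/= => wK; apply/obox2E; rewrite !mxE /= Nb.
  rewrite (setIidl (B := h2 @^-1` _))//.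
  by move=> p [Bx /=]; rewrite in_itv/= => wK; apply/obox2E; rewrite !mxE /= Nb.
by move=> _ [[a b] _ <-]; exact: integral_rot_obox.
Qed.

(** M is rewritten as a set A of pairs (|x|^2, t). For a.e. t the section of M is null, and
    [ae_radial] makes the set of x with norm in it null as well; so the preimage of A under [h2] is
    null, and the integral over pairs vanishes. *)
Lemma integral_rot_null (M : set (R * R)) : measurable (M : set (measurableTypeR R * measurableTypeR R)) ->
  (leb \x leb)%E M = 0%E ->
  (\int[lrow]_(x in Ball) (rot i j (g x) x *
     ((- K < w x < K) && `[< M (eucl_norm x, w x) >])%R%:R * psi x)%:E = 0)%E.
Proof.
move=> mM M0.
pose A : set 'rV[R]_2 := (fun z : 'rV[R]_2 => (Num.sqrt (z ord0 ord0), z ord0 ord_max)) @^-1` M.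
have mA : measurable A.
  rewrite -[X in measurable X]setTI; apply: (measurable_fun_pair (f := fun z : 'rV[R]_2 => Num.sqrt (z ord0 ord0))) => //.
    apply: (measurableT_comp (continuous_measurable_fun (@sqrt_continuous R))).
    exact: measurable_coord.
  exact: measurable_coord.
have A1 x : Ball x -> (x \in D1 `&` h1 @^-1` A) = (- K < w x < K) && `[< M (eucl_norm x, w x) >].
  move=> Bx; apply/idP/idP.
    rewrite inE => -[[_]]; rewrite /A /= in_itv/= !mxE/= sqrtr_sqr ger0_norm ?eucl_norm_ge0// wE// => -> h.
    exact/asboolP.
  move=> /andP[h1' /asboolP h2']; rewrite inE; split; first by split => //; rewrite /= in_itv/= wE.
  by rewrite /A /= !mxE/= sqrtr_sqr ger0_norm ?eucl_norm_ge0// wE.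
transitivity (\int[lrow]_(x in D1 `&` h1 @^-1` A) (g1 x)%:E)%E.
  rewrite [LHS]integral_mkcond [RHS]integral_mkcond; apply: eq_integral => x _; rewrite !patchE.
  case: ifPn => [/set_mem Bx|]; last by rewrite notin_setE => Bx; rewrite memNset// => -[[]].
  by rewrite A1//; case: (_ && _); rewrite /g1 ?mulr1// mulr0 mul0r.
rewrite integral_rot_preimage//; apply: null_set_integral.
- by apply: measurableI => //; rewrite -[X in measurable X]setTI; exact: mh2.
- have /integrableP[mg2 _] := ig2; exact: measurable_funS mg2.
- apply/null_ysection; first by apply: measurableI => //; rewrite -[X in measurable X]setTI; exact: mh2.
  have := (null_ysection _ _ mM).1 M0; apply: filterS => t /= ht.
  have : {ae leb, forall r : R, 0 < r -> r < rho -> ~ M (r, t)} by apply: filterS ht.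
  move=> /(@ae_radial R n rho); apply: filterS2 (@ae_neq0 R n) => x x0 hx.
  move=> [[Bx _]]; rewrite /A /= !mxE/= sqrtr_sqr ger0_norm ?eucl_norm_ge0//.
  apply: hx => //; rewrite lt_neqAle eucl_norm_ge0 andbT eq_sym.
  by apply: contra x0 => /eqP/eucl_norm_eq0 ->.
Qed.

End rot_level_sets.

Section rot_null.
Context {R : realType} (n : nat) (rho : R) (rho0 : 0 < rho).
Notation leb := (@lebesgue_measure R).
Notation lrow := (@lebesgue_row R n.+1).
Notation Ball := (@eucl_ball R n.+1 rho).
Variables (w : 'rV[R]_n.+1 -> R) (Ww : W110 Ball w).
Let g := grad Ball w.

(** [integral_rot_null] holds for all test functions, so the fundamental lemma applies at each
    truncation level |w| < k + 1; countably many levels cover all values of w. *)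
Lemma rot_null (M : set (R * R)) (i j : 'I_n.+1) :
  measurable (M : set (measurableTypeR R * measurableTypeR R)) -> (leb \x leb)%E M = 0%E ->
  {ae lrow, forall x, Ball x -> M (eucl_norm x, w x) -> rot i j (g x) x = 0}.
Proof.
move=> mM M0; have mB : measurable Ball by exact: measurable_eucl_ball.
have [[iw gw] _] := Ww; have wg : weak_gradient Ball w g := getPex gw.
have irot : lrow.-integrable Ball (EFin \o (fun x => rot i j (g x) x)).
  by apply: integrable_rot => k; have [] := wg k.
have mw : measurable_fun Ball (w : _ -> measurableTypeR R).
  by case/integrableP: iw => /measurable_EFinP.
have H : {ae lrow, forall x, forall k : nat, Ball x ->
    rot i j (g x) x * ((- k.+1%:R < w x < k.+1%:R) && `[< M (eucl_norm x, w x) >])%R%:R = 0}.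
  apply: ae_foralln => k.
  apply: fundamental_lemma; first exact: open_eucl_ball; last first.
    by move=> psi tp; apply: (integral_rot_null rho0 Ww _ i j tp mM M0).
  apply: (@integrable_mul_bounded R _ _ lrow Ball _ _ 1) => //; last first.
    by move=> x _; case: (_ && _); rewrite ?normr1 ?normr0.
  pose S : set (measurableTypeR R * measurableTypeR R) := M `&` (setT `*` `]- k.+1%:R, k.+1%:R[).
  apply: (eq_measurable_fun ((\1_S : measurableTypeR R * measurableTypeR R -> measurableTypeR R) \o (fun x => (eucl_norm x, (w \_ Ball) x)))).
    move=> x xB; rewrite /= patchE xB indicE; congr (nat_of_bool _)%:R.
    apply/idP/idP; rewrite inE /S/= in_itv/=.
      by move=> [h1 [_ ->]]; apply/asboolP.
    by move=> /andP[h1 /asboolP h2].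
  apply: measurable_funTS; apply: measurableT_comp.
    by apply: measurable_indic; apply: measurableI => //; apply: measurableX => //; exact: measurable_itv.
  apply: (measurable_fun_pair (f := @eucl_norm R n.+1 : _ -> measurableTypeR R)); first exact: measurable_eucl_norm.
  exact/(measurable_restrictT _ mB).
apply: filterS H => x hx Bx Mx.
have := hx (Num.truncn `|w x|) Bx; rewrite -ltr_norml truncnS_gt/=.
by rewrite (asboolT Mx) mulr1.
Qed.

Lemma ae_nondecreasing_rot (f : R -> R -> R -> \bar R) : ae_nondecreasing rho f ->
  {ae lrow, forall x, Ball x ->
    (f (eucl_norm x) (w x) `|\sum_i dir x ord0 i * g x ord0 i|%R <=
     f (eucl_norm x) (w x) (eucl_norm (g x)))%E}.
Proof.
move=> [N [mN N0 fN]].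
have : {ae lrow, forall x, forall i j, Ball x -> N (eucl_norm x, w x) -> rot i j (g x) x = 0}.
  apply: filter_forall => i; apply: filter_forall => j; exact: rot_null.
apply: filterS2 (@ae_neq0 R n) => x x0 hx Bx.
have Nx0 : eucl_norm x != 0 by apply: contra x0 => /eqP/eucl_norm_eq0 ->.
have d1 : eucl_norm (dir x) = 1.
  by rewrite /dir eucl_normZ normfV ger0_norm ?eucl_norm_ge0// mulVf.
have [Nx|nNx] := pselect (N (eucl_norm x, w x)).
  rewrite -(lagrange_rot0 (g := g x) (x := dir x))// => i j.
  by rewrite /rot /dir !mxE -!mulrA -mulrBr -/(rot i j (g x) x) hx// mulr0.
suff fle : forall s s' : R, 0 <= s -> s <= s' ->
    (f (eucl_norm x) (w x) s <= f (eucl_norm x) (w x) s')%E.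
  by apply: fle => //; exact: cauchy_schwarz.
apply: contrapT => h; apply: nNx; apply: fN => /= h'; apply: h; apply: h'.
by rewrite in_itv/= eucl_norm_ge0 ltW.
Qed.

End rot_null.

(** * Restrictions to rays *)

Section Wrad_limit.
Context {R : realType} (n : nat) (rho : R).
Notation leb := (@lebesgue_measure R).
Notation I := (`]0, rho[%classic : set (measurableTypeR R)).

(** On ]r, rho[ the weight is at least r^n, so psi_k(r), which is minus the integral of its
    derivative over ]r, rho[, converges for every r to the same expression in h. This limit v is
    locally absolutely continuous and agrees a.e. with W. *)
Lemma Wrad_limit (psi dpsi : nat -> R -> R) (h W : R -> R) :
  (forall k (s : R), is_derive s 1 (psi k) (dpsi k s)) -> (forall k, continuous (dpsi k)) ->
  (forall k, psi k rho = 0) -> measurable_fun I h ->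
  (\int[leb]_(s in I) (s ^+ n * `|h s|)%:E < +oo)%E ->
  (\int[leb]_(s in I) (s ^+ n * `|h s - dpsi k s|)%:E)%E @[k --> \oo] --> 0%E ->
  {ae leb, forall s : R, 0 < s -> s < rho -> psi k s @[k --> \oo] --> W s} ->
  exists2 v : R -> R, Wrad n.+1 rho v &
    {ae leb, forall s : R, 0 < s -> s < rho -> v s = W s /\ derive1 v s = h s}.
Proof.
move=> dpsi_ cdpsi psi0 mh hoo hcvg psiW.
have mI : measurable I by exact: measurable_itv.
have mX : measurable_fun I (fun s : R => s ^+ n : measurableTypeR R).
  by apply: measurable_funTS; apply: continuous_measurable_fun; exact: exprn_continuous.
have mdpsi k : measurable_fun I (dpsi k : _ -> measurableTypeR R).
  by apply: measurable_funTS; apply: continuous_measurable_fun; exact: cdpsi.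
have weight (F : R -> R) (a : R) : 0 < a -> measurable_fun I F ->
    (\int[leb]_(s in `]a, rho[) `|F s|%:E <= (a ^- n)%:E * \int[leb]_(s in I) (s ^+ n * `|F s|)%:E)%E.
  move=> a0 mF; have an0 : 0 < a ^+ n by rewrite exprn_gt0.
  rewrite -ge0_integralZl_EFin//; last 3 first.
  - move=> s; rewrite /= in_itv/= => /andP[s0 _].
    by rewrite lee_fin mulr_ge0// exprn_ge0// ltW.
  - apply/measurable_EFinP; apply: measurable_funM => //.
    by apply: measurableT_comp.
  - by rewrite invr_ge0 ltW.
  apply: (@le_trans _ _ (\int[leb]_(s in `]a, rho[) ((a ^- n)%:E * (s ^+ n * `|F s|)%:E))%E).
    apply: le_integralT => s; rewrite /= in_itv/= => /andP[as_ sr].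
    rewrite -EFinM lee_fin mulrA ler_peMl// mulrC ler_pdivlMr// mul1r lerXn2r ?nnegrE ?ltW//.
    exact: lt_trans as_.
  apply: le_integral_sub.
    by move=> s; rewrite /= !in_itv/= => /andP[as_ ->]; rewrite (lt_trans a0).
  move=> s; rewrite /= in_itv/= => /andP[s0 _].
  by rewrite -EFinM lee_fin !mulr_ge0// ?exprn_ge0 ?invr_ge0 ?exprn_ge0 ?(ltW a0)// ltW.
have sub a : 0 < a -> `]a, rho[%classic `<=` (I : set R).
  by move=> a0 s; rewrite /= !in_itv/= => /andP[as_ ->]; rewrite (lt_trans a0).
have ma a : measurable (`]a, rho[%classic : set (measurableTypeR R)) by exact: measurable_itv.
have ih a : 0 < a -> leb.-integrable `]a, rho[ (EFin \o h).
  move=> a0; apply/integrableP; split.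
    by apply/measurable_EFinP; apply: measurable_funS mh => //; exact: sub.
  apply: (le_lt_trans (weight h a a0 mh)).
  by rewrite lte_mul_pinfty ?lee_fin ?invr_ge0 ?exprn_ge0 ?(ltW a0).
pose v r := - \int[leb]_(t in `]r, rho[) h t.
have [acv dv] := primitive_AC ih (fun r _ _ => erefl (v r)).
have mdv : measurable_fun I (derive1 v : R -> measurableTypeR R) by exact: AC_loc_measurable_derive1.
have mabs (F : R -> R) : measurable_fun I F -> measurable_fun I (fun s : R => (s ^+ n * `|F s|)%:E).
  move=> mF; apply/measurable_EFinP; apply: measurable_funM => //.
  by apply: measurableT_comp.
have vWrad : Wrad n.+1 rho v.
  split => //.
    by rewrite /v set_itv_ge ?bnd_simp// Rintegral_set0 oppr0.
  apply: (@ae_eq_integrable _ _ _ leb I (fun s => (s ^+ n * `|h s|)%:E)) => //.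
  - exact: mabs.
  - apply/integrableP; split; first exact: mabs.
    apply: le_lt_trans hoo; apply: le_integralT => s; rewrite /= in_itv/= => /andP[s0 _].
    by rewrite ger0_norm// mulr_ge0// exprn_ge0// ltW.
  - move: dv; apply: filterS; first exact: (ae_filter_ringOfSetsType leb).
    by move=> s hs; rewrite /= in_itv/= => /andP[s0 sr]; rewrite hs.
exists v => //.
have psi_v r : 0 < r -> r < rho -> psi k r @[k --> \oo] --> v r.
  move=> r0 rr.
  have bnd k : (`|v r - psi k r|%:E <= (r ^- n)%:E *
      \int[leb]_(s in I) (s ^+ n * `|h s - dpsi k s|)%:E)%E.
    have mhd : measurable_fun I (fun s => h s - dpsi k s) by exact: (measurable_funB mh (mdpsi k)).
    apply: le_trans (weight _ _ r0 mhd).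
    have idp : leb.-integrable `]r, rho[ (EFin \o dpsi k).
      apply: (@integrableS _ _ _ leb (`[r, rho]%classic : set (measurableTypeR R))) => //.
        by move=> s; rewrite /= !in_itv/= => /andP[/ltW -> /ltW ->].
      by apply: continuous_compact_integrable; [exact: segment_compact|exact: continuous_subspaceT].
    have -> : v r - psi k r = - \int[leb]_(s in `]r, rho[) (h s - dpsi k s).
      rewrite RintegralB//; last exact: ih.
      by rewrite (Rintegral_derive (dpsi_ k) (cdpsi k) (ltW rr)) psi0 /v sub0r opprD opprK.
    rewrite normrN; apply: le_trans (_ : ((\int[leb]_(s in `]r, rho[) `|h s - dpsi k s|)%R%:E <= _)%E).
      rewrite lee_fin; apply: le_normr_Rintegral => //.
      by apply: integrable_subr => //; exact: ih.
    rewrite /Rintegral fineK//; apply: integrable_fin_num => //.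
    by apply: integrable_norm; apply: integrable_subr => //; exact: ih.
  have c0 : ((r ^- n)%:E * \int[leb]_(s in I) (s ^+ n * `|h s - dpsi k s|)%:E)%E @[k --> \oo] --> 0%E.
    by rewrite -[X in _ --> X](mule0 (r ^- n)%:E); apply: cvgeZl.
  have : `|v r - psi k r|%:E @[k --> \oo] --> 0%E.
    apply: (@squeeze_cvge _ _ _ _ (cst 0%E) _ _ _ _ _ c0); last exact: cvg_cst.
    by apply: nearW => k; rewrite bnd lee_fin normr_ge0.
  move=> /fine_cvgP[_ /cvgrPdist_lt H]; apply/cvgrPdist_lt => e e0.
  by have := H _ e0; apply: filterS => k /=; rewrite sub0r normrN normr_id.
move: dv psiW; apply: filterS2; first exact: (ae_filter_ringOfSetsType leb).
move=> s ds Ws s0 sr; split; last exact: ds.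
have := psi_v s s0 sr; have := Ws s0 sr => h1 h2.
exact: (cvg_unique (@Rhausdorff R) h2 h1).
Qed.

End Wrad_limit.

Lemma eucl_norm_le_sum (R : realType) (n : nat) (x : 'rV[R]_n) : eucl_norm x <= \sum_i `|x ord0 i|.
Proof.
rewrite -(@ler_pXn2r _ 2) ?nnegrE ?eucl_norm_ge0 ?sumr_ge0// sqr_eucl_norm expr2 mulr_suml.
apply: ler_sum => i _; rewrite -real_normK ?num_real// expr2 ler_wpM2l//.
by rewrite (bigD1 i)//= lerDl sumr_ge0.
Qed.

Section rays.
Context {R : realType} (n : nat) (rho : R) (rho0 : 0 < rho).
Notation leb := (@lebesgue_measure R).
Notation lrow := (@lebesgue_row R n.+1).
Notation Ball := (@eucl_ball R n.+1 rho).
Notation A := (@annulus R n).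

Lemma measurable_ray_at (y : 'rV[R]_n.+1) :
  measurable_fun setT (fun s : measurableTypeR R => s *: dir y : 'rV[R]_n.+1).
Proof.
apply: (measurableT_comp (@measurable_ray R n) (g := fun s => (y, s))).
exact: measurable_fun_pair.
Qed.

Lemma measurable_ray_integral (G : 'rV[R]_n.+1 -> \bar R) : measurable_fun setT G ->
  (forall x, 0 <= G x)%E ->
  measurable_fun setT (fun y => \int[leb]_(s in `]0%R, +oo[) ((s ^+ n)%:E * G (s *: dir y)%R))%E.
Proof.
move=> mG G0.
pose F (p : 'rV[R]_n.+1 * measurableTypeR R) : \bar R :=
  ((\1_(`]0, +oo[%classic) p.2 * `|p.2| ^+ n)%:E * G (p.2 *: dir p.1)%R)%E.
rewrite (_ : (fun y => _) = fubini_F leb F).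
  apply: measurable_fun_fubini_tonelli_F.
    apply: emeasurable_funM; last by apply: (measurableT_comp mG); exact: measurable_ray.
    apply/measurable_EFinP; apply: measurable_funM.
      apply: (measurableT_comp (f := \1_(`]0, +oo[%classic) : measurableTypeR R -> measurableTypeR R)).
        by apply: measurable_indic; exact: measurable_itv.
      exact: measurable_snd.
    by apply: measurable_funX; apply: measurableT_comp.
  by move=> p; rewrite mule_ge0// lee_fin mulr_ge0// exprn_ge0.
apply/funext => y; rewrite /fubini_F [LHS]integral_mkcond; apply: (@eq_integral _ _ _ leb) => s _.
rewrite patchE mem_setE in_itv/= andbT /F/= indicE mem_setE in_itv/= andbT.
by case: ifPn => s0; rewrite ?mul0r ?mul0e// mul1r gtr0_norm.
Qed.

Definition ray_integral (H : 'rV[R]_n.+1 -> \bar R) (y : 'rV[R]_n.+1) : \bar R :=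
  (\int[leb]_(s in `]0%R, rho[) ((s ^+ n)%:E * H (s *: dir y)%R))%E.

Lemma ray_integral_ge0 (H : 'rV[R]_n.+1 -> \bar R) y : (forall x, 0 <= H x)%E ->
  (0 <= ray_integral H y)%E.
Proof.
move=> H0; apply: integral_ge0 => s; rewrite /= in_itv/= => /andP[s0 _].
by rewrite mule_ge0// lee_fin exprn_ge0// ltW.
Qed.

Lemma ray_integral_polar (H : 'rV[R]_n.+1 -> \bar R) : measurable_fun Ball H ->
  (forall x, 0 <= H x)%E -> measurable_fun A (ray_integral H) /\
  (\int[lrow]_(y in A) ray_integral H y = polar_cst n * \int[lrow]_(x in Ball) H x)%E.
Proof.
move=> mH H0; have mB : measurable Ball by exact: measurable_eucl_ball.
have mH' : measurable_fun setT (H \_ Ball) by apply/(measurable_restrictT _ mB).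
have H'0 x : (0 <= (H \_ Ball) x)%E by rewrite patchE; case: ifP.
pose J y := (\int[leb]_(s in `]0%R, +oo[) ((s ^+ n)%:E * (H \_ Ball) (s *: dir y)%R))%E.
have JE y : A y -> J y = ray_integral H y.
  move=> Ay; rewrite /J integral_mkcond [RHS]integral_mkcond.
  apply: (@eq_integral _ _ _ leb) => s _; rewrite !patchE.
  rewrite (_ : (s \in _) = (0 < s)); last by rewrite mem_setE in_itv/= andbT.
  rewrite [in RHS](_ : (s \in _) = (0 < s < rho)); last by rewrite mem_setE in_itv.
  case: ifPn => // s0; rewrite andTb.
  have sB : (s *: dir y \in Ball) = (s < rho).
    by apply/idP/idP; rewrite inE /eucl_ball/= eucl_norm_ray.
  by rewrite sB; case: ifPn; rewrite ?mule0.
split.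
  apply: (eq_measurable_fun J) => [y /set_mem/JE//|].
  by apply: measurable_funTS; exact: measurable_ray_integral.
rewrite [in RHS]integral_mkcond polar//; apply: eq_integral => y /set_mem Ay.
by rewrite -JE.
Qed.

(** [polar] for the indicator function of a null set: almost all its ray integrals vanish, and the
    weight s^n is positive for s > 0. *)
Lemma ae_polar (P : 'rV[R]_n.+1 -> Prop) : {ae lrow, forall x, Ball x -> P x} ->
  {ae lrow, forall y, A y -> {ae leb, forall s : R, 0 < s -> s < rho -> P (s *: dir y)}}.
Proof.
move=> [N [mN N0 PN]].
have mG : measurable_fun setT (fun x => (\1_N x : R)%:E).
  by apply/measurable_EFinP; exact: measurable_indic.
have G0 x : (0 <= (\1_N x : R)%:E)%E by rewrite lee_fin.
have mA := @measurable_annulus R n.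
have := polar mG G0; rewrite integral_indic// setIT.
have -> : (polar_cst n * lrow N = 0 :> \bar R)%E by rewrite [X in (_ * X)%E](_ : _ = 0%E) ?mule0.
move=> /esym/(ge0_integral_eq0_ae mA (measurable_funTS (measurable_ray_integral mG G0))) H.
have i0 y : A y -> (0 <= \int[leb]_(s in `]0%R, +oo[) ((s ^+ n)%:E * (\1_N (s *: dir y)%R : R)%:E))%E.
  move=> _; apply: integral_ge0 => s; rewrite /= in_itv/= andbT => s0.
  by rewrite mule_ge0// lee_fin exprn_ge0// ltW.
have {}H := H i0; apply: filterS H => y hy Ay.
have mI : measurable (`]0, +oo[%classic : set (measurableTypeR R)) by exact: measurable_itv.
have mr : measurable_fun (`]0, +oo[%classic : set (measurableTypeR R)) (fun s : measurableTypeR R => ((s ^+ n)%:E * (\1_N (s *: dir y)%R : R)%:E)%E).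
  apply: measurable_funTS; apply: emeasurable_funM.
    by apply/measurable_EFinP; by apply: measurable_funX.
  by apply: (measurableT_comp mG); exact: measurable_ray_at.
have s0' (s : R) : `]0, +oo[%classic s -> (0 <= (s ^+ n)%:E * (\1_N (s *: dir y)%R : R)%:E)%E.
  by rewrite /= in_itv/= andbT => s0; rewrite mule_ge0// lee_fin exprn_ge0// ltW.
have := ge0_integral_eq0_ae mI mr s0' (hy Ay).
apply: filterS => s hs s0 sr; apply: contrapT => nP.
have Ns : N (s *: dir y).
  by apply: PN => /= h; apply: nP; apply: h; rewrite /eucl_ball/= eucl_norm_ray.
move: hs; rewrite /= in_itv/= andbT => /(_ s0).
rewrite indicE mem_set// mule1 => -[]/eqP; rewrite expf_eq0 => /andP[_ /eqP s00].
by rewrite s00 ltxx in s0.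
Qed.

(** By [polar], the ray integrals of |g - grad phi_k| have summable integrals over the annulus,
    hence tend to 0 for a.e. y. On such a ray [Wrad_limit] applies to the restrictions of the phi_k,
    whose derivatives are the radial components of the gradients. *)
Lemma ray_Wrad (w : 'rV[R]_n.+1 -> R) : W110 Ball w ->
  {ae lrow, forall y, A y -> exists2 v : R -> R, Wrad n.+1 rho v &
    {ae leb, forall s : R, 0 < s -> s < rho -> v s = w (s *: dir y) /\
      derive1 v s = \sum_i dir y ord0 i * grad Ball w (s *: dir y) ord0 i}}.
Proof.
move=> Ww; have oB : open Ball by exact: open_eucl_ball.
have mB : measurable Ball by exact: measurable_eucl_ball.
have [phi_ [tphi phiE phi_cvg]] := W110_elim_ae oB Ww.
have [[iw gw] _] := Ww; have wg : weak_gradient Ball w (grad Ball w) := getPex gw.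
set g := grad Ball w in wg phiE *.
have mw : measurable_fun Ball w by case/integrableP: iw => /measurable_EFinP.
have mg i : measurable_fun Ball (fun x => g x ord0 i).
  by have [/integrableP[/measurable_EFinP]] := wg i.
pose E k (x : 'rV[R]_n.+1) := eucl_norm (g x - gradient (phi_ k) x).
have mE k : measurable_fun Ball (E k).
  apply: measurable_eucl_norm_row => i.
  rewrite (_ : (fun x => _) = (fun x => g x ord0 i - partial i (phi_ k) x)).
    by apply: measurable_funB => //; exact: test_partial_measurable (tphi k).
  by apply/funext => x; rewrite !mxE.
have mgn : measurable_fun Ball (fun x => eucl_norm (g x)) by exact: measurable_eucl_norm_row.
pose J (F : 'rV[R]_n.+1 -> R) := ray_integral (EFin \o F).
have J_polar (F : 'rV[R]_n.+1 -> R) : measurable_fun Ball F -> (forall x, 0 <= F x) ->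
    [/\ measurable_fun A (J F), forall y, (0 <= J F y)%E &
    (\int[lrow]_(y in A) J F y = polar_cst n * \int[lrow]_(x in Ball) (F x)%:E)%E].
  move=> mF F0; have F0' x : (0 <= (EFin \o F) x)%E by rewrite lee_fin.
  have [] := @ray_integral_polar (EFin \o F); [exact/measurable_EFinP|by []|].
  by split => // y; exact: ray_integral_ge0.
have mA := @measurable_annulus R n.
have E0 k x : 0 <= E k x by exact: eucl_norm_ge0.
have C0 := @polar_cst_gt0 R n; have Cfin := @polar_cst_fin R n.
have aeJ : {ae lrow, forall y, A y -> (J (fun x => eucl_norm (g x)) y < +oo)%E}.
  have [mJ J0 JE] := J_polar _ mgn (fun x => eucl_norm_ge0 (g x)).
  have iJ : lrow.-integrable A (J (fun x => eucl_norm (g x))).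
    apply/integrableP; split => //.
    rewrite (_ : (fun y => _) = J (fun x => eucl_norm (g x))); last first.
      by apply/funext => y; rewrite gee0_abs.
    rewrite JE lte_mul_pinfty//; first exact: ltW.
    apply: (@le_lt_trans _ _ (\sum_(i < n.+1) \int[lrow]_(x in Ball) `|g x ord0 i|%:E)%E).
      rewrite -ge0_integral_sum//; last first.
        by move=> i; apply/measurable_EFinP; exact: measurableT_comp.
      apply: le_integralT => x _; rewrite sumEFin lee_fin.
      exact: eucl_norm_le_sum.
    rewrite lte_sum_pinfty// => i _.
    by have [/integrableP[]] := wg i.
  by move: (integrable_ae mA iJ); apply: filterS => y h Ay; rewrite -ge0_fin_numE// h.
have aeE : {ae lrow, forall y, A y -> J (E k) y @[k --> \oo] --> 0%E}.
  (* Dividing by the polar constant makes the integrals at most 2^-k, the form in which [ae_cvg0]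
     applies. *)
  have : {ae lrow, forall y, A y -> ((fine (polar_cst n))^-1%:E * J (E k) y)%E @[k --> \oo] --> (0 : \bar R)%E}.
    have c0 : 0 < fine (polar_cst n : \bar R) by rewrite fine_gt0// C0 ltey_eq Cfin.
    apply: ae_cvg0 => //.
    - move=> k; apply: emeasurable_funM => //.
      by have [] := J_polar _ (mE k) (E0 k).
    - move=> k y _; rewrite mule_ge0 ?lee_fin ?invr_ge0 ?(ltW c0)//.
      by have [] := J_polar _ (mE k) (E0 k).
    - move=> k; have [mJ J0 JE] := J_polar _ (mE k) (E0 k).
      rewrite ge0_integralZl_EFin//; last by rewrite invr_ge0 ltW.
      rewrite JE muleA -[X in (_ * X * _)%E]fineK// -EFinM mulVf ?gt_eqF// mul1e.
      by apply: le_trans (phiE k); rewrite leeDr// integral_ge0.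
  apply: filterS => y hy Ay.
  have c0 : 0 < fine (polar_cst n : \bar R) by rewrite fine_gt0// C0 ltey_eq Cfin.
  have -> : (fun k => J (E k) y) = (fun k => (fine (polar_cst n))%:E * ((fine (polar_cst n))^-1%:E * J (E k) y))%E.
    by apply/funext => k; rewrite muleA -EFinM divff ?gt_eqF// mul1e.
  by rewrite -[X in _ --> X](mule0 (fine (polar_cst n))%:E); apply: cvgeZl => //; exact: hy.
apply: filterS3 aeJ aeE (ae_polar phi_cvg) => y Jy Ey Py Ay.
have d1 := eucl_norm_dir Ay.
have sp k : smooth (phi_ k) by have [] := tphi k.
have mI : measurable (`]0, rho[%classic : set (measurableTypeR R)) by exact: measurable_itv.
apply: (Wrad_limit (n := n) (psi := fun k s => phi_ k (s *: dir y))
  (dpsi := fun k s => \sum_i dir y ord0 i * partial i (phi_ k) (s *: dir y))).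
- move=> k s; have := smooth_is_derive_dir (s *: dir y) (dir y) (sp k).
  by rewrite -{1}[s *: _]add0r is_derive_line; under eq_fun do rewrite add0r.
- move=> k s; apply: (@continuous_comp _ _ _ (fun s : R => s *: dir y)
    (fun x => \sum_i dir y ord0 i * partial i (phi_ k) x)).
    exact: scalel_continuous.
  apply: continuous_row_sum => i; apply: gen_smooth_continuous; apply: gen_smooth_mul; first exact: gen_smooth_cst.
  exact/gen_smooth_smooth/smooth_partial.
- move=> k; apply: (test_out (tphi k)); rewrite /eucl_ball/=.
  by rewrite (eucl_norm_ray Ay rho0) ltxx.
- apply: measurable_sum => i; apply: measurable_funM; first exact: measurable_cst.
  apply: (eq_measurable_fun (((fun x => g x ord0 i) \_ Ball) \o (fun s => s *: dir y))).
    move=> s; rewrite inE/= in_itv/= => /andP[s0 sr].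
    by rewrite patchE mem_set// /eucl_ball/= eucl_norm_ray.
  apply: measurable_funTS; apply: measurableT_comp; last exact: measurable_ray_at.
  by apply/(measurable_restrictT _ mB); exact: mg.
- apply: le_lt_trans (Jy Ay); apply: le_integralT => s; rewrite /= in_itv/= => /andP[s0 _].
  by rewrite lee_fin ler_wpM2l ?exprn_ge0 ?(ltW s0)// cauchy_schwarz.
- have := Ey Ay; apply: squeeze_cvge; [|exact: cvg_cst].
  apply: nearW => k; rewrite integral_ge0/=; last first.
    by move=> s; rewrite /= in_itv/= => /andP[s0 _]; rewrite lee_fin mulr_ge0 ?exprn_ge0 ?(ltW s0).
  apply: le_integralT => s; rewrite /= in_itv/= => /andP[s0 _].
  rewrite lee_fin ler_wpM2l ?exprn_ge0 ?(ltW s0)//.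
  apply: le_trans (cauchy_schwarz (g (s *: dir y) - gradient (phi_ k) (s *: dir y)) d1).
  rewrite -sumrB le_eqVlt; apply/orP; left; apply/eqP; congr `|_|; apply: eq_bigr => i _.
  by rewrite !mxE mulrBr.
- move: (Py Ay); apply: filterS; first exact: (ae_filter_ringOfSetsType leb).
  by move=> s hs s0 sr; exact: hs.
Qed.

End rays.

(** * Comparison of the two functionals *)

(** Otherwise F would exceed its mean at a.e. point of D, and F minus its mean would be a.e.
    positive with integral 0. Keeping P in the conclusion selects a point that also has the a.e.
    properties. *)
Lemma ae_le_mean d (T : measurableType d) (R : realType) (mu : {measure set T -> \bar R})
    (D : set T) (F : T -> \bar R) (P : T -> Prop) :
  measurable D -> (0 < mu D)%E -> mu D \is a fin_num -> mu.-integrable D F ->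
  {ae mu, forall x, D x -> P x} ->
  exists x, [/\ D x, P x & (mu D * F x <= \int[mu]_(y in D) F y)%E].
Proof.
move=> mD D0 Dfin iF aeP; apply: contrapT => /forallNP H.
have c0 : 0 < fine (mu D) by rewrite fine_gt0// D0 ltey_eq Dfin.
have Ffin : (\int[mu]_(y in D) F y)%E \is a fin_num by exact: integrable_fin_num.
pose m := fine (\int[mu]_(y in D) F y)%E / fine (mu D).
pose G x := (F x - m%:E)%E.
have im : mu.-integrable D (cst m%:E).
  apply/integrableP; split; first exact: measurable_cst.
  apply: (@le_lt_trans _ _ (`|m|%:E * mu D)%E).
    by rewrite -(integral_cst mu mD)//; apply: le_integralT.
  by rewrite -[mu D]fineK// -EFinM ltry.
have iG : mu.-integrable D G by exact: integrableB.
have G0 : (\int[mu]_(x in D) G x = 0)%E.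
  rewrite integralB//; transitivity (\int[mu]_(x in D) F x - m%:E * mu D)%E.
    by congr (_ - _)%E; exact: integral_cst.
  rewrite -[mu D]fineK// -EFinM /m divfK ?gt_eqF// fineK//.
  by rewrite subee.
have aeG : {ae mu, forall x, D x -> (0 < G x)%E}.
  apply: filterS aeP => x Px Dx; rewrite /G sube_gt0.
  have := H x; apply: contra_notT; rewrite -leNgt => Fm; split => //; first exact: Px.
  rewrite -[mu D]fineK//; apply: (le_trans (lee_wpmul2l _ Fm)); first by rewrite lee_fin ltW.
  by rewrite -EFinM /m mulrC divfK ?gt_eqF// fineK.
have Gp0 : (\int[mu]_(x in D) funepos G x = 0)%E.
  rewrite -[RHS]G0; apply: ae_eq_integralT; apply: filterS aeG => x Gx Dx.
  by rewrite funeposE max_l// ltW// Gx.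
have mGp : measurable_fun D (funepos G).
  by apply: measurable_funepos; have /integrableP[] := iG.
have [N [mN N0 GN]] := ge0_integral_eq0_ae mD mGp (fun x _ => funepos_ge0 G x) Gp0.
have [M [mM M0 GM]] := aeG.
suff DNM : D `<=` N `|` M.
  have := le_measure mu (mem_set mD) (mem_set (measurableU _ _ mN mM)) DNM.
  move=> /le_trans/(_ (measureU2 _ mN mM)).
  by move: N0 M0 D0 => /= -> ->; rewrite adde0 leNgt => ->.
move=> x Dx; apply: contrapT => /not_orP[Nx Mx].
have Gx : (0 < G x)%E by apply: contrapT => h; apply: Mx; apply: GM => /=; apply: contra_not h; apply.
apply: Nx; apply: GN => /= /(_ Dx); rewrite funeposE max_l ?ltW// => Gx0.
by rewrite Gx0 ltxx in Gx.
Qed.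

(** [uncurry3 f] is measurable on [integrand_domain] only: a, b and c are extended by 0 off D to
    form a measurable triple, which maps D into that domain. *)
Lemma measurable_integrand (R : realType) d (T : measurableType d) (D : set T) (rho : R)
    (f : R -> R -> R -> \bar R) (a b c : T -> R) : measurable D ->
  measurable_fun (integrand_domain rho) (uncurry3 f) ->
  measurable_fun D a -> measurable_fun D b -> measurable_fun D c ->
  (forall x, D x -> 0 <= a x <= rho) -> (forall x, D x -> 0 <= c x) ->
  measurable_fun D (fun x => f (a x) (b x) (c x)).
Proof.
move=> mD mf ma mb mc a0 c0.
have mr (q : T -> R) : measurable_fun D q -> measurable_fun setT (q \_ D : T -> measurableTypeR R).
  by move=> mq; apply/(measurable_restrictT _ mD).
have mdom : measurable (integrand_domain rho : set (measurableTypeR R * measurableTypeR R * measurableTypeR R)).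
  by apply: measurableX; [apply: measurableX => //|]; exact: measurable_itv.
apply: (eq_measurable_fun (uncurry3 f \o (fun x => ((a \_ D) x, (b \_ D) x, (c \_ D) x)))).
  by move=> x xD; rewrite /uncurry3 /= !patchE xD.
apply: (measurable_comp mdom _ mf).
  move=> _ [x Dx <-]; rewrite /integrand_domain /= !patchE mem_set// !in_itv/= andbT.
  by split; [split => //; exact: a0|exact: c0].
apply: measurable_funTS; apply: measurable_fun_pair; last exact: mr.
by apply: measurable_fun_pair; exact: mr.
Qed.

Section comparison.
Context {R : realType} (n : nat) (rho : R) (rho0 : 0 < rho).
Notation leb := (@lebesgue_measure R).
Notation lrow := (@lebesgue_row R n.+1).
Notation Ball := (@eucl_ball R n.+1 rho).
Notation A := (@annulus R n).
Notation I := (`]0, rho[%classic : set (measurableTypeR R)).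
Notation C := (@polar_cst R n).
Variables (f : R -> R -> R -> \bar R) (f_normal : normal_integrand rho f).

(** The Borel representative replaces f for a.e. radius, which [ae_radial] transfers to a.e. x; then
    [polar_radial] applies, whatever the sign or finiteness of the integrals. *)
Lemma Fball_radial (v : R -> R) : Wrad n.+1 rho v ->
  (C * @Fball R n.+1 rho f (fun x => v (eucl_norm x)) = lrow A * Frad n.+1 rho f v)%E.
Proof.
move=> Wv; have [_ [fh [_ mfh fhE]]] := f_normal.
have [_ gE] := Wrad_W110 rho0 Wv; have [acv _ _] := Wv.
have [mh _ _] := Wrad_derive1 Wv.
pose G s := fh s (v s) `|derive1 v s|.
have mG : measurable_fun I G.
  apply: (measurable_integrand (rho := rho)) => //.
  - exact: AC_loc_measurable.
  - by apply: measurableT_comp.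
  - by move=> s; rewrite /= in_itv/= => /andP[/ltW -> /ltW ->].
have aeI : {ae leb, forall s : R, 0 < s -> s < rho -> f s (v s) `|derive1 v s| = G s}.
  move: fhE; apply: filterS; first exact: (ae_filter_ringOfSetsType leb).
  by move=> s hs s0 sr; rewrite /G hs// in_itv/= !ltW.
have -> : @Fball R n.+1 rho f (fun x => v (eucl_norm x)) =
    (\int[lrow]_(x in Ball) G (eucl_norm x))%E.
  apply: ae_eq_integralT; apply: filterS3 gE (ae_radial n aeI) (@ae_neq0 R n) => x gx aex x0 Bx.
  rewrite gx// aex// lt_neqAle eucl_norm_ge0 andbT eq_sym.
  by apply: contra x0 => /eqP/eucl_norm_eq0 ->.
rewrite polar_radial//; congr (_ * _)%E.
apply: (@ae_eq_integralT _ _ _ leb).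
move: aeI; apply: filterS; first exact: (ae_filter_ringOfSetsType leb).
by move=> s hs; rewrite /= in_itv/= => /andP[s0 sr]; rewrite hs.
Qed.

Lemma Frad_le_Fball (w : 'rV[R]_n.+1 -> R) : ae_nondecreasing rho f -> W110 Ball w ->
  (-oo < @Fball R n.+1 rho f w)%E -> (@Fball R n.+1 rho f w < +oo)%E ->
  exists2 v : R -> R, Wrad n.+1 rho v & (lrow A * Frad n.+1 rho f v <= C * @Fball R n.+1 rho f w)%E.
Proof.
move=> fmono Ww Fnoo Foo; have [_ [fh [_ mfh fhE]]] := f_normal.
have mB : measurable Ball by exact: measurable_eucl_ball.
have mA := @measurable_annulus R n.
have [[iw gw] _] := Ww; have wg : weak_gradient Ball w (grad Ball w) := getPex gw.
have mw : measurable_fun Ball w by case/integrableP: iw => /measurable_EFinP.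
have mg i : measurable_fun Ball (fun x => grad Ball w x ord0 i).
  by have [/integrableP[/measurable_EFinP]] := wg i.
have mgn : measurable_fun Ball (fun x => eucl_norm (grad Ball w x)) by exact: measurable_eucl_norm_row.
pose F x := fh (eucl_norm x) (w x) (eucl_norm (grad Ball w x)).
have mF : measurable_fun Ball F.
  apply: (measurable_integrand (rho := rho)) => //.
  - by apply: measurable_funTS; exact: measurable_eucl_norm.
  - by move=> x Bx; rewrite eucl_norm_ge0 ltW.
  - by move=> x _; exact: eucl_norm_ge0.
have fhE' : {ae leb, forall r : R, 0 < r -> r < rho -> forall t s, 0 <= s -> fh r t s = f r t s}.
  move: fhE; apply: filterS; first exact: (ae_filter_ringOfSetsType leb).
  by move=> s hs s0 sr; apply: hs; rewrite in_itv/= !ltW.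
have aeF : {ae lrow, forall x, Ball x -> f (eucl_norm x) (w x) (eucl_norm (grad Ball w x)) = F x}.
  apply: filterS2 (ae_radial n fhE') (@ae_neq0 R n) => x aex x0 Bx.
  rewrite /F aex// ?eucl_norm_ge0// lt_neqAle eucl_norm_ge0 andbT eq_sym.
  by apply: contra x0 => /eqP/eucl_norm_eq0 ->.
have FE : @Fball R n.+1 rho f w = (\int[lrow]_(x in Ball) F x)%E by exact: ae_eq_integralT.
rewrite FE in Fnoo Foo *.
have C0 := @polar_cst_gt0 R n; have Cfin := @polar_cst_fin R n.
have A0 := @lebesgue_row_annulus_gt0 R n; have Afin := @lebesgue_row_annulus_fin R n.
have J_int (H : 'rV[R]_n.+1 -> \bar R) : measurable_fun Ball H -> (forall x, 0 <= H x)%E ->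
    (\int[lrow]_(x in Ball) H x < +oo)%E ->
    lrow.-integrable A (ray_integral rho H) /\
    (\int[lrow]_(y in A) ray_integral rho H y = C * \int[lrow]_(x in Ball) H x)%E.
  move=> mH H0 Hoo; have [mJ JE] := ray_integral_polar mH H0; split => //.
  apply/integrableP; split => //.
  under eq_integral => y _ do rewrite gee0_abs ?ray_integral_ge0//.
  by rewrite JE lte_mul_pinfty//; exact: ltW.
have Fp0 : (0 <= \int[lrow]_(x in Ball) funepos F x)%E by apply: integral_ge0.
have Fn0 : (0 <= \int[lrow]_(x in Ball) funeneg F x)%E by apply: integral_ge0.
(* An infinite positive or negative part would make the integral +oo or -oo, with +oo - +oo =
   -oo. *)
have [Fpoo Fnegoo] : (\int[lrow]_(x in Ball) funepos F x < +oo)%E /\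
    (\int[lrow]_(x in Ball) funeneg F x < +oo)%E.
  move: Fnoo Foo; rewrite integralE.
  move: (\int[lrow]_(x in Ball) funepos F x)%E (\int[lrow]_(x in Ball) funeneg F x)%E Fp0 Fn0.
  by move=> [p| |] [m| |]//=; rewrite ?ltry.
have [iJp JpE] := J_int _ (measurable_funepos mF) (funepos_ge0 F) Fpoo.
have [iJn JnE] := J_int _ (measurable_funeneg mF) (funeneg_ge0 F) Fnegoo.
have aeR : {ae lrow, forall x, Ball x -> (f (eucl_norm x) (w x)
    `|\sum_i dir x ord0 i * grad Ball w x ord0 i|%R <= F x)%E}.
  apply: filterS2 (ae_nondecreasing_rot rho0 Ww fmono) aeF => x h1 h2 Bx.
  by rewrite -h2//; exact: h1.
have aey : {ae lrow, forall y, A y ->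
    {ae leb, forall s : R, 0 < s -> s < rho -> (f (eucl_norm (s *: dir y)) (w (s *: dir y))
      `|\sum_i dir (s *: dir y) ord0 i * grad Ball w (s *: dir y) ord0 i|%R <= F (s *: dir y))%E} /\
    exists2 v : R -> R, Wrad n.+1 rho v &
      {ae leb, forall s : R, 0 < s -> s < rho -> v s = w (s *: dir y) /\
        derive1 v s = \sum_i dir y ord0 i * grad Ball w (s *: dir y) ord0 i}}.
  apply: filterS2 (ae_polar aeR) (ray_Wrad rho0 Ww) => y h1 h2 Ay.
  by split; [exact: h1|exact: h2].
(* The averaged quantity is the difference of the ray integrals of the positive and negative parts,
   as both are integrable over the annulus. *)
have [y [Ay [Py [v Wv vE]] mean]] := ae_le_mean mA A0 Afin (integrableB mA iJp iJn) aey.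
exists v => //.
move: mean; rewrite integralB// JpE JnE -[C]fineK// -EFin_mulB ?fine_gt0 ?C0 ?ltey_eq ?Cfin//.
rewrite fineK// -integralE; apply: le_trans; apply: lee_wpmul2l; first exact: ltW.
apply: (@le_trans _ _ (\int[leb]_(s in `]0%R, rho[) ((s ^+ n)%:E * F (s *: dir y)%R))%E).
  apply: (@ae_le_integral _ _ _ leb).
  move: vE Py; apply: filterS2; first exact: (ae_filter_ringOfSetsType leb).
  move=> s vs Ps; rewrite /= in_itv/= => /andP[s0 sr]; have [-> ->] := vs s0 sr.
  apply: lee_wpmul2l; first by rewrite lee_fin exprn_ge0// ltW.
  have dE : dir (s *: dir y) = dir y.
    by rewrite -[LHS]/((eucl_norm (s *: dir y))^-1 *: (s *: dir y)) eucl_norm_ray// scalerA mulVf ?gt_eqF// scale1r.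
  by have := Ps s0 sr; rewrite dE eucl_norm_ray.
rewrite integralE; apply: leeB; apply: (@le_integralT _ _ _ leb) => s; rewrite /= in_itv/= => /andP[s0 _].
  by rewrite !funeposE maxe_pMr ?mule0// lee_fin exprn_ge0// ltW.
by rewrite !funenegE maxe_pMr ?mule0 ?muleN// lee_fin exprn_ge0// ltW.
Qed.

End comparison.

Theorem corollary3p3 (R : realType) (N : nat) (rho : R)
    (f : R -> R -> R -> \bar R)
    (N_ge1 : (1 <= N)%N) (rho_gt0 : 0 < rho)
    (f_proper : proper_on (integrand_domain rho) (uncurry3 f))
    (f_normal : normal_integrand rho f)
    (f_nondecreasing : ae_nondecreasing rho f)
    (F_proper : proper_on (W110 (eucl_ball rho)) (@Fball R N rho f))
    (Frad_proper : proper_on (Wrad N rho) (Frad N rho f)) :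
  has_minimizer (W110 (eucl_ball rho)) (@Fball R N rho f) <->
  has_minimizer (Wrad N rho) (Frad N rho f).
Proof.
case: N N_ge1 F_proper Frad_proper => // n _ [F_noo [w0 Ww0 w0oo]] _.
have C0 := @polar_cst_gt0 R n; have Cfin := @polar_cst_fin R n.
have A0 := @lebesgue_row_annulus_gt0 R n; have Afin := @lebesgue_row_annulus_fin R n.
(* Both constants are positive and finite, so they cancel from inequalities even between infinite
   values. *)
have cancelA x y : (lebesgue_row n.+1 (@annulus R n) * x <= lebesgue_row n.+1 (@annulus R n) * y)%E -> (x <= y)%E.
  by rewrite lee_pmul2l.
have cancelC x y : (@polar_cst R n * x <= polar_cst n * y)%E -> (x <= y)%E by rewrite lee_pmul2l.
split=> [[u Wu umin]|[v Wv vmin]].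
- have uoo := le_lt_trans (umin w0 Ww0) w0oo.
  have [v Wv vu] := Frad_le_Fball rho_gt0 f_normal f_nondecreasing Wu (F_noo u Wu) uoo.
  exists v; first exact: Wv.
  move=> v' Wv'; apply: cancelA; apply: (le_trans vu).
  rewrite -[leRHS](Fball_radial rho_gt0 f_normal Wv'); apply: lee_wpmul2l; first exact: ltW.
  by apply: umin; have [] := Wrad_W110 rho_gt0 Wv'.
- exists (fun x => v (eucl_norm x)); first by have [] := Wrad_W110 rho_gt0 Wv.
  move=> w Ww; have [woo|] := ltP (@Fball R n.+1 rho f w) +oo%E; last first.
    by rewrite leye_eq => /eqP ->; exact: leey.
  have [v' Wv' v'w] := Frad_le_Fball rho_gt0 f_normal f_nondecreasing Ww (F_noo w Ww) woo.
  apply: cancelC; apply: le_trans v'w.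
  rewrite [leLHS](Fball_radial rho_gt0 f_normal Wv).
  by apply: lee_wpmul2l; [exact: ltW|exact: vmin].
Qed.
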